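(* Let $0<\alpha<n$, let $0<q_1,q_2<\infty$, and let $\vec p_1=(p_{11},\dots,p_{1n})$, $\vec p_2=(p_{21},\dots,p_{2n})$ satisfy $\frac n{q_1}\le\sum_{i=1}^n\frac1{p_{1i}}$, $\frac n{q_2}\le\sum_{i=1}^n\frac1{p_{2i}}$ and at least one of the following: (a) $1<\vec p_1\le\vec p_2<\infty$, $\vec p_1\ne\vec p_2$, $\sum_{i=1}^n\frac1{p_{1i}}-\sum_{i=1}^n\frac1{p_{2i}}\le\alpha<n$; (b) $0<\vec p_2<\vec p_1\le\infty$, $\vec p_1>1$, $0<\alpha<n$; (c) $0<\vec p_2<\infty$, $1<\vec p_1<\infty$, $\sum_{i=1}^n\left(\frac1{p_{1i}}-\frac1{p_{2i}}\right)_+<\alpha<n$. Moreover, suppose that $$\frac1{q_2}=\frac1{q_1}-\frac\alpha n.$$ Then there is a constant $C>0$ such that for all $f\in\mathcal M_{\vec p_1}^{q_1}(\mathbb R^n)$, $$\|I_\alpha f\|_{\mathcal M_{\vec p_2}^{q_2}(\mathbb R^n)}\le C\|f\|_{\mathcal M_{\vec p_1}^{q_1}(\mathbb R^n)}.$$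
   Context: Inequalities between tuples, or between a tuple and a number, are componentwise; $1/\infty=0$; $t_+=t$ if $t>0$ and $0$ otherwise. The mixed Lebesgue quasi-norm $\|f\|_{L_{\vec p}(\mathbb R^n)}$, $0<\vec p\le\infty$, is obtained by taking successively the $L_{p_1}(\mathbb R)$-norm in $x_1$, ..., the $L_{p_n}(\mathbb R)$-norm in $x_n$, in that order. For $\vec p\in(0,\infty]^n$ and $q\in(0,\infty]$ with $\sum_{j=1}^n\frac1{p_j}\ge\frac nq$, the mixed Morrey space $\mathcal M_{\vec p}^q(\mathbb R^n)$ is the set of measurable $f$ with $$\|f\|_{\mathcal M_{\vec p}^q(\mathbb R^n)}=\sup\Big\{|Q|^{\frac1q-\frac1n\sum_{j=1}^n\frac1{p_j}}\|f\chi_Q\|_{L_{\vec p}(\mathbb R^n)}:\ Q\text{ a cube in }\mathbb R^n\text{ with sides parallel to the axes}\Big\}<\infty.$$ $I_\alpha f(x)=\int_{\mathbb R^n}\frac{f(y)}{|x-y|^{n-\alpha}}\,dy$. *)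

(* Defs.v *)
From HB Require Import structures.
From mathcomp Require Import all_boot all_order all_algebra.
From mathcomp Require Import all_classical all_reals all_analysis.
From mathcomp Require Import measurable_realfun.

Set Implicit Arguments.
Unset Strict Implicit.
Unset Printing Implicit Defensive.

Import Order.TTheory GRing.Theory Num.Theory.
Import numFieldNormedType.Exports.

Local Open Scope classical_set_scope.
Local Open Scope ring_scope.

(* As a measurable type, R^n carries the product, i.e. Borel, sigma-algebra. *)
Notation Rn R n := (n.-tuple (measurableTypeR R)).

Definition vcons (R : realType) (n : nat) (z : measurableTypeR R * Rn R n) :
  Rn R n.+1 := [tuple of z.1 :: z.2].

Section vcons_measure.
Context (R : realType) (n : nat) (mu : {sigma_finite_measure set (Rn R n) -> \bar R}).

Lemma measurable_vcons : measurable_fun [set: _] (@vcons R n).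
Proof. by apply: measurable_cons; [exact: measurable_fst | exact: measurable_snd]. Qed.

Definition vcons_measure : set (Rn R n.+1) -> \bar R :=
  pushforward (lebesgue_measure \x mu)%E (@vcons R n).

Let pm : {measure set (Rn R n.+1) -> \bar R} :=
  measure_function_pushforward__canonical__measure_function_Measure
    (lebesgue_measure \x mu)%E measurable_vcons.

HB.instance Definition _ := isMeasure.Build _ _ _ vcons_measure
  (measure0 pm) (measure_ge0 pm) (@measure_semi_sigma_additive _ _ _ pm).

Let vcons_measure_sigma_finite : sigma_finite setT vcons_measure.
Proof.
pose h (t : Rn R n.+1) : measurableTypeR R * Rn R n := (thead t, [tuple of behead t]).
have mh : measurable_fun setT h.
  apply/measurable_fun_pair => /=; first exact: (measurable_tnth ord0).
  exact: measurable_behead.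
have hK z : h (vcons z) = z.
  by case: z => x t; rewrite /h /vcons theadE; congr pair; exact: val_inj.
have /sigma_finiteP[F [TF ndF Foo]] := sigma_finiteT (@lebesgue_measure R).
have /sigma_finiteP[G [TG ndG Goo]] := sigma_finiteT mu.
exists (fun i => h @^-1` (F i `*` G i)).
  rewrite -preimage_bigcup -[LHS](preimage_setT h); congr (_ @^-1` _).
  apply/seteqP; split=> [[x y] _|//].
  have [i _ Fx] : (\bigcup_i F i) x by rewrite -TF.
  have [j _ Gy] : (\bigcup_i G i) y by rewrite -TG.
  exists (maxn i j) => //; split.
    by move: x Fx; exact/subsetPset/ndF/leq_maxl.
  by move: y Gy; exact/subsetPset/ndG/leq_maxr.
move=> i; have [mF Fi] := Foo i; have [mG Gi] := Goo i; split.
  by rewrite -[X in measurable X]setTI; apply: mh => //; exact: measurableX.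
rewrite /vcons_measure /pushforward -comp_preimage.
rewrite (_ : h \o _ = id); last by apply/funext => z /=; rewrite hK.
by rewrite preimage_id product_measure1E// lte_mul_pinfty// ge0_fin_numE.
Qed.

HB.instance Definition _ := Measure_isSigmaFinite.Build _ _ _ vcons_measure
  vcons_measure_sigma_finite.

End vcons_measure.

Fixpoint lebesgueRn (R : realType) (n : nat) :
    {sigma_finite_measure set (Rn R n) -> \bar R} :=
  match n with
  | 0 => \d_([tuple] : Rn R 0)
  | m.+1 => @vcons_measure R m (lebesgueRn R m)
  end.

(* The L_{p_1}-norm in x_1 is innermost: (tnth p 0) is applied first. *)
Fixpoint mixed_norm (R : realType) (n : nat) :
    n.-tuple (\bar R) -> (Rn R n -> \bar R) -> \bar R :=
  match n with
  | 0 => fun _ f => `|f [tuple]|%E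
  | m.+1 => fun p f =>
      mixed_norm [tuple of behead p]
        (fun t : Rn R m => Lnorm lebesgue_measure (thead p)
           (fun x => f (vcons (x, t))))
  end.

(* Sum of the reciprocals 1/p_j, with 1/oo = 0 ([inve +oo = 0]); meaningful for
   0 < p, where every (p_j)^-1 is a finite number. *)
Definition sum_recip (R : realType) (n : nat) (p : n.-tuple (\bar R)) : R :=
  \sum_(j < n) fine (tnth p j)^-1%E.

Definition cube (R : realType) (n : nat) (a : Rn R n) (l : R) : set (Rn R n) :=
  [set x | forall i, tnth a i <= tnth x i <= tnth a i + l].

Definition is_cube (R : realType) (n : nat) (Q : set (Rn R n)) : Prop :=
  exists (a : Rn R n) (l : R), 0 < l /\ Q = cube a l.

Definition morrey_norm (R : realType) (n : nat) (p : n.-tuple (\bar R))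
    (q : \bar R) (f : Rn R n -> \bar R) : \bar R :=
  ereal_sup [set
    (lebesgueRn R n Q `^ (fine q^-1 - n%:R^-1 * sum_recip p)
     * mixed_norm p (fun x => f x * (\1_Q x)%:E))%E
    | Q in @is_cube R n].

(* Lebesgue (not merely Borel) measurability. *)
Definition lebesgue_measurable (R : realType) (n : nat) (f : Rn R n -> R) : Prop :=
  forall B : set (measurableTypeR R), measurable B ->
    completed_algebra_gen (lebesgueRn R n) (f @^-1` B).

Definition morrey_space (R : realType) (n : nat) (p : n.-tuple (\bar R))
    (q : \bar R) (f : Rn R n -> R) : Prop :=
  lebesgue_measurable f /\ (morrey_norm p q (EFin \o f) < +oo)%E.

Definition eucl_dist (R : realType) (n : nat) (x y : Rn R n) : R :=
  Num.sqrt (\sum_(i < n) (tnth x i - tnth y i) ^+ 2).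

(* The library's integral is the integral of the positive part minus that of the
   negative part, with oo - oo = -oo. Hence it is infinite exactly where it fails
   to converge absolutely, and finiteness of a norm of I_alpha f includes absolute
   convergence almost everywhere. At y = x the quotient is 0 instead of undefined,
   which only affects a null set. *)
Definition riesz_potential (R : realType) (n : nat) (alpha : R) (f : Rn R n -> R)
    (x : Rn R n) : \bar R :=
  (\int[lebesgueRn R n]_y (f y / (eucl_dist x y `^ (n%:R - alpha))%R)%:E)%E.

(* Main.v *)
Require Import Defs.
From HB Require Import structures.
From mathcomp Require Import all_boot all_order all_algebra.
From mathcomp Require Import all_classical all_reals all_analysis.
From mathcomp Require Import measurable_realfun ess_sup_inf.
From mathcomp Require Import ring lra zify.

(** Why the theorem holds.

The absolute value of a Riesz potential is at most the potential of the absolute value, and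
a Lebesgue measurable function agrees with a Borel function off a null set, so the matter is
an inequality for nonnegative Borel functions (riesz_morrey_bound). In each of the three cases
there are finite exponents p and s with 1 < p <= s, different from each other, such that p <= p1,
p2 <= s, and the order alpha' = sum (1/p - 1/s) is at most alpha; where p2 <= p1 throughout, s
is p raised slightly (raise_exponent). By Hölder's inequality on cubes, p1 may be
replaced by p and p2 by s, at the price of powers of the side that the Morrey norms compensate.

Fix a cube Q of side l and split f at a dilate of Q. The mass outside is cut into dyadic annuli;
on each the kernel is comparable to a constant, Hölder's inequality bounds the mass by the
Morrey norm, and the resulting series is geometric with ratio 2 ^ (- n / q2), so it converges
because q2 is finite (far_potential). For the mass inside, all distances are at most a multiple
of l, so the kernel is at most a power of l times the kernel of order alpha', and what remains is
the Hardy-Littlewood-Sobolev inequality from L_p to L_s for mixed norms (local_potential). The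
powers of l from both parts agree because 1/q2 = 1/q1 - alpha/n (morrey_potential).

For the mixed-norm inequality the kernel is made discrete. Two points of a cube at distance d
above the mesh lie in a common dyadic cube of side at most 6 d, for one of 2 ^ n translates of a
dyadic grid (shifted_grids). So the truncated potential is at most a sum of dyadic potentials of
the masses of cells (potential_le_steps), averaging over cells is bounded in mixed norms
(dnorm_cell_integral), all powers of the mesh cancel, and Fatou's lemma removes the truncation. It
remains to bound, uniformly in the number of scales, the potential on a finite grid whose kernel is
a power of the dyadic distance (dyadic_hls).

There, variables are peeled off from the inside. A variable with p = s is handled by Schur's
test, one with p < s by the one-dimensional inequality; in both cases the kernel of the same
problem for the other variables is left over, until these all have p = s. In this last case the
fractional integration in the innermost variable, done by Hedberg's comparison with the maximal
function, has to be carried through outer variables with arbitrary exponents, where the maximal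
function gives nothing directly. Written as a bilinear form summed over the scales, the potential
admits sparse domination: a bound for a single outer exponent implies a bound by the product of
two maximal functions, hence one for every outer exponent (sparse_core, extrapolate). Choosing each
time the exponent of the next variable as the single one, all outer variables are absorbed
(form_chain). *)

Set Implicit Arguments.
Unset Strict Implicit.
Unset Printing Implicit Defensive.

Import Order.TTheory GRing.Theory Num.Theory.
Import numFieldNormedType.Exports.

Local Open Scope classical_set_scope.
Local Open Scope ring_scope.

(** * Norms on finite sets *)

HB.lock Definition lp {R : realType} (T : finType) (p : R) (f : T -> R) : R :=
  (\sum_x f x `^ p) `^ p^-1.
Canonical lp_unlockable := Unlockable lp.unlock.
Arguments lp {R T} p f.

Notation nneg f := (forall x, 0 <= f x).

Section Lp.
Context {R : realType}.
Implicit Types (p q : R).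

Lemma powRK p (a : R) : p != 0 -> 0 <= a -> (a `^ p) `^ p^-1 = a.
Proof. by move=> p0 a0; rewrite -powRrM mulfV// powRr1. Qed.

Lemma powRVK p (a : R) : p != 0 -> 0 <= a -> (a `^ p^-1) `^ p = a.
Proof. by move=> p0 a0; rewrite -powRrM mulVf// powRr1. Qed.

Lemma ler_powR_pow p (a b : R) : 0 < p -> 0 <= a -> a <= b -> a `^ p <= b `^ p.
Proof.
move=> p0 a0 ab; apply: ge0_ler_powR; rewrite ?nnegrE ?(ltW p0)//.
exact: le_trans ab.
Qed.

Lemma ler_powR_inv p (a b : R) : 0 < p -> 0 <= a -> 0 <= b -> a `^ p <= b `^ p -> a <= b.
Proof.
move=> p0 a0 b0 ab; rewrite -(powRK (lt0r_neq0 p0) a0) -(powRK (lt0r_neq0 p0) b0).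
by apply: ler_powR_pow => //; rewrite ?invr_gt0// powR_ge0.
Qed.

Section fixT.
Context (T : finType).
Implicit Types f g h : T -> R.

Lemma lpE p f : lp p f = (\sum_x f x `^ p) `^ p^-1.
Proof. by rewrite lp.unlock. Qed.

Lemma lp_ge0 p f : 0 <= lp p f.
Proof. by rewrite lp.unlock; exact: powR_ge0. Qed.

Lemma sum_powR_ge0 p f : 0 <= \sum_x f x `^ p.
Proof. by apply: sumr_ge0 => x _; exact: powR_ge0. Qed.

Lemma lp_pow p f : 0 < p -> lp p f `^ p = \sum_x f x `^ p.
Proof. by move=> p0; rewrite lp.unlock powRVK ?lt0r_neq0// sum_powR_ge0. Qed.

Lemma le_lp p f g : 0 < p -> nneg f -> (forall x, f x <= g x) -> lp p f <= lp p g.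
Proof.
move=> p0 f0 fg; rewrite lp.unlock; apply: ler_powR_pow; rewrite ?invr_gt0 ?sum_powR_ge0//.
by apply: ler_sum => x _; exact: ler_powR_pow.
Qed.

Lemma lpZ p f (c : R) : 0 < p -> 0 <= c -> nneg f ->
  lp p (fun x => c * f x) = c * lp p f.
Proof.
move=> p0 c0 f0; rewrite lp.unlock; under eq_bigr do rewrite powRM//.
by rewrite -mulr_sumr powRM ?powR_ge0 ?sum_powR_ge0// powRK ?lt0r_neq0.
Qed.

Lemma eq_lp p f g : f =1 g -> lp p f = lp p g.
Proof. by move=> fg; rewrite lp.unlock; under eq_bigr do rewrite fg. Qed.

Lemma le1_lp p f x : 0 < p -> nneg f -> f x <= lp p f.
Proof.
move=> p0 f0; apply: (@ler_powR_inv p) => //; first exact: lp_ge0.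
rewrite lp_pow// (bigD1 x)//= lerDl; apply: sumr_ge0 => *; exact: powR_ge0.
Qed.

Lemma lp_eq0 p f : 0 < p -> nneg f -> lp p f = 0 -> forall x, f x = 0.
Proof.
by move=> p0 f0 lf0 x; apply/eqP; rewrite eq_le f0 andbT -lf0 le1_lp.
Qed.

Lemma hoelder_lp p q f g : 0 < p -> 0 < q -> p^-1 + q^-1 = 1 ->
  nneg f -> nneg g -> \sum_x f x * g x <= lp p f * lp q g.
Proof.
move=> p0 q0 pq f0 g0.
have [lf|lf] := eqVneq (lp p f) 0.
  by rewrite lf mul0r big1// => x _; rewrite (lp_eq0 p0 f0 lf) mul0r.
have [lg|lg] := eqVneq (lp q g) 0.
  by rewrite lg mulr0 big1// => x _; rewrite (lp_eq0 q0 g0 lg) mulr0.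
have lf0 : 0 < lp p f by rewrite lt0r lf lp_ge0.
have lg0 : 0 < lp q g by rewrite lt0r lg lp_ge0.
have lfg0 := mulr_gt0 lf0 lg0.
suff H : \sum_x f x * g x / (lp p f * lp q g) <= 1.
  by move: H; rewrite -mulr_suml ler_pdivrMr// mul1r.
have -> : 1 = \sum_x (f x / lp p f) `^ p / p + \sum_x (g x / lp q g) `^ q / q.
  rewrite -!mulr_suml.
  under eq_bigr do rewrite powRM ?invr_ge0 ?lp_ge0//.
  under [in X in _ + X]eq_bigr do rewrite powRM ?invr_ge0 ?lp_ge0//.
  rewrite -!mulr_suml -!lp_pow// -!powRM ?invr_ge0 ?lp_ge0// !mulfV//.
  by rewrite !powR1 !mul1r.
rewrite -big_split/=; apply: ler_sum => x _.
have -> : f x * g x / (lp p f * lp q g) = (f x / lp p f) * (g x / lp q g).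
  by rewrite invfM mulrACA.
by apply: conjugate_powR => //; rewrite divr_ge0// ltW.
Qed.

(** The norm is attained on the extremizer of Hölder's inequality. *)
Lemma lp_dual p q f : 1 < p -> 0 < q -> p^-1 + q^-1 = 1 -> nneg f ->
  exists g, [/\ nneg g, lp q g <= 1 & \sum_x f x * g x = lp p f].
Proof.
move=> p1 q0 pq f0.
have p0 : 0 < p by rewrite (lt_trans _ p1).
have [lf|lf] := eqVneq (lp p f) 0.
  exists (fun=> 0); split => //; last first.
    by rewrite lf big1// => x _; rewrite mulr0.
  rewrite lp.unlock big1 ?powR0 ?ler01 ?invr_eq0 ?gt_eqF// => x _.
have lf0 : 0 < lp p f by rewrite lt0r lf lp_ge0.
have fn0 x : 0 <= f x / lp p f by rewrite divr_ge0// ltW.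
have sum1 : \sum_x (f x / lp p f) `^ p = 1.
  under eq_bigr do rewrite powRM ?invr_ge0 ?lp_ge0//.
  by rewrite -mulr_suml -lp_pow// -powRM ?invr_ge0 ?lp_ge0// mulfV// powR1.
have qE : (p - 1) * q = p.
  have := pq; have p0' := lt0r_neq0 p0; have q0' := lt0r_neq0 q0.
  move=> /(congr1 (fun z => z * (p * q))).
  by rewrite mulrDl mul1r mulKf// mulrCA mulVf// mulr1 mulrBl mul1r => <-; ring.
exists (fun x => (f x / lp p f) `^ (p - 1)); split.
- by move=> x; exact: powR_ge0.
- rewrite lpE; under eq_bigr do rewrite -powRrM qE.
  by rewrite sum1 powR1.
- transitivity (\sum_x lp p f * (f x / lp p f) `^ p).
    apply: eq_bigr => x _; rewrite -[in RHS](@mulr_powRB1 _ (f x / lp p f) p)//.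
    by rewrite mulrA [lp p f * _]mulrC divfK.
  by rewrite -mulr_sumr sum1 mulr1.
Qed.

(** By duality, the triangle inequality is Hölder's inequality term by term. *)
Lemma minkowski_lp (I : Type) (r : seq I) p (c : I -> R) (F : I -> T -> R) :
  1 < p -> (forall i, 0 <= c i) -> (forall i, nneg (F i)) ->
  lp p (fun x => \sum_(i <- r) c i * F i x) <= \sum_(i <- r) c i * lp p (F i).
Proof.
move=> p1 c0 F0; have p0 : 0 < p by rewrite (lt_trans _ p1).
have q0 : 0 < (1 - p^-1)^-1 by rewrite invr_gt0 subr_gt0 invf_lt1.
have pq : p^-1 + (1 - p^-1)^-1^-1 = 1 by rewrite invrK; ring.
have S0 : nneg (fun x => \sum_(i <- r) c i * F i x).
  by move=> x; apply: sumr_ge0 => i _; exact: mulr_ge0.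
have [g [g0 g1 <-]] := lp_dual p1 q0 pq S0.
under eq_bigr do rewrite mulr_suml.
rewrite exchange_big/=; apply: ler_sum => i _.
under eq_bigr do rewrite -mulrA.
rewrite -mulr_sumr; apply: ler_wpM2l => //.
apply: (le_trans (hoelder_lp p0 q0 pq (F0 i) g0)).
by rewrite -[leRHS]mulr1; apply: ler_wpM2l => //; exact: lp_ge0.
Qed.

End fixT.
End Lp.
Arguments powRK {R} p a.

Section Dual.
Context {R : realType}.
Implicit Types p : R.

Definition dual p := p / (p - 1).

Lemma dual_gt1 p : 1 < p -> 1 < dual p.
Proof. by move=> p1; rewrite /dual ltr_pdivlMr ?subr_gt0// mul1r ltrBlDr ltrDl. Qed.

Lemma dualK p : 1 < p -> dual (dual p) = p.
Proof.
move=> p1; have p10 : p - 1 != 0 by rewrite subr_eq0 gt_eqF.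
rewrite /dual; have -> : p / (p - 1) - 1 = (p - 1)^-1 by field.
by field.
Qed.

Lemma dual_conj p : 1 < p -> p^-1 + (dual p)^-1 = 1.
Proof.
move=> p1; have p10 : p - 1 != 0 by rewrite subr_eq0 gt_eqF.
have p0 : p != 0 by rewrite gt_eqF// (lt_trans _ p1).
by rewrite /dual; field; rewrite ?p0 ?p10.
Qed.

Lemma dual_mul p : 1 < p -> (p - 1) * dual p = p.
Proof. by move=> p1; rewrite /dual mulrC divfK// subr_eq0 gt_eqF. Qed.

End Dual.

(** * Averages over nested partitions *)

Section Tree.
Context {R : realType} (U : finType) (e : nat -> rel U).

Definition avg m (h : U -> R) u : R :=
  (\sum_(v | e m u v) h v) / #|e m u|%:R.

Definition saturated m (h : U -> R) := forall u v, e m u v -> h u = h v.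

(** Nested partitions of a finite set into cells, single points at scale 0, with [D]
bounding the growth of a cell from one scale to the next. This is the structure common to
the dyadic intervals, to their products, and to the point, among which the variables of a
mixed norm are exchanged one by one. *)
Record tree (D : R) : Prop := Tree {
  tree_equiv : forall m, equivalence_rel (e m) ;
  tree0 : forall u v, e 0%N u v = (u == v) ;
  treeS : forall m u v, e m u v -> e m.+1 u v ;
  tree_D1 : 1 <= D ;
  tree_doubling : forall m u, #|e m.+1 u|%:R <= D * #|e m u|%:R }.

Definition tmax a b h u := \big[Num.max/0]_(a <= m < b) avg m h u.

Context (D : R) (T : tree D).

Let equiv := tree_equiv T.
Implicit Types f g h : U -> R.

Lemma tree_refl m u : e m u u.
Proof. by have [] := equiv m u u u. Qed.

Lemma tree_eql m u v : e m u v -> e m u =1 e m v.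
Proof. by move=> uv w; have [_ /(_ uv)] := equiv m u v w. Qed.

Lemma tree_sym m u v : e m u v = e m v u.
Proof.
by apply/idP/idP => h; [rewrite -(tree_eql h) tree_refl|rewrite -(tree_eql h) tree_refl].
Qed.

Lemma tree_le m n u v : (m <= n)%N -> e m u v -> e n u v.
Proof.
move=> /subnK <-; elim: (n - m)%N => [//|k IH] uv.
by rewrite addSn; apply: (treeS T); exact: IH.
Qed.

Lemma card_cell_gt0 m u : 0 < #|e m u|%:R :> R.
Proof. by rewrite ltr0n; apply/card_gt0P; exists u; exact: tree_refl. Qed.

Lemma card_cellE m u v : e m u v -> #|e m u| = #|e m v|.
Proof. by move=> uv; apply: eq_card => w; exact: tree_eql. Qed.

Lemma sat_le m n h : (m <= n)%N -> saturated n h -> saturated m h.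
Proof. by move=> mn sh u v uv; apply: sh; exact: tree_le uv. Qed.

Lemma avg_ge0 m h : nneg h -> nneg (avg m h).
Proof. by move=> h0 u; rewrite divr_ge0 ?ler0n// sumr_ge0. Qed.

Lemma le_avg m f g u : (forall v, e m u v -> f v <= g v) -> avg m f u <= avg m g u.
Proof.
by move=> fg; rewrite ler_pM2r ?invr_gt0 ?card_cell_gt0//; exact: ler_sum.
Qed.

Lemma eq_avg m f g u : (forall v, e m u v -> f v = g v) -> avg m f u = avg m g u.
Proof. by move=> fg; rewrite /avg; under eq_bigr => v uv do rewrite fg//. Qed.

Lemma avgD m f g u : avg m (fun v => f v + g v) u = avg m f u + avg m g u.
Proof. by rewrite /avg big_split mulrDl. Qed.

Lemma avg_sum I (r : seq I) (P : pred I) m (F : I -> U -> R) u :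
  avg m (fun v => \sum_(i <- r | P i) F i v) u = \sum_(i <- r | P i) avg m (F i) u.
Proof. by rewrite /avg exchange_big/= mulr_suml. Qed.

Lemma avg_sat m f : saturated m (avg m f).
Proof.
move=> u v uv; rewrite /avg (card_cellE uv); congr (_ / _).
by apply: eq_bigl => w; exact: tree_eql.
Qed.

Lemma avgMr m f h u : saturated m h -> avg m (fun v => f v * h v) u = avg m f u * h u.
Proof.
move=> sh; rewrite /avg mulrAC; congr (_ / _); rewrite mulr_suml.
by apply: eq_bigr => v uv; rewrite (sh _ _ uv).
Qed.

Lemma avg_id m h u : saturated m h -> avg m h u = h u.
Proof.
move=> sh; rewrite /avg (eq_bigr (fun=> h u)); last by move=> v /sh.
by rewrite sumr_const -[X in X / _]mulr_natr mulfK// gt_eqF// card_cell_gt0.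
Qed.

Lemma avg0 h u : avg 0 h u = h u.
Proof. by apply: avg_id => x y; rewrite (tree0 T) => /eqP ->. Qed.

Lemma avg_adj m f g : \sum_u avg m f u * g u = \sum_u f u * avg m g u.
Proof.
transitivity (\sum_u \sum_v (if e m u v then f v * g u / #|e m u|%:R else 0)).
  apply: eq_bigr => u _; rewrite /avg -big_mkcond/= -mulrA mulr_suml.
  by apply: eq_bigr => v _; rewrite [_^-1 * _]mulrC mulrA.
rewrite exchange_big/=; apply: eq_bigr => u _; rewrite -big_mkcond/= /avg mulrA mulr_sumr.
rewrite mulr_suml; apply: eq_big => [v|v vu]; first by rewrite tree_sym.
by rewrite (card_cellE vu).
Qed.

Lemma sum_sat m W f : saturated m W -> \sum_u W u * avg m f u = \sum_u W u * f u.
Proof.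
move=> sW; rewrite -avg_adj; apply: eq_bigr => u _.
by rewrite avg_id.
Qed.

Lemma avg_tower i m F u : (i <= m)%N -> avg m (avg i F) u = avg m F u.
Proof.
move=> im; rewrite /avg; congr (_ / _); rewrite -!/(avg _ _ _).
pose W v : R := (e m u v)%:R.
have sW : saturated i W.
  by move=> x y /(tree_le im) xy; rewrite /W ![e m u _]tree_sym (tree_eql xy).
have E (G : U -> R) : \sum_(v | e m u v) G v = \sum_v W v * G v.
  rewrite big_mkcond; apply: eq_bigr => v _; rewrite /W.
  by case: ifP; rewrite ?mul1r ?mul0r.
by rewrite !E -(sum_sat F sW).
Qed.

Lemma sat_sum_le m W F G : saturated m W -> nneg W ->
  (forall u, \sum_(v | e m u v) F v <= \sum_(v | e m u v) G v) ->
  \sum_u W u * F u <= \sum_u W u * G u.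
Proof.
move=> sW W0 FG; rewrite -(sum_sat F sW) -(sum_sat G sW).
apply: ler_sum => u _; apply: ler_wpM2l => //.
by rewrite ler_pM2r ?invr_gt0 ?card_cell_gt0.
Qed.

Lemma avg_step m h u : nneg h -> avg m h u <= D * avg m.+1 h u.
Proof.
move=> h0; have S0 : 0 <= \sum_(v | e m u v) h v by exact: sumr_ge0.
have c1 := card_cell_gt0 m u; have c2 := card_cell_gt0 m.+1 u.
apply: (@le_trans _ _ ((\sum_(v | e m u v) h v) * (D / #|e m.+1 u|%:R))).
  apply: ler_wpM2l => //; rewrite ler_pdivlMr// mulrC ler_pdivrMr//.
  exact: (tree_doubling T).
rewrite /avg [leRHS]mulrCA; apply: ler_wpM2r.
  rewrite divr_ge0 ?ler0n// (le_trans ler01)//; exact: (tree_D1 T).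
rewrite [leLHS]big_mkcond [leRHS]big_mkcond; apply: ler_sum => v _.
by case: ifPn => [/(treeS T) ->//|_]; case: ifPn.
Qed.

Lemma tmax_ge0 a b h u : 0 <= tmax a b h u.
Proof.
rewrite /tmax; elim: (index_iota a b) => [|m s IH]; first by rewrite big_nil.
by rewrite big_cons le_max IH orbT.
Qed.

Lemma le_tmax a b h u m : (a <= m < b)%N -> avg m h u <= tmax a b h u.
Proof.
move=> amb; rewrite /tmax; have : m \in index_iota a b by rewrite mem_index_iota.
elim: (index_iota a b) => [//|x s IH]; rewrite inE big_cons le_max => /orP[/eqP ->|/IH ->].
  by rewrite lexx.
by rewrite orbT.
Qed.

Lemma tmax_leP a b h u c : 0 <= c ->
  (forall m, (a <= m < b)%N -> avg m h u <= c) -> tmax a b h u <= c.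
Proof.
move=> c0 hc; rewrite /tmax big_seq; elim/big_ind: _ => //.
  by move=> x y xc yc; rewrite ge_max xc.
by move=> m; rewrite mem_index_iota => /hc.
Qed.

Lemma tmax_recl a b h u : (a < b)%N ->
  tmax a b h u = Num.max (avg a h u) (tmax a.+1 b h u).
Proof. by move=> ab; rewrite /tmax big_ltn. Qed.

Lemma tmax_sat a b h : saturated a (tmax a b h).
Proof.
move=> u v uv; rewrite /tmax big_seq [RHS]big_seq; apply: eq_bigr => m.
rewrite mem_index_iota => /andP[am _].
by apply: avg_sat; exact: tree_le uv.
Qed.

(** Young's inequality, arranged so that the sum over scales telescopes on both sides. *)
Lemma doob_step p (x y : R) : 1 < p -> 0 <= x -> x <= y ->
  y `^ p - x `^ p <= dual p * (y `^ (p - 1) - x `^ (p - 1)) * y.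
Proof.
move=> p1 x0 xy; have y0 := le_trans x0 xy.
have p0 : 0 < p by rewrite (lt_trans _ p1).
have d0 : 0 < dual p by rewrite (lt_trans _ (dual_gt1 p1)).
have := conjugate_powR (powR_ge0 x (p - 1)) y0 d0 p0.
rewrite addrC => /(_ (dual_conj p1)); rewrite -powRrM dual_mul//.
have yp : y `^ (p - 1) * y = y `^ p by rewrite mulrC mulr_powRB1.
have dp : dual p / p = dual p - 1.
  have p10 : p - 1 != 0 by rewrite subr_eq0 gt_eqF.
  by rewrite /dual; field; rewrite p10 gt_eqF.
rewrite -(ler_pM2l d0) mulrDr.
have -> : dual p * (x `^ p / dual p) = x `^ p by rewrite mulrC divfK// gt_eqF.
have -> : dual p * (y `^ p / p) = (dual p - 1) * y `^ p by rewrite -dp; ring.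
move=> H; rewrite -[leRHS]mulrA mulrBl yp; lra.
Qed.

(** Doob's maximal inequality, by telescoping the powers of the maximal function
of the scales coarser than [k]. *)
Lemma doob p b h : 1 < p -> nneg h -> lp p (tmax 0 b h) <= dual p * lp p h.
Proof.
move=> p1 h0; pose M k := tmax k b h.
have p0 : 0 < p by rewrite (lt_trans _ p1).
have q0 : 0 < dual p by rewrite (lt_trans _ (dual_gt1 p1)).
have M0 k u : 0 <= M k u by exact: tmax_ge0.
have step k : (k < b)%N -> \sum_u (M k u `^ p - M k.+1 u `^ p) <=
   dual p * \sum_u (M k u `^ (p - 1) - M k.+1 u `^ (p - 1)) * h u.
  move=> kb.
  have sW : saturated k (fun u => M k u `^ (p - 1) - M k.+1 u `^ (p - 1)).
    move=> u v uv; rewrite /M (tmax_sat b h uv).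
    by rewrite (sat_le (leqnSn k) (@tmax_sat k.+1 b h) uv).
  rewrite -(sum_sat h sW) mulr_sumr; apply: ler_sum => u _.
  have := tmax_recl h u kb; rewrite -/(M k u) -/(M k.+1 u).
  have [le_a|lt_a] := leP (avg k h u) (M k.+1 u).
    by move=> ->; rewrite !subrr mul0r mulr0.
  by move=> Mk; rewrite mulrA -Mk; apply: doob_step => //; rewrite Mk ltW.
have : \sum_(0 <= k < b) \sum_u (M k u `^ p - M k.+1 u `^ p) <=
   \sum_(0 <= k < b) dual p * \sum_u (M k u `^ (p - 1) - M k.+1 u `^ (p - 1)) * h u.
  rewrite big_nat [leRHS]big_nat; apply: ler_sum => k /andP[_ kb]; exact: step.
have Mb u : M b u = 0 by rewrite /M /tmax big_geq.
have telescope (G : nat -> U -> R) : \sum_(0 <= k < b) \sum_u (G k u - G k.+1 u)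
   = \sum_u (G 0 u - G b u).
  rewrite exchange_big/=; apply: eq_bigr => u _.
  rewrite -[RHS]opprB -(telescope_sumr (fun k => G k u))// -sumrN.
  by apply: eq_bigr => k _; rewrite opprB.
rewrite telescope -mulr_sumr.
under [in X in _ * X]eq_bigr do under eq_bigr do rewrite mulrBl.
rewrite (telescope (fun k u => M k u `^ (p - 1) * h u)).
under eq_bigr do rewrite Mb powR0 ?gt_eqF// subr0.
under [in X in _ * X]eq_bigr do rewrite Mb powR0 ?subr_eq0 ?gt_eqF// mul0r subr0.
move=> H.
have hq : (dual p)^-1 + p^-1 = 1 by rewrite addrC dual_conj.
have := hoelder_lp q0 p0 hq (fun u => powR_ge0 (M 0%N u) (p - 1)) h0.
move=> /(ler_wpM2l (ltW q0)) /(le_trans H); rewrite -lp_pow//.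
have -> : lp (dual p) (fun u => M 0%N u `^ (p - 1)) = lp p (M 0%N) `^ (p - 1).
  rewrite !lpE; under eq_bigr do rewrite -powRrM dual_mul//.
  rewrite -powRrM; congr (_ `^ _); rewrite /dual.
  have p10 : p - 1 != 0 by rewrite subr_eq0 gt_eqF.
  by field; rewrite p10 gt_eqF.
have [->|lM] := eqVneq (lp p (M 0%N)) 0.
  by move=> _; apply: mulr_ge0; rewrite ?(ltW q0)// lp_ge0.
have lM0 : 0 < lp p (M 0%N) by rewrite lt0r lM lp_ge0.
rewrite -(mulr_powRB1 (lp_ge0 _ _) p0) mulrCA [leRHS]mulrC ler_pM2r ?powR_gt0//.
Qed.

(** A point is stopped at the largest scale below [j] at which [P] fails. *)
Definition unstopped (P : nat -> U -> bool) j m u := all (P^~ u) (index_iota m j).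
Definition unstoppedR P j m u : R := (unstopped P j m u)%:R.
Definition stopped P j i u : R := unstoppedR P j i.+1 u - unstoppedR P j i u.

Lemma unstopped_recl P j m u : (m < j)%N -> unstopped P j m u = P m u && unstopped P j m.+1 u.
Proof. by move=> mj; rewrite /unstopped /index_iota -subnSK. Qed.

Lemma unstopped_top P j u : unstopped P j j u.
Proof. by rewrite /unstopped /index_iota subnn. Qed.

Lemma unstopped_at P j m u : (m < j)%N -> unstopped P j m u -> P m u.
Proof. by move=> mj; rewrite unstopped_recl// => /andP[]. Qed.

Lemma unstopped_mono P j m n u : (m <= n <= j)%N -> unstopped P j m u -> unstopped P j n u.
Proof.
move=> /andP[mn nj] /allP h; apply/allP => i; rewrite mem_index_iota => /andP[ni ij].
by apply: h; rewrite mem_index_iota ij (leq_trans mn ni).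
Qed.

Lemma unstopped_sat P j m u v : (forall i u v, e i u v -> P i u = P i v) ->
  e m u v -> unstopped P j m u = unstopped P j m v.
Proof.
move=> sP uv; apply: eq_in_all => i; rewrite mem_index_iota => /andP[mi _].
by apply: sP; exact: tree_le uv.
Qed.

Lemma stopped_ge0 P j i u : (i < j)%N -> 0 <= stopped P j i u.
Proof.
move=> ij; rewrite subr_ge0 ler_nat; have := @unstopped_mono P j i i.+1 u.
by rewrite leqnSn ij => /(_ isT); case: (unstopped P j i u) => // ->.
Qed.

Lemma stopped_sat P j i : (forall i u v, e i u v -> P i u = P i v) ->
  saturated i (stopped P j i).
Proof.
move=> sP u v uv; rewrite /stopped /unstoppedR (unstopped_sat _ sP uv).
by rewrite (unstopped_sat _ sP (treeS T uv)).
Qed.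

Lemma sum_stopped P j m u : (m <= j)%N ->
  \sum_(m <= i < j) stopped P j i u = 1 - unstoppedR P j m u.
Proof.
move=> mj; rewrite /stopped (telescope_sumr (fun i => unstoppedR P j i u))//.
by rewrite /unstoppedR unstopped_top.
Qed.

Lemma sum_stopped_lt P j m u : (m <= j)%N ->
  \sum_(0 <= i < m) stopped P j i u = unstoppedR P j m u - unstoppedR P j 0 u.
Proof. by move=> mj; rewrite /stopped (telescope_sumr (fun i => unstoppedR P j i u)). Qed.

(** The weak-type maximal inequality on a cell: on the part stopped at a scale, the average
over the cell of that scale exceeds the threshold. *)
Lemma weak_type j h u0 (c : R) : 0 <= c -> nneg h ->
  c * \sum_(u | e j u0 u) (1 - unstoppedR (fun i u => avg i h u <= c) j 0 u) <=
  \sum_(u | e j u0 u) h u.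
Proof.
move=> c0 h0; pose P i u := avg i h u <= c; rewrite -/P.
have sP i u v : e i u v -> P i u = P i v by move=> uv; rewrite /P (avg_sat h uv).
pose X v : R := (e j u0 v)%:R.
have sX i : (i <= j)%N -> saturated i X.
  by move=> ij x y /(tree_le ij) xy; rewrite /X ![e j u0 _]tree_sym (tree_eql xy).
have E (G : U -> R) : \sum_(v | e j u0 v) G v = \sum_v X v * G v.
  rewrite big_mkcond; apply: eq_bigr => v _; rewrite /X.
  by case: ifP; rewrite ?mul1r ?mul0r.
rewrite !E; under eq_bigr do rewrite -sum_stopped// mulr_sumr.
rewrite exchange_big/= mulr_sumr.
apply: (@le_trans _ _ (\sum_(0 <= i < j) \sum_u X u * stopped P j i u * h u)).
  rewrite big_nat [leRHS]big_nat; apply: ler_sum => i /andP[_ ij].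
  have sXW : saturated i (fun u => X u * stopped P j i u).
    by move=> x y xy; rewrite (sX _ (ltnW ij) _ _ xy) (stopped_sat _ sP xy).
  rewrite -(sum_sat h sXW) mulr_sumr; apply: ler_sum => u _.
  rewrite mulrC; have [Pu|] := boolP (P i u).
    by rewrite /stopped /unstoppedR (unstopped_recl P u ij) Pu/= subrr mulr0 !mul0r.
  by rewrite /P -ltNge => /ltW cu; apply: ler_wpM2l => //;
    rewrite mulr_ge0 ?stopped_ge0// ler0n.
rewrite exchange_big/=; apply: ler_sum => u _.
rewrite -mulr_suml -mulr_sumr sum_stopped// -mulrA; apply: ler_wpM2l; first exact: ler0n.
rewrite ler_piMl// gerBl /unstoppedR ler0n//.
Qed.

End Tree.

(** * Sparse domination and extrapolation *)

Lemma sum_nat_triangle (R : nmodType) (F : nat -> nat -> R) j :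
  \sum_(0 <= m < j) \sum_(m <= i < j) F m i = \sum_(0 <= i < j) \sum_(0 <= m < i.+1) F m i.
Proof.
elim: j => [|j IH]; first by rewrite !big_geq.
rewrite [RHS]big_nat_recr//= -IH big_nat_recr//= [in RHS]big_nat_recr//=.
rewrite addrA -big_split/=; congr (_ + _); last by rewrite big_nat1.
by rewrite big_nat [RHS]big_nat; apply: eq_bigr => m /andP[_ mj]; rewrite big_nat_recr//= ltnW.
Qed.

Section Extrapolate.
Context {R : realType} (V : Type).

(** The values of the functions below are themselves functions, of the variables that are
not indexed by the tree, and these functionals measure them. *)
Record sublinear (N : (V -> R) -> R) : Prop := Sublinear {
  sublinear_ge0 : forall f, nneg f -> 0 <= N f ;
  sublinear_sum : forall (I : Type) (r : seq I) (c : I -> R) (F : I -> V -> R),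
    nneg c -> (forall i, nneg (F i)) ->
    N (fun v => \sum_(i <- r) c i * F i v) <= \sum_(i <- r) c i * N (F i) }.

Context (U : finType) (e : nat -> rel U) (D : R) (T : tree e D).

Definition vavg m (f : U -> V -> R) u v := avg e m (fun u => f u v) u.

Lemma vavg_ge0 m f : (forall u, nneg (f u)) -> forall u, nneg (vavg m f u).
Proof. by move=> f0 u v; apply: avg_ge0. Qed.

Lemma sublinear_avg N m f u : sublinear N -> (forall u, nneg (f u)) ->
  N (vavg m f u) <= avg e m (fun u => N (f u)) u.
Proof.
move=> sN f0; pose c := #|e m u|%:R^-1 : R.
have c0 : 0 <= c by rewrite invr_ge0 ler0n.
have -> : vavg m f u = (fun v => \sum_(w <- [seq w <- index_enum U | e m u w]) c * f w v).
  by apply/funext => v; rewrite big_filter -mulr_sumr mulrC.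
apply: (le_trans (sublinear_sum sN _ (fun _ => c0) f0)).
by rewrite big_filter -mulr_sumr mulrC.
Qed.

Context (N1 N2 : (V -> R) -> R) (sN1 : sublinear N1) (sN2 : sublinear N2).
Context (lam : nat -> (V -> R) -> (V -> R) -> R).
Hypothesis lam0 : forall m (f g : V -> R), nneg f -> nneg g -> 0 <= lam m f g.

(** Cells of all scales contribute, each as many times as it has points. *)
Definition form K (f g : U -> V -> R) : R :=
  \sum_(0 <= m < K.+1) \sum_u lam m (vavg m f u) (vavg m g u).

Context (K : nat) (c0 C0 : R) (c01 : 1 < c0) (C00 : 0 <= C0).
Hypothesis bound0 : forall f g : U -> V -> R, (forall u, nneg (f u)) -> (forall u, nneg (g u)) ->
  form K f g <= C0 * lp c0 (fun u => N1 (f u)) * lp (dual c0) (fun u => N2 (g u)).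

Implicit Types (P : nat -> U -> bool) (f g : U -> V -> R).

(** The function [f] on the unstopped part of a cell, and its average over the stopping cell
on the rest; the summand of index 0 is the unstopped part. The result has the averages of
[f] at all scales that are not yet stopped, but is bounded. *)
Definition corona (P : nat -> U -> bool) j u0 (f : U -> V -> R) u v : R :=
  \sum_(0 <= k < j.+1)
    ((e j u0 u)%:R * (if k is i.+1 then stopped P j i u else unstoppedR P j 0 u)) *
    vavg k.-1 f u v.

Let w P j u k : R := if k is i.+1 then stopped P j i u else unstoppedR P j 0 u.

Let w_ge0 P j u k : (k < j.+1)%N -> 0 <= w P j u k.
Proof. by case: k => [_|k kj]; rewrite ?ler0n//; apply: stopped_ge0. Qed.

Let sum_w P j u : \sum_(0 <= k < j.+1) w P j u k = 1.
Proof. by rewrite big_nat_recl//= sum_stopped// addrC subrK. Qed.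

Lemma corona_ge0 P j u0 f : (forall u, nneg (f u)) -> forall u, nneg (corona P j u0 f u).
Proof.
move=> f0 u v; rewrite /corona big_nat sumr_ge0// => k /andP[_ kj].
by rewrite mulr_ge0 ?vavg_ge0// mulr_ge0 ?ler0n// (w_ge0 P u kj).
Qed.

Lemma corona_avg P j u0 f m u : (forall i u v, e i u v -> P i u = P i v) ->
  (m <= j)%N -> e j u0 u -> unstopped P j m u ->
  vavg m (corona P j u0 f) u = vavg m f u.
Proof.
move=> sP mj u0u gu; apply/funext => v; rewrite /vavg.
pose h u := f u v.
transitivity (avg e m (fun u => unstoppedR P j 0 u * h u +
    \sum_(0 <= i < m) stopped P j i u * avg e i h u) u).
  apply: (eq_avg (e := e)) => u' uu'.
  have u0u' : e j u0 u' by rewrite (tree_eql T u0u) (tree_le T mj uu').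
  have gu' : unstopped P j m u' by rewrite -(unstopped_sat T j sP uu').
  rewrite /corona u0u' big_nat_recl//= mul1r -/(h u').
  rewrite /vavg (avg0 T); congr (_ + _).
  rewrite (@big_cat_nat _ _ _ m)//= [X in _ + X]big1_seq ?addr0; last first.
    move=> i /=; rewrite mem_index_iota => /andP[mi ij].
    rewrite mul1r /stopped /unstoppedR (unstopped_mono _ gu') ?(unstopped_mono _ gu') ?subrr ?mul0r//.
      by rewrite mi ltnW.
    by rewrite (leq_trans mi) ?ij.
  by apply: eq_bigr => i _; rewrite mul1r.
rewrite avgD avg_sum.
transitivity (avg e m (fun u => unstoppedR P j 0 u * h u) u +
    \sum_(0 <= i < m) avg e m (fun u => stopped P j i u * h u) u).
  congr (_ + _); rewrite big_nat [RHS]big_nat; apply: eq_bigr => i /andP[_ im].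
  rewrite -[RHS](avg_tower T _ _ (ltnW im)); apply: (eq_avg (e := e)) => x _.
  rewrite mulrC -(@avgMr _ _ e); last exact: (stopped_sat T _ sP).
  by apply: (eq_avg (e := e)) => y _; rewrite mulrC.
rewrite -avg_sum -avgD; apply: (eq_avg (e := e)) => u' uu'.
have gu' : unstopped P j m u' by rewrite -(unstopped_sat T j sP uu').
rewrite -mulr_suml -mulrDl sum_stopped_lt// addrC subrK.
by rewrite /unstoppedR gu' mul1r.
Qed.

(** The average over a stopping cell is out of control, but its parent is not stopped, and
doubling compares the two. *)
Lemma corona_norm P j u0 f N (a : R) : sublinear N -> (forall u, nneg (f u)) ->
  0 <= a ->
  (forall m u, (m <= j)%N -> e j u0 u -> unstopped P j m u -> avg e m (fun u => N (f u)) u <= a) ->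
  forall u, N (corona P j u0 f u) <= D * a * (e j u0 u)%:R.
Proof.
move=> sN f0 a0 ha u.
have Nf0 u' : 0 <= N (f u') by exact: sublinear_ge0.
have D1 := tree_D1 T; have D0 := le_trans ler01 D1.
rewrite /corona.
pose c k : R := if (k < j.+1)%N then (e j u0 u)%:R * w P j u k else 0.
have c0' : nneg c.
  by move=> k; rewrite /c; case: ifP => // kj; rewrite mulr_ge0 ?ler0n ?w_ge0.
have := sublinear_sum sN (index_iota 0 j.+1) c0' (fun k => @vavg_ge0 k.-1 f f0 u).
set L := N _; set L' := N _.
have -> : L = L'.
  congr N; apply/funext => v; rewrite big_nat [RHS]big_nat; apply: eq_bigr => k /andP[_ kj].
  by rewrite /c kj.
move=> /le_trans; apply.
have [u0u|nu] := boolP (e j u0 u); last first.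
  rewrite mulr0 big1// => k _; rewrite /c (negbTE nu).
  by case: ifP => _; rewrite ?mul0r.
rewrite mulr1 -[leRHS]mulr1 -(sum_w P j u) mulr_sumr big_nat [leRHS]big_nat.
apply: ler_sum => k /andP[_ kj]; rewrite /c kj u0u mul1r [leRHS]mulrC.
have wk0 := w_ge0 P u kj.
have [w0|w0] := eqVneq (w P j u k) 0; first by rewrite w0 !mul0r.
apply: ler_wpM2l => //; apply: (le_trans (sublinear_avg _ _ sN f0)).
case: k kj wk0 w0 => [|i] ij wk0 w0 /=.
  apply: le_trans (_ : a <= _); last by rewrite ler_peMl.
  apply: ha => //; move: w0; rewrite /w /= /unstoppedR; by case: unstopped; rewrite ?eqxx.
apply: (le_trans (avg_step T i u Nf0)); apply: ler_wpM2l => //.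
apply: ha => //; move: w0; rewrite /w /= /stopped /unstoppedR; case: (boolP (unstopped P j i.+1 u)) => // ng.
by rewrite unstopped_recl// (negbTE ng) andbF subrr eqxx.
Qed.

Lemma lp_cell c j u0 (F : U -> R) (a : R) : 1 < c -> 0 <= a -> nneg F ->
  (forall u, F u <= a * (e j u0 u)%:R) ->
  lp c F <= a * #|e j u0|%:R `^ c^-1.
Proof.
move=> c1 a0 F0 Fa; have c0' : 0 < c by rewrite (lt_trans _ c1).
apply: (le_trans (le_lp c0' F0 Fa)); rewrite lpZ//.
apply: ler_wpM2l => //; rewrite lpE.
rewrite (eq_bigr (fun u => (e j u0 u)%:R)) => [|u _]; last first.
  by case: (e j u0 u); rewrite ?powR1 ?powR0// gt_eqF.
by rewrite -natr_sum -big_mkcond/= sum1_card.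
Qed.

Section core.
Context (f g : U -> V -> R).
Hypothesis (f0 : forall u, nneg (f u)) (g0 : forall u, nneg (g u)).
Let Nf u := N1 (f u).
Let Ng u := N2 (g u).
Let L m u := lam m (vavg m f u) (vavg m g u).
Let S j u := \sum_(0 <= m < j.+1) L m u.
Let Q j u := tmax e 0 j.+1 Nf u * tmax e 0 j.+1 Ng u.

Let Nf0 : nneg Nf. Proof. by move=> u; apply: sublinear_ge0. Qed.
Let Ng0 : nneg Ng. Proof. by move=> u; apply: sublinear_ge0. Qed.
Let L0 m u : 0 <= L m u. Proof. by apply: lam0; apply: vavg_ge0. Qed.

(** Sparse domination, by induction on the scale. Above the stopping scale, the form only
sees the bounded functions [corona], for which the known bound becomes the size of the cell
times a product of two averages, since the outer exponents are conjugate.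
Below it, the induction hypothesis applies to the stopping cells. The loss is paid for by
the unstopped half of the cell. *)
Lemma sparse_core B : B = 32 * D ^+ 2 * C0 -> forall j u0, (j <= K)%N ->
  \sum_(u | e j u0 u) S j u <= B * \sum_(u | e j u0 u) Q j u.
Proof.
move=> BE; elim/ltn_ind => j IH u0 jK.
have D1 := tree_D1 T; have D0 := le_trans ler01 D1.
have B0 : 0 <= B by rewrite BE !mulr_ge0// exprn_ge0.
pose a := avg e j Nf u0; pose b := avg e j Ng u0.
have a0 : 0 <= a by apply: avg_ge0.
have b0 : 0 <= b by apply: avg_ge0.
pose Pf i u := avg e i Nf u <= 4 * a.
pose Pg i u := avg e i Ng u <= 4 * b.
pose P i u := Pf i u && Pg i u.
have sP i u v : e i u v -> P i u = P i v.
  by move=> uv; rewrite /P /Pf /Pg !(avg_sat T _ uv).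
pose X v : R := (e j u0 v)%:R.
have X0 : nneg X by move=> v; exact: ler0n.
have sX i : (i <= j)%N -> saturated e i X.
  by move=> ij x y /(tree_le T ij) xy; rewrite /X ![e j u0 _](tree_sym T) (tree_eql T xy).
have E (G : U -> R) : \sum_(v | e j u0 v) G v = \sum_v X v * G v.
  rewrite big_mkcond; apply: eq_bigr => v _; rewrite /X.
  by case: ifP; rewrite ?mul1r ?mul0r.
have Q0 i u : 0 <= Q i u by rewrite mulr_ge0 ?tmax_ge0.
have Qmono i u : (i <= j)%N -> Q i u <= Q j u.
  move=> ij; apply: ler_pM; rewrite ?tmax_ge0//.
    apply: tmax_leP; rewrite ?tmax_ge0// => m /andP[_ mi]; apply: le_tmax.
    by rewrite (leq_trans mi).
  apply: tmax_leP; rewrite ?tmax_ge0// => m /andP[_ mi]; apply: le_tmax.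
  by rewrite (leq_trans mi).
(* the scales above the stopping one, and those not above it *)
have SE u : S j u = \sum_(0 <= m < j.+1) unstoppedR P j m u * L m u +
                    \sum_(0 <= i < j) stopped P j i u * S i u.
  transitivity (\sum_(0 <= m < j.+1) (unstoppedR P j m u * L m u +
      \sum_(m <= i < j) stopped P j i u * L m u)).
    rewrite /S big_nat [RHS]big_nat; apply: eq_bigr => m /andP[_ mj].
    by rewrite -mulr_suml sum_stopped// -mulrDl addrC subrK mul1r.
  rewrite big_split/=; congr (_ + _); rewrite big_nat_recr//= [X in _ + X]big_geq// addr0.
  by rewrite sum_nat_triangle; apply: eq_bigr => i _; rewrite -mulr_sumr.
have lower : \sum_u X u * (\sum_(0 <= i < j) stopped P j i u * S i u) <=
    B * \sum_u X u * ((1 - unstoppedR P j 0 u) * Q j u).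
  under eq_bigr do rewrite mulr_sumr.
  rewrite exchange_big/=.
  apply: (@le_trans _ _ (\sum_(0 <= i < j) B * \sum_u X u * stopped P j i u * Q j u)).
    rewrite big_nat [leRHS]big_nat; apply: ler_sum => i /andP[_ ij].
    have sXW : saturated e i (fun u => X u * stopped P j i u).
      by move=> x y xy; rewrite (sX _ (ltnW ij) _ _ xy) (stopped_sat T _ sP xy).
    have XW0 u : 0 <= X u * stopped P j i u by rewrite mulr_ge0 ?stopped_ge0.
    under eq_bigr do rewrite mulrA.
    have IHi u : \sum_(v | e i u v) S i v <= \sum_(v | e i u v) B * Q i v.
      by rewrite -mulr_sumr; apply: IH => //; rewrite (leq_trans (ltnW ij)).
    apply: (le_trans (sat_sum_le T sXW XW0 IHi)); rewrite mulr_sumr.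
    apply: ler_sum => u _; rewrite mulrCA; apply: ler_wpM2l => //; apply: ler_wpM2l => //.
    by apply: Qmono; exact: ltnW.
  rewrite -mulr_sumr; apply: ler_wpM2l => //; rewrite exchange_big/=.
  by apply: ler_sum => u _; rewrite -mulr_suml -mulr_sumr sum_stopped// -mulrA.
have upper : \sum_u X u * (\sum_(0 <= m < j.+1) unstoppedR P j m u * L m u) <=
    C0 * (D * (4 * a) * (D * (4 * b)) * \sum_u X u).
  set F := corona P j u0 f; set G := corona P j u0 g.
  have F0 u : nneg (F u) by exact: corona_ge0.
  have G0 u : nneg (G u) by exact: corona_ge0.
  apply: (@le_trans _ _ (form K F G)).
    under eq_bigr do rewrite mulr_sumr.
    rewrite exchange_big/= /form [leRHS](@big_cat_nat _ _ _ j.+1)//=.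
    apply: ler_wpDr; first by apply: sumr_ge0 => m _; apply: sumr_ge0 => u _;
      apply: lam0; apply: vavg_ge0.
    rewrite big_nat [leRHS]big_nat; apply: ler_sum => m /andP[_ mj].
    apply: ler_sum => u _; rewrite /X /unstoppedR.
    have lamFG0 : 0 <= lam m (vavg m F u) (vavg m G u) by apply: lam0; apply: vavg_ge0.
    have [u0u|_] := boolP (e j u0 u); last by rewrite mul0r.
    have [gu|_] := boolP (unstopped P j m u); last by rewrite mul0r mulr0.
    by rewrite !mul1r /L /F /G !corona_avg.
  have bnd (h : U -> R) : nneg h -> forall c : R, 0 <= c -> c = avg e j h u0 ->
      (forall i u, P i u -> avg e i h u <= 4 * c) ->
      forall m u, (m <= j)%N -> e j u0 u -> unstopped P j m u -> avg e m h u <= 4 * c.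
    move=> h0 c c0' ch hP m u; rewrite leq_eqVlt => /predU1P[->|mj] u0u gu.
      rewrite -(avg_sat T _ u0u) -ch; lra.
    by apply: hP; exact: unstopped_at gu.
  have NF u : N1 (F u) <= D * (4 * a) * (e j u0 u)%:R.
    apply: corona_norm => //; first by rewrite mulr_ge0.
    by apply: (bnd Nf) => // i v /andP[].
  have NG u : N2 (G u) <= D * (4 * b) * (e j u0 u)%:R.
    apply: corona_norm => //; first by rewrite mulr_ge0.
    by apply: (bnd Ng) => // i v /andP[].
  have a40 : 0 <= D * (4 * a) by exact: mulr_ge0 D0 (mulr_ge0 (ler0n _ 4) a0).
  have b40 : 0 <= D * (4 * b) by exact: mulr_ge0 D0 (mulr_ge0 (ler0n _ 4) b0).
  apply: (le_trans (bound0 F0 G0)); rewrite -mulrA; apply: ler_wpM2l => //.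
  have NF0 u : 0 <= N1 (F u) by exact: sublinear_ge0.
  have NG0 u : 0 <= N2 (G u) by exact: sublinear_ge0.
  have := lp_cell c01 a40 NF0 NF; have := lp_cell (dual_gt1 c01) b40 NG0 NG.
  move=> hG hF; apply: (le_trans (ler_pM (lp_ge0 _ _) (lp_ge0 _ _) hF hG)).
  rewrite mulrACA; apply: ler_wpM2l; first exact: mulr_ge0.
  rewrite -powRD ?dual_conj// ?oner_eq0// powRr1 ?ler0n//.
  by rewrite /X -natr_sum -big_mkcond/= sum1_card.
have Xcard : \sum_u X u = #|e j u0|%:R by rewrite /X -natr_sum -big_mkcond/= sum1_card.
have XNf : \sum_u X u * Nf u = a * \sum_u X u.
  by rewrite Xcard /a /avg divfK ?gt_eqF ?(card_cell_gt0 T)// E.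
have XNg : \sum_u X u * Ng u = b * \sum_u X u.
  by rewrite Xcard /b /avg divfK ?gt_eqF ?(card_cell_gt0 T)// E.
(* each of the thresholds 4 a and 4 b stops at most a quarter of the cell *)
have half : a * b * \sum_u X u <= 2 * \sum_u X u * (unstoppedR P j 0 u * (a * b)).
  have wf : 4 * a * \sum_u X u * (1 - unstoppedR Pf j 0 u) <= a * \sum_u X u.
    by rewrite -XNf -!E; apply: (weak_type T j u0 (mulr_ge0 (ler0n _ 4) a0) Nf0).
  have wg : 4 * b * \sum_u X u * (1 - unstoppedR Pg j 0 u) <= b * \sum_u X u.
    by rewrite -XNg -!E; apply: (weak_type T j u0 (mulr_ge0 (ler0n _ 4) b0) Ng0).
  have : \sum_u X u * (1 - unstoppedR P j 0 u) <=
     \sum_u X u * (1 - unstoppedR Pf j 0 u) + \sum_u X u * (1 - unstoppedR Pg j 0 u).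
    rewrite -big_split/=; apply: ler_sum => u _; rewrite -mulrDr; apply: ler_wpM2l => //.
    by rewrite /unstoppedR /unstopped all_predI; case: all; case: all;
      rewrite /= ?subrr ?subr0 ?addr0 ?add0r ?lerDl ?ler01.
  move=> /(ler_wpM2l (mulr_ge0 a0 b0)).
  move/(ler_wpM2l b0): wf; move/(ler_wpM2l a0): wg.
  have -> : \sum_u X u * (1 - unstoppedR P j 0 u) = \sum_u X u - \sum_u X u * unstoppedR P j 0 u.
    by rewrite -sumrB; apply: eq_bigr => u _; rewrite mulrBr mulr1.
  have -> : \sum_u X u * (unstoppedR P j 0 u * (a * b)) = (\sum_u X u * unstoppedR P j 0 u) * (a * b).
    by rewrite mulr_suml; apply: eq_bigr => u _; rewrite mulrA.
  move: (\sum_u _ * (1 - unstoppedR Pf _ _ _)) (\sum_u _ * (1 - unstoppedR Pg _ _ _)).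
  move: (\sum_u X u * _) (\sum_u X u) => y x z1 z2 h1 h2 h3; nra.
have top : \sum_u X u * (unstoppedR P j 0 u * (a * b)) <= \sum_u X u * (unstoppedR P j 0 u * Q j u).
  apply: ler_sum => u _; rewrite /X; have [u0u|_] := boolP (e j u0 u); last by rewrite !mul0r.
  rewrite !mul1r; apply: ler_wpM2l; first exact: ler0n.
  rewrite /a /b !(avg_sat T _ u0u); apply: ler_pM; rewrite ?avg_ge0//; apply: le_tmax;
  by rewrite ltnSn.
rewrite !E (eq_bigr _ (fun u _ => congr1 (fun z => X u * z) (SE u))).
under eq_bigr do rewrite mulrDr.
rewrite big_split/=; apply: (le_trans (lerD upper lower)).
have -> : \sum_u X u * Q j u = \sum_u X u * (unstoppedR P j 0 u * Q j u) +
    \sum_u X u * ((1 - unstoppedR P j 0 u) * Q j u).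
  rewrite -big_split/=; apply: eq_bigr => u _; ring.
rewrite mulrDr lerD2r BE.
have -> : C0 * (D * (4 * a) * (D * (4 * b)) * \sum_u X u) =
  16 * D ^+ 2 * C0 * (a * b * \sum_u X u) by ring.
have -> : 32 * D ^+ 2 * C0 * \sum_u X u * (unstoppedR P j 0 u * Q j u) =
  16 * D ^+ 2 * C0 * (2 * \sum_u X u * (unstoppedR P j 0 u * Q j u)) by ring.
apply: ler_wpM2l; first by rewrite !mulr_ge0// exprn_ge0.
by apply: (le_trans half); rewrite ler_pM2l.
Qed.

End core.

(** The sparse bound contains only the two maximal functions, which Doob's inequality
controls for all exponents: a bound for one outer exponent gives all of them. *)
Lemma extrapolate c f g : 1 < c -> (forall u, nneg (f u)) -> (forall u, nneg (g u)) ->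
  form K f g <= 32 * D ^+ 2 * C0 * (dual c * c) *
    lp c (fun u => N1 (f u)) * lp (dual c) (fun u => N2 (g u)).
Proof.
move=> c1 f0 g0; set B := 32 * _ * _.
have D1 := tree_D1 T; have D0 := le_trans ler01 D1.
have B0 : 0 <= B by rewrite !mulr_ge0// exprn_ge0.
have Nf0 u : 0 <= N1 (f u) by exact: sublinear_ge0.
have Ng0 u : 0 <= N2 (g u) by exact: sublinear_ge0.
have c0' : 0 < c by rewrite (lt_trans _ c1).
have d1 := dual_gt1 c1; have d0 : 0 < dual c by rewrite (lt_trans _ d1).
have := sat_sum_le T (m := K) (W := fun=> 1) (fun _ _ _ => erefl) (fun=> ler01)
  (fun u => le_trans (sparse_core f0 g0 (erefl B) u (leqnn K)) _).
under eq_bigr do rewrite mul1r.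
rewrite /form exchange_big/= => H.
apply: (le_trans (H (fun u => B * (tmax e 0 K.+1 (fun u => N1 (f u)) u *
   tmax e 0 K.+1 (fun u => N2 (g u)) u)) _)); first by move=> u; rewrite mulr_sumr.
under eq_bigr do rewrite mul1r.
rewrite -mulr_sumr.
apply: (@le_trans _ _ (B * ((dual c * lp c (fun u => N1 (f u))) *
                            (c * lp (dual c) (fun u => N2 (g u)))))); last first.
  by move: (B) (dual c) (lp _ _) (lp _ _) => b d x y; rewrite le_eqVlt; apply/orP; left; apply/eqP; ring.
apply: ler_wpM2l => //.
apply: (le_trans (hoelder_lp c0' d0 (dual_conj c1) _ _)); try by move=> u; exact: tmax_ge0.
have := doob T K.+1 c1 Nf0; have := doob T K.+1 d1 Ng0; rewrite dualK// => h2 h1.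
exact: (ler_pM (lp_ge0 _ _) (lp_ge0 _ _) h1 h2).
Qed.

End Extrapolate.

(** * Geometric sums over scales *)

Section LpPair.
Context {R : realType}.
Implicit Types p : R.

Lemma lpD (T : finType) p (f g : T -> R) : 1 < p -> nneg f -> nneg g ->
  lp p (fun x => f x + g x) <= lp p f + lp p g.
Proof.
move=> p1 f0 g0.
have := minkowski_lp [:: true; false] p1 (fun=> ler01)
  (fun b : bool => if b as b' return nneg (if b' then f else g) then f0 else g0).
rewrite !big_cons !big_nil !mul1r addr0; under eq_lp do rewrite !big_cons !big_nil !mul1r addr0.
by [].
Qed.

Lemma lp_pair (A B : finType) p (F : A * B -> R) : p != 0 ->
  lp p F = lp p (fun u => lp p (fun x => F (x, u))).
Proof.
move=> p0; rewrite !(lpE p); congr (_ `^ _).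
under [RHS]eq_bigr do rewrite lpE powRVK ?sum_powR_ge0//.
rewrite exchange_big/= pair_big/=; by apply: eq_bigr => -[].
Qed.

Lemma powR_geo_le (a b t : R) : 0 <= a -> 0 <= b -> 0 < t < 1 ->
  a `^ (1 - t) * b `^ t <= a + b.
Proof.
move=> a0 b0 /andP[t0 t1]; pose M := Num.max a b.
have M0 : 0 <= M by rewrite le_max a0.
apply: (@le_trans _ _ M); last by rewrite /M ge_max lerDl lerDr a0 b0.
have -> : M = M `^ (1 - t) * M `^ t.
  by rewrite -powRD ?subrK ?powRr1// oner_eq0.
apply: ler_pM; rewrite ?powR_ge0//; apply: ler_powR_pow;
  by rewrite ?subr_gt0 ?le_max ?lexx ?orbT.
Qed.

Lemma powR2_gt1 (d : R) : 0 < d -> 1 < 2 `^ d.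
Proof.
move=> d0; have := @gt0_ltr_powR _ d d0 1 2; rewrite !nnegrE powR1.
by apply; rewrite ?ler01 ?ler0n ?ltr1n.
Qed.

Lemma powR2N_lt1 (d : R) : 0 < d -> 0 <= 2 `^ (- d) < 1.
Proof. by move=> d0; rewrite powR_ge0 powRN invf_lt1 ?powR_gt0// powR2_gt1. Qed.

Lemma geo_sum_lt (w : R) i M : 0 <= w < 1 -> \sum_(i <= m < M) w ^+ m <= w ^+ i / (1 - w).
Proof.
move=> /andP[w0 w1]; have w10 : 0 < 1 - w by rewrite subr_gt0.
have [iM|Mi] := leqP i M; last first.
  by rewrite big_geq ?(ltnW Mi)// divr_ge0 ?exprn_ge0// ltW.
rewrite ler_pdivlMr// mulr_suml.
have E m : w ^+ m * (1 - w) = w ^+ m - w ^+ m.+1 by rewrite exprSr mulrBr mulr1.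
under eq_bigr do rewrite E -opprB.
by rewrite sumrN telescope_sumr// opprB gerBl exprn_ge0.
Qed.

Lemma geo_sum_gt (t : R) M : 1 < t -> \sum_(0 <= m < M.+1) t ^+ m <= t ^+ M * (t / (t - 1)).
Proof.
move=> t1; have t10 : 0 < t - 1 by rewrite subr_gt0.
rewrite mulrA ler_pdivlMr// mulr_suml.
have E m : t ^+ m * (t - 1) = t ^+ m.+1 - t ^+ m by rewrite exprSr mulrBr mulr1.
under eq_bigr do rewrite E.
by rewrite telescope_sumr// exprSr expr0 gerBl ler01.
Qed.

Lemma geo_sum_below (d : R) (rho : R) M : 0 < d -> 0 < rho ->
  \sum_(0 <= m < M | 2 ^+ m <= rho) (2 `^ d) ^+ m <= rho `^ d * (2 `^ d / (2 `^ d - 1)).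
Proof.
move=> d0 r0.
have t1 := powR2_gt1 d0.
have c0 : 0 <= 2 `^ d / (2 `^ d - 1) :> R by rewrite divr_ge0 ?powR_ge0// subr_ge0 ltW.
elim: M => [|M IH]; first by rewrite big_geq// mulr_ge0// powR_ge0.
have [hM|hM] := leP (2 ^+ M) rho; last first.
  by rewrite big_mkcond big_nat_recr//= -big_mkcond/= (lt_geF hM) addr0.
apply: (@le_trans _ _ (\sum_(0 <= m < M.+1) (2 `^ d) ^+ m)).
  by rewrite big_mkcond; apply: ler_sum => m _; case: ifP => // _; rewrite ?exprn_ge0 ?powR_ge0.
apply: (le_trans (geo_sum_gt M t1)); apply: ler_wpM2r => //.
rewrite -powR_mulrn ?powR_ge0// -powRrM mulrC powRrM powR_mulrn//.
by apply: ler_powR_pow => //; rewrite exprn_ge0.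
Qed.

Lemma geo_sum_above (d : R) (rho : R) M : 0 < d -> 0 < rho ->
  \sum_(0 <= m < M | rho < 2 ^+ m) (2 `^ (- d)) ^+ m <= rho `^ (- d) * (1 - 2 `^ (- d))^-1.
Proof.
move=> d0.
have w01 := powR2N_lt1 d0; have /andP[w0 w1] := w01.
have c0 : 0 < (1 - 2 `^ (- d))^-1 :> R by rewrite invr_gt0 subr_gt0.
elim: M rho => [|M IH] rho r0; first by rewrite big_geq// mulr_ge0 ?powR_ge0// ltW.
have [r1|r1] := ltP rho 1.
  apply: (@le_trans _ _ (\sum_(0 <= m < M.+1) (2 `^ (- d)) ^+ m)).
    by rewrite big_mkcond; apply: ler_sum => m _; case: ifP => // _; rewrite ?exprn_ge0 ?powR_ge0.
  apply: (le_trans (geo_sum_lt 0 M.+1 w01)); rewrite expr0; apply: ler_wpM2r; first exact: ltW.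
  rewrite powRN invf_ge1 ?powR_gt0//.
  by apply: (le_trans (ler_powR_pow d0 (ltW r0) (ltW r1))); rewrite powR1.
rewrite big_mkcond big_nat_recl//= expr0 (le_gtF r1) add0r.
have := IH (rho / 2) (divr_gt0 r0 (ltr0n _ 2)).
rewrite powRM ?invr_ge0 ?(ltW r0)// big_mkcond.
have -> : (2^-1 : R) `^ (- d) = (2 `^ (- d))^-1 by rewrite -powR_inv1// powRAC powR_inv1 ?powR_ge0.
move=> /(ler_wpM2l (powR_ge0 2 (- d))).
have -> : 2 `^ (- d) * (rho `^ (- d) / 2 `^ (- d) * (1 - 2 `^ (- d))^-1) =
    rho `^ (- d) * (1 - 2 `^ (- d))^-1 :> R.
  by rewrite mulrA [X in X * _]mulrC divfK// gt_eqF// powR_gt0.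
move/(le_trans _); apply; rewrite mulr_sumr; apply: ler_sum => m _.
rewrite ltr_pdivrMr// exprSr; case: ifP => _; last by rewrite mulr0.
by rewrite exprSr mulrC.
Qed.

Definition hedberg_cst (d h : R) : R := 2 `^ d / (2 `^ d - 1) + (1 - 2 `^ (- h))^-1.

Lemma hedberg_cst_ge0 d h : 0 < d -> 0 < h -> 0 <= hedberg_cst d h.
Proof.
move=> d0 h0; apply: addr_ge0.
  by rewrite divr_ge0 ?powR_ge0// subr_ge0 ltW// powR2_gt1.
by have /andP[_ w1] := powR2N_lt1 h0; rewrite invr_ge0 subr_ge0 ltW.
Qed.

(** Summing the better of a growing and a decaying geometric bound; the two cross at
the scale [rho]. *)
Lemma hedberg_sum (d h a b : R) (X : nat -> R) M : 0 < d -> 0 < h -> 0 <= a -> 0 <= b ->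
  (forall m, (m < M)%N -> X m <= (2 `^ d) ^+ m * a) ->
  (forall m, (m < M)%N -> X m <= (2 `^ (- h)) ^+ m * b) ->
  \sum_(0 <= m < M) X m <=
    hedberg_cst d h * (a `^ (h / (d + h)) * b `^ (d / (d + h))).
Proof.
move=> d0 h0 a0 b0 Xa Xb.
have dh0 : 0 < d + h by exact: addr_gt0.
have RHS0 : 0 <= hedberg_cst d h * (a `^ (h / (d + h)) * b `^ (d / (d + h))).
  by rewrite mulr_ge0 ?hedberg_cst_ge0// mulr_ge0 ?powR_ge0.
have [az|az] := eqVneq a 0.
  apply: le_trans RHS0; rewrite big_nat; apply: sumr_le0 => m /andP[_ mM].
  by rewrite (le_trans (Xa _ mM))// az mulr0.
have [bz|bz] := eqVneq b 0.
  apply: le_trans RHS0; rewrite big_nat; apply: sumr_le0 => m /andP[_ mM].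
  by rewrite (le_trans (Xb _ mM))// bz mulr0.
have {}a0 : 0 < a by rewrite lt0r az.
have {}b0 : 0 < b by rewrite lt0r bz.
pose rho := (b / a) `^ (d + h)^-1.
have r0 : 0 < rho by rewrite powR_gt0// divr_gt0.
set x := a `^ _ * b `^ _.
have Va y : a^-1 `^ y = a `^ (- y) by rewrite -powR_inv1 ?(ltW a0)// -powRrM mulN1r.
have mula (c y : R) : 0 < c -> c * c `^ y = c `^ (1 + y).
  by move=> c0; rewrite powRD ?(gt_eqF c0) ?implybT// powRr1// ltW.
have dh' : d + h != 0 by rewrite gt_eqF.
have xa : a * rho `^ d = x.
  rewrite /rho -powRrM powRM ?invr_ge0 ?(ltW a0) ?(ltW b0)// Va mulrCA mula// mulrC /x.
  by congr (_ `^ _ * _ `^ _); field.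
have xb : b * rho `^ (- h) = x.
  rewrite /rho -powRrM powRM ?invr_ge0 ?(ltW a0) ?(ltW b0)// Va mulrA mula// mulrC /x.
  by congr (_ `^ _ * _ `^ _); field.
rewrite (bigID (fun m => 2 ^+ m <= rho))/= mulrDl; apply: lerD.
  apply: (@le_trans _ _ (\sum_(0 <= m < M | 2 ^+ m <= rho) (2 `^ d) ^+ m * a)).
    by rewrite big_nat_cond [leRHS]big_nat_cond; apply: ler_sum => m /andP[/andP[_ mM] _]; exact: Xa.
  rewrite -mulr_suml -xa mulrCA mulrC; apply: ler_wpM2l; first exact: ltW.
  by rewrite mulrC; exact: geo_sum_below.
apply: (@le_trans _ _ (\sum_(0 <= m < M | ~~ (2 ^+ m <= rho)) (2 `^ (- h)) ^+ m * b)).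
  by rewrite big_nat_cond [leRHS]big_nat_cond; apply: ler_sum => m /andP[/andP[_ mM] _]; exact: Xb.
rewrite -mulr_suml -xb mulrCA mulrC; apply: ler_wpM2l; first exact: ltW.
rewrite mulrC; under eq_bigl do rewrite -ltNge.
exact: geo_sum_above.
Qed.

End LpPair.

(** * Dyadic intervals and Hedberg's argument *)

Section TreeProduct.
Context {R : realType}.

Lemma tree_unit : tree (fun _ (_ _ : unit) => true) (1 : R).
Proof.
split => //= *; rewrite ?mul1r//; by repeat case: (_ : unit).
Qed.

Context (W U : finType) (e1 : nat -> rel W) (e2 : nat -> rel U).

Definition eprod m : rel (W * U) := fun z z' => e1 m z.1 z'.1 && e2 m z.2 z'.2.

Lemma card_eprod m z : #|eprod m z| = (#|e1 m z.1| * #|e2 m z.2|)%N.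
Proof. by rewrite -cardX; apply: eq_card => -[x y]; rewrite !inE. Qed.

Context (D1 D2 : R) (T1 : tree e1 D1) (T2 : tree e2 D2).

Lemma tree_eprod : tree eprod (D1 * D2).
Proof.
have D10 := le_trans ler01 (tree_D1 T1); have D20 := le_trans ler01 (tree_D1 T2).
split.
- move=> m x y z; rewrite /eprod !(tree_refl T1) !(tree_refl T2); split => //.
  by move=> /andP[/(tree_eql T1) -> /(tree_eql T2) ->].
- by move=> [x u] [y v]; rewrite /eprod/= (tree0 T1) (tree0 T2) xpair_eqE.
- by move=> m x y /andP[/(treeS T1) h1 /(treeS T2) h2]; rewrite /eprod h1.
- by rewrite -[1]mulr1; apply: ler_pM => //; [exact: tree_D1 T1|exact: tree_D1 T2].
- move=> m z; rewrite !card_eprod !natrM mulrACA; apply: ler_pM; rewrite ?ler0n//.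
    exact: tree_doubling.
  exact: tree_doubling.
Qed.

Lemma avg_eprod m (h : W * U -> R) w u :
  avg eprod m h (w, u) = avg e1 m (fun w' => avg e2 m (fun u' => h (w', u')) u) w.
Proof.
rewrite /avg card_eprod/= natrM invfM mulrA mulrAC -mulr_suml; congr (_ / _ / _).
rewrite pair_big/=; by apply: eq_big => -[].
Qed.

End TreeProduct.

Section Dyadic.
Context {R : realType} (K : nat).
Notation I := 'I_(2 ^ K).

(** The exponent of the smallest dyadic interval containing two integers. *)
Definition lev (x y : nat) : nat := find (fun m => x %/ 2 ^ m == y %/ 2 ^ m)%N (iota 0 K).

Lemma lev_le (x y : I) m : (lev x y <= m)%N = (x %/ 2 ^ m == y %/ 2 ^ m)%N.
Proof.
have up i j : (i <= j)%N -> (x %/ 2 ^ i == y %/ 2 ^ i)%N -> (x %/ 2 ^ j == y %/ 2 ^ j)%N.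
  by move=> /subnK <- /eqP xy; rewrite addnC expnD !divnMA xy.
have levK : (lev x y <= K)%N by rewrite /lev (leq_trans (find_size _ _))// size_iota.
apply/idP/idP => [|xy].
  have [lK|Kl] := ltnP (lev x y) K.
    move=> lm; apply: up lm _; have /(nth_find 0%N) : has (fun m => x %/ 2 ^ m == y %/ 2 ^ m)%N (iota 0 K).
      by rewrite has_find size_iota.
    by rewrite nth_iota.
  by move=> /(leq_trans Kl)/up; apply; rewrite !divn_small.
have [mK|Km] := ltnP m K; last exact: leq_trans levK Km.
rewrite leqNgt; apply/negP => /(before_find 0%N); rewrite nth_iota// add0n.
by move/eqP: xy => ->; rewrite eqxx.
Qed.

Lemma lev_leK (x y : I) : (lev x y <= K)%N.
Proof. by rewrite lev_le !divn_small. Qed.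

Definition same_block m : rel I := fun x y => (lev x y <= m)%N.

Lemma card_same_block m (x : I) : (m <= K)%N -> #|same_block m x| = (2 ^ m)%N.
Proof.
move=> mK; set c := (x %/ 2 ^ m)%N.
have e0 : (0 < 2 ^ m)%N by rewrite expn_gt0.
have cK : (c.+1 * 2 ^ m <= 2 ^ K)%N.
  have /subnK KE := mK; rewrite -{1}KE expnD leq_pmul2r// /c ltn_divLR//.
  by rewrite -expnD KE ltn_ord.
have inj j : (j < 2 ^ m -> c * 2 ^ m + j < 2 ^ K)%N.
  by move=> jm; apply: leq_trans cK; rewrite mulSn addnC ltn_add2r.
pose phi (j : 'I_(2 ^ m)) : I := Ordinal (inj j (ltn_ord j)).
have phi_inj : injective phi by move=> i j /(congr1 val)/= /addnI h; exact: val_inj.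
rewrite -[RHS]card_ord -(card_imset predT phi_inj); apply: eq_card => y.
rewrite unfold_in /same_block lev_le -/c; apply/eqP/imsetP => [cy|[j _ ->]]; last first.
  by rewrite /= divnMDl// divn_small ?addn0.
have yr : (y %% 2 ^ m < 2 ^ m)%N by rewrite ltn_mod.
by exists (Ordinal yr) => //; apply: val_inj; rewrite /= cy -divn_eq.
Qed.

(** The root is at scale [K], and all larger scales repeat it. *)
Lemma tree_same_block : tree same_block (2 : R).
Proof.
split.
- move=> m x y z; rewrite /same_block !lev_le; by split => // /eqP ->.
- by move=> x y; rewrite /same_block lev_le expn0 !divn1.
- by move=> m x y; exact: leqW.
- by rewrite ler1n.
- move=> m x; have [mK|Km] := ltnP m K.
    by rewrite !card_same_block// 1?ltnW// expnS natrM.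
  have all_eI i y : (K <= i)%N -> #|same_block i y| = (2 ^ K)%N.
    move=> Ki; rewrite -[RHS]card_ord; apply: eq_card => z; rewrite unfold_in /same_block.
    by rewrite (leq_trans (lev_leK _ _)).
  by rewrite !all_eI ?leqW// ler_peMl ?ler0n// ler1n.
Qed.

Lemma avg_same_block m (h : I -> R) x : (m <= K)%N ->
  avg same_block m h x = (\sum_(y : I | (lev x y <= m)%N) h y) / 2 ^+ m.
Proof. by move=> mK; rewrite /avg card_same_block// natrX. Qed.

Lemma avg_same_block_lp p m (h : I -> R) x : 1 < p -> (m <= K)%N -> nneg h ->
  avg same_block m h x <= (2 `^ (- p^-1)) ^+ m * lp p h.
Proof.
move=> p1 mK h0; rewrite avg_same_block// ler_pdivrMr ?exprn_gt0//.
have p0 : 0 < p by rewrite (lt_trans _ p1).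
have q1 := dual_gt1 p1; have q0 : 0 < dual p by rewrite (lt_trans _ q1).
have pq := dual_conj p1.
rewrite big_mkcond.
pose X (y : I) : R := ((lev x y <= m)%N)%:R.
have X0 : nneg X by move=> y; exact: ler0n.
apply: (@le_trans _ _ (\sum_y h y * X y)).
  by apply: ler_sum => y _; rewrite /X; case: ifP; rewrite ?mulr1 ?mulr0.
apply: (le_trans (hoelder_lp p0 q0 pq h0 X0)).
rewrite mulrAC mulrC; apply: ler_wpM2r; first exact: lp_ge0.
rewrite -exprMn -{2}(@powRr1 _ 2)// -powRD ?implybT//; last by rewrite pnatr_eq0 implybT.
rewrite lpE (eq_bigr X) => [|y _]; last first.
  by rewrite /X; case: (_ <= _)%N; rewrite ?powR1 ?powR0// gt_eqF.
rewrite /X -natr_sum -big_mkcond sum1_card card_same_block// natrX.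
have -> : - p^-1 + 1 = (dual p)^-1 by rewrite -pq addKr.
by rewrite -(powR_mulrn m (ler0n R 2)) powRAC powR_mulrn ?lexx// powR_ge0.
Qed.

(** Hedberg's argument: the scales are split where the maximal function and the bound
by the norm balance. *)
Lemma hedberg (p s : R) (U : finType) (e : nat -> rel U) (D : R) (f : I * U -> R) :
  tree e D -> 1 < p -> p < s -> nneg f ->
  lp p (fun u => lp s (fun x => \sum_(0 <= m < K.+1)
     (2 `^ (p^-1 - s^-1)) ^+ m * avg (eprod same_block e) m f (x, u))) <=
  hedberg_cst (p^-1 - s^-1) s^-1 * (2 * dual p) * lp p f.
Proof.
move=> T p1 ps f0; set d := p^-1 - s^-1; set C := hedberg_cst d s^-1.
have p0 : 0 < p by rewrite (lt_trans _ p1).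
have s0 : 0 < s by rewrite (lt_trans p0 ps).
have d0 : 0 < d by rewrite subr_gt0 ltf_pV2.
have C0 : 0 <= C by rewrite hedberg_cst_ge0// invr_gt0.
have TT := tree_eprod tree_same_block T.
pose Df x u := tmax (eprod same_block e) 0 K.+1 f (x, u).
pose D'f x u := tmax e 0 K.+1 (fun u => f (x, u)) u.
have Df0 x u : 0 <= Df x u by exact: tmax_ge0.
have D'f0 x u : 0 <= D'f x u by exact: tmax_ge0.
pose A u := lp p (fun x => D'f x u).
pose B u := lp p (fun x => Df x u).
have A0 u : 0 <= A u by exact: lp_ge0.
have B0 u : 0 <= B u by exact: lp_ge0.
have t01 : 0 < p / s < 1 by rewrite divr_gt0//= ltr_pdivrMr// mul1r.
have pointwise u x : \sum_(0 <= m < K.+1) (2 `^ d) ^+ m * avg (eprod same_block e) m f (x, u) <=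
    C * (A u `^ (1 - p / s) * Df x u `^ (p / s)).
  have -> : 1 - p / s = d / (d + s^-1).
    by rewrite /d subrK; field; rewrite !gt_eqF.
  have -> : p / s = s^-1 / (d + s^-1) by rewrite /d subrK invrK mulrC.
  rewrite [X in C * X]mulrC.
  apply: hedberg_sum => //; rewrite ?invr_gt0// => m mK.
    apply: ler_wpM2l; first by rewrite exprn_ge0// powR_ge0.
    exact: le_tmax.
  have -> : (2 `^ (- s^-1)) ^+ m = (2 `^ d) ^+ m * (2 `^ (- p^-1)) ^+ m :> R.
    rewrite -exprMn -powRD; last by rewrite pnatr_eq0 implybT.
    by congr (_ `^ _ ^+ _); rewrite /d; ring.
  rewrite -mulrA; apply: ler_wpM2l; first by rewrite exprn_ge0// powR_ge0.
  apply: le_trans (avg_same_block_lp x p1 _ (D'f0^~ u)) => //.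
  rewrite avg_eprod; apply: (le_avg tree_same_block) => y _.
  exact: le_tmax.
have sq u : lp s (fun x => C * (A u `^ (1 - p / s) * Df x u `^ (p / s))) <= C * (A u + B u).
  rewrite lpZ//; last by move=> x; rewrite mulr_ge0 ?powR_ge0.
  apply: ler_wpM2l => //; rewrite lpZ ?powR_ge0//; last by move=> x; exact: powR_ge0.
  have -> : lp s (fun x => Df x u `^ (p / s)) = B u `^ (p / s).
    rewrite /B !lpE; under eq_bigr do rewrite -powRrM divfK ?gt_eqF//.
    by rewrite -powRrM; congr (_ `^ _); field; rewrite !gt_eqF.
  exact: powR_geo_le.
have S0 u x : 0 <= \sum_(0 <= m < K.+1) (2 `^ d) ^+ m * avg (eprod same_block e) m f (x, u).
  by apply: sumr_ge0 => m _; rewrite mulr_ge0 ?exprn_ge0 ?powR_ge0// avg_ge0.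
apply: (@le_trans _ _ (lp p (fun u => C * (A u + B u)))).
  apply: le_lp => // [u|u]; first exact: lp_ge0.
  by apply: le_trans (sq u); exact: le_lp.
rewrite lpZ// => [|u]; last exact: addr_ge0.
rewrite -[leRHS]mulrA; apply: ler_wpM2l => //.
apply: (le_trans (lpD p1 A0 B0)).
have -> : 2 * dual p * lp p f = dual p * lp p f + dual p * lp p f by ring.
have pn0 : p != 0 by rewrite gt_eqF.
have q0 : 0 <= dual p by rewrite ltW// (lt_trans _ (dual_gt1 p1)).
apply: lerD; last first.
  rewrite /B -(@lp_pair _ _ _ p (fun z => Df z.1 z.2))//.
  apply: le_trans (doob TT K.+1 p1 f0); rewrite le_eqVlt; apply/orP; left; apply/eqP.
  by apply: eq_lp => -[].
rewrite /A -(@lp_pair _ _ _ p (fun z => D'f z.1 z.2))//.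
apply: (ler_powR_inv p0 (lp_ge0 _ _) (mulr_ge0 q0 (lp_ge0 _ _))); rewrite lp_pow//.
rewrite powRM ?lp_ge0// lp_pow// mulr_sumr.
rewrite -(pair_bigA _ (fun x u => D'f x u `^ p))/= (eq_bigr (fun z => dual p `^ p * f (z.1, z.2) `^ p)) => [|[]//].
rewrite -(pair_bigA _ (fun x u => dual p `^ p * f (x, u) `^ p))/=.
apply: ler_sum => x _; rewrite -mulr_sumr -!lp_pow// -powRM ?lp_ge0//.
apply: ler_powR_pow; rewrite ?lp_ge0//.
exact: (doob T K.+1 p1 (fun u => f0 (x, u))).
Qed.

End Dyadic.

(** * Mixed norms of sequences and the dyadic form *)

Lemma big_tuple_cons (V : Type) (idx : V) (op : Monoid.com_law idx) (I : finType) k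
    (G : k.+1.-tuple I -> V) :
  \big[op/idx]_(b : k.+1.-tuple I) G b =
  \big[op/idx]_(x : I) \big[op/idx]_(t : k.-tuple I) G [tuple of x :: t].
Proof.
rewrite pair_big/= (reindex (fun z : I * k.-tuple I => [tuple of z.1 :: z.2]))//=.
exists (fun t : k.+1.-tuple I => (thead t, [tuple of behead t])) => [[x t] _|t _] /=.
  by rewrite theadE; congr pair; exact: val_inj.
by rewrite -tuple_eta.
Qed.

Lemma big_tuple0 (V : Type) (idx : V) (op : Monoid.com_law idx) (I : finType)
    (G : 0.-tuple I -> V) : \big[op/idx]_(b : 0.-tuple I) G b = G [tuple].
Proof. by rewrite (big_pred1 [tuple]) // => t; apply/esym/eqP/tuple0. Qed.

Section MixedSeq.
Context {R : realType} (I : finType).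
Implicit Types (F G : seq I -> R) (ps : seq R).

Definition dsum k F : R := \sum_(t : k.-tuple I) F t.

Fixpoint dnorm ps F : R :=
  if ps is p :: ps' then dnorm ps' (fun t => lp p (fun x => F (x :: t))) else F [::].

Lemma dsum0 F : dsum 0 F = F [::].
Proof. exact: big_tuple0. Qed.

Lemma dsum_cons k F : dsum k.+1 F = \sum_x dsum k (fun t => F (x :: t)).
Proof. exact: big_tuple_cons. Qed.

Lemma dsum_rcons k F : dsum k.+1 F = \sum_x dsum k (fun t => F (rcons t x)).
Proof.
elim: k F => [|k IH] F.
  by rewrite dsum_cons; apply: eq_bigr => x _; rewrite !dsum0.
rewrite dsum_cons; under eq_bigr do rewrite IH.
by rewrite exchange_big/=; apply: eq_bigr => w _; rewrite dsum_cons.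
Qed.

Lemma dsum_ge0 k F : nneg F -> 0 <= dsum k F.
Proof. by move=> F0; apply: sumr_ge0 => t _. Qed.

Lemma dnorm_ge0 ps F : nneg F -> 0 <= dnorm ps F.
Proof. by elim: ps F => //= p ps IH F F0; apply: IH => t; exact: lp_ge0. Qed.

Lemma le_dnorm ps F G : all (fun x => 0 < x) ps -> nneg F -> (forall t, F t <= G t) ->
  dnorm ps F <= dnorm ps G.
Proof.
elim: ps F G => [|p ps IH] F G /=; first by move=> _ _; apply.
move=> /andP[p0 ps0] F0 FG; apply: IH => // t; first exact: lp_ge0.
exact: le_lp.
Qed.

Lemma eq_dnorm ps F G : F =1 G -> dnorm ps F = dnorm ps G.
Proof. by move=> /funext ->. Qed.

Lemma dnorm_rcons ps r F :
  dnorm (rcons ps r) F = lp r (fun w => dnorm ps (fun t => F (rcons t w))).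
Proof. by elim: ps F => //= p ps IH F; rewrite IH. Qed.

Lemma dnormZ ps F (c : R) : all (fun x => 0 < x) ps -> 0 <= c -> nneg F ->
  dnorm ps (fun t => c * F t) = c * dnorm ps F.
Proof.
move=> + c0; elim: ps F => //= p ps IH F /andP[p0 ps0] F0; rewrite -IH// => [|t]; last exact: lp_ge0.
by apply: eq_dnorm => t; rewrite lpZ.
Qed.

Lemma dnorm_sublinear ps : all (fun x => 1 < x) ps -> sublinear (dnorm ps).
Proof.
move=> ps1; split => [F F0|J r c]; first exact: dnorm_ge0.
elim: ps ps1 => [_ F _ _ //=|p ps IH /= /andP[p1 ps1] F c0 F0].
have ps0 : all (fun x => 0 < x) ps by apply: sub_all ps1 => x; exact: lt_trans.
apply: le_trans (IH ps1 (fun i t => lp p (fun x => F i (x :: t))) c0 _); last first.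
  by move=> i t; exact: lp_ge0.
apply: le_dnorm => // t; first exact: lp_ge0.
exact: minkowski_lp.
Qed.

Lemma dnorm_dual ps F : all (fun x => 1 < x) ps -> nneg F -> exists G,
  [/\ nneg G, dnorm (map dual ps) G <= 1 &
      dsum (size ps) (fun t => F t * G t) = dnorm ps F].
Proof.
elim: ps F => [|p ps IH] F /=.
  by move=> _ _; exists (fun=> 1); rewrite dsum0 mulr1; split.
move=> /andP[p1 ps1] F0; have p0 := lt_trans ltr01 p1.
have q1 := dual_gt1 p1; have q0 := lt_trans ltr01 q1.
have H t := lp_dual p1 q0 (dual_conj p1) (fun x => F0 (x :: t)).
have /boolp.choice[g hg] := H.
have [G [G0 G1 GE]] := IH (fun t => lp p (fun x => F (x :: t))) ps1 (fun t => lp_ge0 _ _).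
have g0 t x : 0 <= g t x by have [] := hg t.
exists (fun s => if s is x :: t then g t x * G t else 0); split.
- by move=> [|x t] //; exact: mulr_ge0.
- apply: le_trans G1; have q0s : all (fun x => 0 < x) (map dual ps).
    rewrite all_map; apply: sub_all ps1 => x /= x1.
    exact: lt_trans ltr01 (dual_gt1 x1).
  apply: le_dnorm => // t; first exact: lp_ge0.
  have [_ g1 _] := hg t.
  under eq_lp do rewrite mulrC; rewrite lpZ// ler_piMr//.
- rewrite dsum_cons -GE /dsum exchange_big/=; apply: eq_bigr => t _.
  under eq_bigr do rewrite mulrA; rewrite -mulr_suml; congr (_ * _).
  by have [] := hg t.
Qed.

Lemma lp_unit p (a : R) : p != 0 -> 0 <= a -> lp p (fun _ : unit => a) = a.
Proof. by move=> p0 a0; rewrite lpE (big_pred1 tt) ?powRK// => -[]. Qed.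

End MixedSeq.

Section DyadicForm.
Context {R : realType}.

Section fixK.
Context (K : nat).
Notation I := 'I_(2 ^ K).
Implicit Types (phi psi : seq I -> R).

(** The level of the smallest dyadic cube containing two points of the grid. *)
Fixpoint slev (s t : seq I) : nat :=
  match s, t with x :: s', y :: t' => maxn (lev K x y) (slev s' t') | _, _ => 0 end.

Lemma slev_leK s t : (slev s t <= K)%N.
Proof. by elim: s t => [|x s IH] [|y t] //=; rewrite geq_max lev_leK IH. Qed.

Lemma slev_rcons s t x y : size s = size t ->
  slev (rcons s x) (rcons t y) = maxn (slev s t) (lev K x y).
Proof.
elim: s t => [|u s IH] [|v t] //=; first by rewrite maxnC.
by move=> [/IH ->]; rewrite maxnA.
Qed.

Definition block_avg k m phi v : R :=
  dsum k (fun w => ((slev v w <= m)%N)%:R * phi w) / (2 ^+ m) ^+ k.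

Lemma block_avg_ge0 k m phi v : nneg phi -> 0 <= block_avg k m phi v.
Proof.
move=> p0; rewrite divr_ge0 ?exprn_ge0//; apply: dsum_ge0 => w.
by rewrite mulr_ge0.
Qed.

Lemma block_avg_rcons k m phi (v : k.-tuple I) w : (m <= K)%N ->
  block_avg k.+1 m phi (rcons v w) = block_avg k m (fun v' => avg (@same_block K) m (fun w' => phi (rcons v' w')) w) v.
Proof.
move=> mK; rewrite /block_avg exprSr invfM mulrA mulrAC; congr (_ / _).
rewrite dsum_rcons /dsum exchange_big/= mulr_suml; apply: eq_bigr => v' _.
rewrite avg_same_block// [RHS]mulrA; congr (_ / _); rewrite mulr_sumr.
rewrite [RHS]big_mkcond; apply: eq_bigr => w' _.
rewrite slev_rcons ?size_tuple// geq_max.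
by case: (slev v v' <= m)%N; case: (lev K w w' <= m)%N; rewrite ?mul1r ?mul0r.
Qed.

Lemma block_avg1 m phi x : (m <= K)%N ->
  block_avg 1 m phi [:: x] = avg (@same_block K) m (fun y => phi [:: y]) x.
Proof.
move=> mK; have := @block_avg_rcons 0 m phi [tuple] x mK; rewrite /= => ->.
by rewrite /block_avg dsum0 expr0 divr1 mul1r.
Qed.

(** Summed over the scales, with weights 2 ^ (d m), the averages over dyadic cubes dominate
a power of the dyadic distance. *)
Definition scale_form k (d : R) m phi psi : R :=
  (2 `^ d) ^+ m * dsum k (fun v => block_avg k m phi v * psi v).

Lemma scale_form_ge0 k d m phi psi : nneg phi -> nneg psi -> 0 <= scale_form k d m phi psi.
Proof.
move=> h1 h2; rewrite mulr_ge0 ?exprn_ge0 ?powR_ge0//; apply: dsum_ge0 => v.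
by rewrite mulr_ge0 ?block_avg_ge0.
Qed.

(** After Hölder's inequality in the last variable, this is Hedberg's argument on the product
of the tree with the dyadic intervals of that variable. *)
Lemma form_base (p s : R) (U : finType) (e : nat -> rel U) (D : R) (f g : U -> seq I -> R) :
  tree e D -> 1 < p -> p < s -> (forall u, nneg (f u)) -> (forall u, nneg (g u)) ->
  form e (scale_form 1 (p^-1 - s^-1)) K f g <=
  hedberg_cst (p^-1 - s^-1) s^-1 * (2 * dual p) *
    lp p (fun u => dnorm [:: p] (f u)) * lp (dual p) (fun u => dnorm [:: dual s] (g u)).
Proof.
move=> T p1 ps f0 g0; set d := p^-1 - s^-1.
have p0 := lt_trans ltr01 p1; have s1 := lt_trans p1 ps; have s0 := lt_trans ltr01 s1.
pose F (z : I * U) := f z.2 [:: z.1].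
pose S u x := \sum_(0 <= m < K.+1) (2 `^ d) ^+ m * avg (eprod (@same_block K) e) m F (x, u).
have F0 : nneg F by move=> z; exact: f0.
have S0 u x : 0 <= S u x.
  by apply: sumr_ge0 => m _; rewrite mulr_ge0 ?exprn_ge0 ?powR_ge0// avg_ge0.
have -> : form e (scale_form 1 d) K f g = \sum_u \sum_x S u x * g u [:: x].
  transitivity (\sum_(0 <= m < K.+1) \sum_u \sum_x
     (2 `^ d) ^+ m * avg (eprod (@same_block K) e) m F (x, u) * g u [:: x]).
    rewrite /form big_nat [RHS]big_nat; apply: eq_bigr => m /andP[_ mK].
    rewrite /scale_form; under eq_bigr do rewrite dsum_cons.
    rewrite -[LHS]mulr_sumr exchange_big/= [RHS]exchange_big/= mulr_sumr; apply: eq_bigr => x _.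
    under [RHS]eq_bigr do rewrite -mulrA; rewrite -mulr_sumr; congr (_ * _).
    under eq_bigr do rewrite dsum0 block_avg1//.
    rewrite -(sum_sat T (m := m) (fun u => g u [:: x])); last first.
      by move=> u v uv; apply: (avg_sat (tree_eprod (tree_same_block K) T));
         rewrite /eprod /= uv (tree_refl (tree_same_block K)).
    by apply: eq_bigr => u _; rewrite avg_eprod.
  rewrite exchange_big/=; apply: eq_bigr => u _.
  by rewrite exchange_big/=; apply: eq_bigr => x _; rewrite mulr_suml.
have q1 := dual_gt1 p1; have q0 := lt_trans ltr01 q1.
have t0 := lt_trans ltr01 (dual_gt1 s1).
apply: (@le_trans _ _ (\sum_u lp s (S u) * lp (dual s) (fun x => g u [:: x]))).
  by apply: ler_sum => u _; apply: hoelder_lp => //; exact: dual_conj.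
apply: (le_trans (hoelder_lp p0 q0 (dual_conj p1) _ _)); try by move=> u; exact: lp_ge0.
apply: ler_wpM2r; first exact: lp_ge0.
apply: (le_trans (hedberg T p1 ps F0)); rewrite lp_pair ?gt_eqF//.
Qed.

(** A variable can be moved from the values of the functions to the tree, where its dyadic
intervals become another factor. *)
Lemma form_rcons k d (U : finType) (e : nat -> rel U) (D : R) (f g : U -> seq I -> R) :
  tree e D ->
  form e (scale_form k.+1 d) K f g =
  form (eprod (@same_block K) e) (scale_form k d) K
    (fun z t => f z.2 (rcons t z.1)) (fun z t => g z.2 (rcons t z.1)).
Proof.
move=> T; have TI := tree_same_block K : tree _ (2 : R); have TT := tree_eprod TI T.
rewrite /form big_nat [RHS]big_nat; apply: eq_bigr => m /andP[_ mK].
set f' : I * U -> seq I -> R := fun z t => f z.2 _.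
set g' : I * U -> seq I -> R := fun z t => g z.2 _.
pose vv (h : I * U -> seq I -> R) := vavg (eprod (@same_block K) e) m h.
transitivity (\sum_w \sum_u scale_form k d m (vv f' (w, u)) (vv g' (w, u))); last first.
  by rewrite pair_big/=; apply: eq_bigr => -[].
rewrite [RHS]exchange_big/=; apply: eq_bigr => u _; rewrite /scale_form -mulr_sumr; congr (_ * _).
rewrite dsum_rcons /dsum exchange_big [RHS]exchange_big/=; apply: eq_bigr => v _.
pose A w := block_avg k m (vavg (eprod (@same_block K) e) m f' (w, u)) v.
have sA : saturated (@same_block K) m A.
  move=> x y xy; rewrite /A; congr block_avg; apply/funext => t.
  by apply: (avg_sat TT); rewrite /eprod/= xy (tree_refl T).
pose h w := vavg e m g u (rcons v w).
transitivity (\sum_w A w * h w).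
  apply: eq_bigr => w _; rewrite block_avg_rcons//; congr (block_avg _ _ _ _ * _).
  by apply/funext => t; rewrite /vavg avg_eprod.
rewrite -(sum_sat TI h sA); apply: eq_bigr => w _; congr (_ * _).
by rewrite /vv /vavg avg_eprod.
Qed.

End fixK.

(** The exponents [rs] are added one at a time: the new variable is moved into the tree,
where the induction hypothesis gives a bound with outer exponent [r]; this is the bound for
one outer exponent that extrapolation needs. Hence the quantification over all trees, with
a constant that depends on the doubling constant only. *)
Lemma form_chain (p s : R) (rs : seq R) : 1 < p -> p < s -> all (fun x => 1 < x) rs ->
  exists Phi : R -> R -> R, (forall D c, 1 <= D -> 1 < c -> 0 <= Phi D c) /\
  forall K (U : finType) (e : nat -> rel U) (D c : R) (f g : U -> seq 'I_(2 ^ K) -> R),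
  tree e D -> 1 < c -> (forall u, nneg (f u)) -> (forall u, nneg (g u)) ->
  form e (scale_form (size rs).+1 (p^-1 - s^-1)) K f g <=
  Phi D c * lp c (fun u => dnorm (p :: rs) (f u)) *
    lp (dual c) (fun u => dnorm (dual s :: map dual rs) (g u)).
Proof.
move=> p1 ps; have s1 := lt_trans p1 ps; have ds1 := dual_gt1 s1.
have dc0 c : 1 < c -> 0 <= dual c * c :> R.
  by move=> c1; rewrite mulr_ge0// ltW// (lt_trans ltr01)// dual_gt1.
elim/last_ind: rs => [_|rs r IH].
  pose C0 := hedberg_cst (p^-1 - s^-1) s^-1 * (2 * dual p).
  have C00 : 0 <= C0.
    rewrite mulr_ge0 ?hedberg_cst_ge0 ?subr_gt0 ?ltf_pV2 ?invr_gt0 ?posrE//;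
      rewrite ?(lt_trans ltr01)// mulr_ge0// ltW// (lt_trans ltr01)// dual_gt1//.
  exists (fun D c => 32 * D ^+ 2 * C0 * (dual c * c)); split.
    move=> D c D1 c1; rewrite mulr_ge0 ?dc0// mulr_ge0// mulr_ge0// exprn_ge0//.
    exact: le_trans D1.
  move=> K U e D c f g T c1 f0 g0; apply: (extrapolate T _ _ _ p1 C00) => //.
  - by apply: dnorm_sublinear; rewrite /= p1.
  - by apply: dnorm_sublinear; rewrite /= ds1.
  - by move=> m ? ?; exact: scale_form_ge0.
  - by move=> f' g' f'0 g'0; exact: (form_base T p1 ps f'0 g'0).
rewrite all_rcons => /andP[r1 rs1]; have [Phi [Phi0 HPhi]] := IH rs1.
have dr1 := dual_gt1 r1.
have drs1 : all (fun x => 1 < x) (map dual rs).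
  by rewrite all_map; apply: sub_all rs1 => x /= x1; exact: dual_gt1.
exists (fun D c => 32 * D ^+ 2 * Phi (2 * D) r * (dual c * c)); split.
  move=> D c D1 c1; rewrite mulr_ge0 ?dc0// mulr_ge0 ?Phi0//.
    by rewrite mulr_ge0// exprn_ge0// (le_trans _ D1).
  by move: D1; lra.
move=> K U e D c f g T c1 f0 g0.
have D1 := tree_D1 T.
have C00 : 0 <= Phi (2 * D) r by apply: Phi0 => //; move: D1; lra.
rewrite map_rcons size_rcons; apply: (extrapolate T _ _ _ r1 C00) => //.
- by apply: dnorm_sublinear; rewrite /= p1 all_rcons /= r1.
- by apply: dnorm_sublinear; rewrite /= ds1 all_rcons /= dr1.
- by move=> m ? ?; exact: scale_form_ge0.
- move=> f' g' f'0 g'0; rewrite (form_rcons _ _ _ _ T).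
  have TT := tree_eprod (tree_same_block K) T.
  apply: (le_trans (HPhi K _ _ _ r _ _ TT r1 _ _)); try by move=> u t.
  rewrite !lp_pair ?gt_eqF ?(lt_trans ltr01)//.
  by rewrite (eq_lp r (fun u => dnorm_rcons (p :: rs) r (f' u)))
    (eq_lp (dual r) (fun u => dnorm_rcons (dual s :: map dual rs) (dual r) (g' u))).
Qed.

End DyadicForm.

(** * Fractional integration on dyadic grids *)

Section DyadicHLS.
Context {R : realType}.

Definition dyadic_ker K (gam : R) (s t : seq 'I_(2 ^ K)) : R := (2 `^ (- gam)) ^+ slev s t.

Lemma dyadic_ker_ge0 K gam (s t : seq 'I_(2 ^ K)) : 0 <= dyadic_ker gam s t.
Proof. by rewrite exprn_ge0// powR_ge0. Qed.

(** The dimension minus the order of the fractional integral. *)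
Fixpoint hls_exponent (ps ss : seq R) : R :=
  match ps, ss with
  | p :: ps', s :: ss' => 1 - (p^-1 - s^-1) + hls_exponent ps' ss'
  | _, _ => 0
  end.

Lemma hls_exponent_diag ps : hls_exponent ps ps = (size ps)%:R.
Proof. by elim: ps => //= p ps ->; rewrite subrr subr0 -natr1 addrC. Qed.

Lemma hls_exponent_ge0 ps ss : all2 (fun p s => (1 < p) && (p <= s)) ps ss ->
  0 <= hls_exponent ps ss.
Proof.
elim: ps ss => [|p ps IH] [|s ss] //= /andP[/andP[p1 ps1] /IH h].
have p0 := lt_trans ltr01 p1; have s0 := lt_le_trans p0 ps1.
rewrite addr_ge0// opprB addrA subr_ge0 (le_trans (_ : _ <= 1))//.
  by rewrite invf_le1// ltW.
by rewrite lerDl invr_ge0 ltW.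
Qed.

Lemma hls_exponent_gt0 ps ss : all2 (fun p s => (1 < p) && (p <= s)) ps ss ->
  ps != [::] -> 0 < hls_exponent ps ss.
Proof.
case: ps ss => [|p ps] [|s ss] //= /andP[/andP[p1 ps1] /hls_exponent_ge0 h] _.
have p0 := lt_trans ltr01 p1; have s0 := lt_le_trans p0 ps1.
rewrite ltr_wpDr// opprB addrA subr_gt0 (lt_le_trans (_ : _ < 1))//.
  by rewrite invf_lt1.
by rewrite lerDl invr_ge0 ltW.
Qed.

(** Fractional integration takes place in the innermost variable alone. Tested against the
extremizer of the dual norm, the potential becomes the form of [form_chain] over the tree
with one point. *)
Lemma hls_innermost (p s : R) (rs : seq R) : 1 < p -> p < s -> all (fun x => 1 < x) rs ->
  exists C : R, 0 <= C /\ forall K (f : seq 'I_(2 ^ K) -> R), nneg f ->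
  dnorm (s :: rs) (fun x => dsum (size rs).+1 (fun y =>
     dyadic_ker (hls_exponent (p :: rs) (s :: rs)) x y * f y)) <=
  C * dnorm (p :: rs) f.
Proof.
move=> p1 ps rs1; have s1 := lt_trans p1 ps.
have [Phi [Phi0 HPhi]] := form_chain p1 ps rs1.
exists (Phi 1 2); split; first by apply: Phi0; rewrite ?lexx// ltr1n.
move=> K f f0; set n := (size rs).+1; set d := p^-1 - s^-1.
set g := hls_exponent _ _.
have gE : g = n%:R - d.
  by rewrite /g /= hls_exponent_diag /n -natr1 /d; ring.
set Tf := fun x => dsum n _.
have Tf0 : nneg Tf.
  by move=> x; apply: dsum_ge0 => y; rewrite mulr_ge0 ?dyadic_ker_ge0.
have srs1 : all (fun x => 1 < x) (s :: rs) by rewrite /= s1.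
have [h [h0 h1 <-]] := dnorm_dual srs1 Tf0.
have T := @tree_unit R.
have v1 (k : seq 'I_(2 ^ K) -> R) m : vavg (fun _ (_ _ : unit) => true) m (fun=> k) tt = k.
  by apply/funext => v; rewrite /vavg (avg_id T).
have := HPhi K unit _ 1 2 (fun=> f) (fun=> h) T (ltr1n R 2) (fun=> f0) (fun=> h0).
rewrite !lp_unit ?pnatr_eq0 ?dnorm_ge0// => [|]; last first.
  by rewrite gt_eqF// (lt_trans ltr01)// dual_gt1 ?ltr1n.
have Cf0 : 0 <= Phi 1 2 * dnorm (p :: rs) f.
  by rewrite mulr_ge0 ?dnorm_ge0// Phi0 ?lexx// ltr1n.
move=> H; apply: (@le_trans _ _ (Phi 1 2 * dnorm (p :: rs) f * 1)); last by rewrite mulr1.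
apply: le_trans (ler_wpM2l Cf0 h1); apply: le_trans H.
rewrite /form; under [leRHS]eq_bigr do rewrite (big_pred1 tt) ?v1//.
rewrite /scale_form; under [leRHS]eq_bigr do rewrite mulr_sumr.
rewrite [leRHS]exchange_big/=; apply: ler_sum => x _.
under [leRHS]eq_bigr do rewrite mulrA.
rewrite -mulr_suml; apply: ler_wpM2r => //.
have E i : (2 `^ d) ^+ i * block_avg n i f x = \sum_(w : n.-tuple 'I_(2 ^ K))
    (2 `^ d) ^+ i / (2 ^+ i) ^+ n * (((slev x w <= i)%N)%:R * f w).
  by rewrite /block_avg mulrCA mulrC mulr_sumr.
under [leRHS]eq_bigr do rewrite E.
rewrite [leRHS]exchange_big/=; apply: ler_sum => y _.
have lK := slev_leK (tval x) (tval y).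
rewrite (big_cat_nat _ _ (n := slev x y)) //=; last exact: leqW.
rewrite [X in _ + X]big_ltn ?ltnS//= leqnn mul1r addrCA.
apply: ler_wpDr.
  by apply: addr_ge0; apply: sumr_ge0 => m _; (apply: mulr_ge0; first by rewrite divr_ge0 ?exprn_ge0 ?powR_ge0);
    rewrite mulr_ge0.
apply: ler_wpM2r => //; rewrite /dyadic_ker gE.
move: (slev x y) => l; rewrite exprAC -expr_div_n.
rewrite le_eqVlt; apply/orP; left; apply/eqP; congr (_ ^+ l).
rewrite opprB powRD; last by rewrite pnatr_eq0 implybT.
by rewrite powRN powR_mulrn.
Qed.

(** Schur's test: Hölder's inequality with the kernel split between the two functions. *)
Lemma schur (I : finType) (p : R) (k : I -> I -> R) (rho : R) (f : I -> R) :
  1 < p -> (forall x y, 0 <= k x y) -> (forall x y, k x y = k y x) ->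
  (forall x, \sum_y k x y <= rho) -> nneg f ->
  lp p (fun x => \sum_y k x y * f y) <= rho * lp p f.
Proof.
move=> p1 k0 ksym krho f0; have p0 := lt_trans ltr01 p1.
have q1 := dual_gt1 p1; have q0 := lt_trans ltr01 q1; have pq := dual_conj p1.
have S0 : nneg (fun x => \sum_y k x y * f y).
  by move=> x; apply: sumr_ge0 => y _; exact: mulr_ge0.
have [[x0]|I0] := pselect (inhabited I); last first.
  rewrite !lpE !big1 ?mulr0 ?powR0 ?mulr0// ?invr_eq0 ?gt_eqF// => x _;
  by exfalso; apply: I0.
have r0 : 0 <= rho by apply: le_trans (krho x0); apply: sumr_ge0.
have [g [g0 g1 <-]] := lp_dual p1 q0 pq S0.
pose F (z : I * I) := k z.1 z.2 `^ p^-1 * f z.2.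
pose G (z : I * I) := k z.1 z.2 `^ (dual p)^-1 * g z.1.
have F0 : nneg F by move=> z; rewrite mulr_ge0 ?powR_ge0.
have G0 : nneg G by move=> z; rewrite mulr_ge0 ?powR_ge0.
have -> : \sum_x (\sum_y k x y * f y) * g x = \sum_z F z * G z.
  under eq_bigr do rewrite mulr_suml.
  rewrite pair_big/=; apply: eq_bigr => z _; rewrite /F /G mulrACA -powRD ?pq ?oner_eq0//.
  by rewrite powRr1// mulrA.
apply: (le_trans (hoelder_lp p0 q0 pq F0 G0)).
have Fle : lp p F <= rho `^ p^-1 * lp p f.
  apply: (ler_powR_inv p0); rewrite ?lp_ge0 ?mulr_ge0 ?lp_ge0 ?powR_ge0//.
  rewrite powRM ?powR_ge0 ?lp_ge0// powRVK ?gt_eqF// !lp_pow//.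
  rewrite -(pair_bigA _ (fun x y => F (x, y) `^ p))/= exchange_big/= mulr_sumr.
  apply: ler_sum => y _; rewrite /F/=.
  under eq_bigr do rewrite powRM ?powR_ge0// powRVK ?gt_eqF// ksym.
  by rewrite -mulr_suml; apply: ler_wpM2r => //; exact: powR_ge0.
have Gle : lp (dual p) G <= rho `^ (dual p)^-1 * lp (dual p) g.
  apply: (ler_powR_inv q0); rewrite ?lp_ge0 ?mulr_ge0 ?lp_ge0 ?powR_ge0//.
  rewrite powRM ?powR_ge0 ?lp_ge0// powRVK ?gt_eqF// !lp_pow//.
  rewrite -(pair_bigA _ (fun x y => G (x, y) `^ dual p))/= mulr_sumr.
  apply: ler_sum => x _; rewrite /G/=.
  under eq_bigr do rewrite powRM ?powR_ge0// powRVK ?gt_eqF//.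
  by rewrite -mulr_suml; apply: ler_wpM2r => //; exact: powR_ge0.
apply: (le_trans (ler_pM (lp_ge0 _ _) (lp_ge0 _ _) Fle Gle)).
rewrite mulrACA -powRD ?pq ?oner_eq0// powRr1//; apply: ler_wpM2l => //.
by rewrite ler_piMr ?lp_ge0.
Qed.

(** The innermost variable, when the other ones are at dyadic distance 2 ^ l. Equal exponents
are handled by Schur's test, whose row sums are geometric because the exponent [g'] left to
the other variables is positive. *)
Lemma hls_one_variable (p s : R) (g' : R) : 1 < p -> p <= s -> 0 <= g' ->
  (p = s -> 0 < g') ->
  exists C : R, 0 <= C /\ forall K l (f : 'I_(2 ^ K) -> R), (l <= K)%N -> nneg f ->
  lp s (fun x : 'I_(2 ^ K) => \sum_(y < 2 ^ K) (2 `^ (- (1 - (p^-1 - s^-1) + g'))) ^+ maxn (lev K x y) l * f y) <=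
  C * (2 `^ (- g')) ^+ l * lp p f.
Proof.
move=> p1; rewrite le_eqVlt => /predU1P[<-|ps] g'0 gp.
  have {gp}g0 := gp erefl; rewrite subrr subr0.
  have w01 := powR2N_lt1 g0; have /andP[w0 w1] := w01.
  exists (1 - 2 `^ (- g'))^-1; split; first by rewrite invr_ge0 subr_ge0 ltW.
  move=> K l f lK f0; apply: (schur p1 _ _ _ f0) => [x y|x y|x].
  - exact/exprn_ge0/powR_ge0.
  - by rewrite /lev; do 2 f_equal; apply: eq_find => m; rewrite eq_sym.
  - rewrite mulrC; apply: le_trans (geo_sum_lt l K.+1 w01).
    apply: (@le_trans _ _ (\sum_(y : 'I_(2 ^ K)) \sum_(l <= m < K.+1)
       (if (lev K x y <= m)%N then (2 `^ (- (1 + g'))) ^+ m else 0))).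
      apply: ler_sum => y _; set M := maxn _ _.
      have MK : (M < K.+1)%N by rewrite ltnS geq_max lev_leK.
      have lM : (l <= M)%N by rewrite leq_maxr.
      rewrite (big_cat_nat _ _ (n := M)) ?(ltnW MK)//= [X in _ <= _ + X]big_ltn//.
      rewrite leq_maxl addrCA ler_wpDr//.
      by rewrite addr_ge0// sumr_ge0// => m _; case: ifP => // _; rewrite ?exprn_ge0 ?powR_ge0.
    rewrite exchange_big/= big_nat [leRHS]big_nat; apply: ler_sum => m /andP[_ mK].
    rewrite -big_mkcond/= sumr_const.
    rewrite (_ : #|_| = 2 ^ m)%N; last by rewrite -(card_same_block x (m := m)).
    rewrite -[leLHS]mulr_natl natrX -exprMn.
    rewrite opprD powRD; last by rewrite pnatr_eq0 implybT.
    by rewrite powR_inv1// mulrA mulfV ?pnatr_eq0// mul1r.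
have [C [C0 HC]] := hls_innermost p1 ps (rs := [::]) isT.
exists C; split => // K l f lK f0; set d := p^-1 - s^-1.
have s0 : 0 < s by rewrite (lt_trans ltr01)// (lt_trans p1).
have d1 : 0 <= 1 - d.
  have := @hls_exponent_ge0 [:: p] [:: s]; rewrite /= p1 ltW//= addr0; exact.
rewrite mulrAC mulrC.
have /= := HC K (fun t => if t is x :: _ then f x else 0).
move=> /(_ _)/(ler_wpM2l (exprn_ge0 l (powR_ge0 2 (- g')))).
have F0 : nneg (fun t => if t is x :: _ then f x else 0) by case.
move=> /(_ F0); apply: le_trans.
rewrite -lpZ ?exprn_ge0 ?powR_ge0//; last first.
  by move=> x; apply: dsum_ge0 => y; rewrite mulr_ge0 ?dyadic_ker_ge0.
apply: le_lp => // x.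
  by apply: sumr_ge0 => y _; rewrite mulr_ge0 ?exprn_ge0 ?powR_ge0.
rewrite dsum_cons mulr_sumr; apply: ler_sum => y _; rewrite dsum0 mulrA.
apply: ler_wpM2r => //; rewrite /dyadic_ker /= maxn0 addr0 opprD powRD; last by rewrite pnatr_eq0 implybT.
rewrite exprMn mulrC; apply: ler_pM; rewrite ?exprn_ge0 ?powR_ge0//;
  apply: ler_wiXn2l; rewrite ?powR_ge0 ?leq_maxl ?leq_maxr//;
  by rewrite powRN invf_le1 ?powR_gt0// -[leLHS](powRr0 2) ler_powR// ler1n.
Qed.

(** The Hardy-Littlewood-Sobolev inequality for the dyadic distance, uniform in the number
of scales. Minkowski's inequality and the estimate in the innermost variable leave the same
problem for the other variables, until these have equal exponents. *)
Theorem dyadic_hls (ps ss : seq R) : all2 (fun p s => (1 < p) && (p <= s)) ps ss ->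
  ps != ss -> exists C : R, 0 <= C /\ forall K (f : seq 'I_(2 ^ K) -> R), nneg f ->
  dnorm ss (fun x => dsum (size ps) (fun y => dyadic_ker (hls_exponent ps ss) x y * f y)) <=
  C * dnorm ps f.
Proof.
elim: ps ss => [|p ps IH] [|s ss] //= /andP[/andP[p1 ps1] hs] neq.
have [E|ne] := eqVneq ps ss.
  subst ss; have {}ps1 : p < s.
    by rewrite lt_neqAle ps1 andbT; apply: contra neq => /eqP ->.
  apply: hls_innermost => //; elim: ps hs {IH neq} => //= q r IH /andP[/andP[-> _] /IH].
  by [].
have [C [C0 HC]] := IH _ hs ne; have g'0 := hls_exponent_ge0 hs.
have g'gt : p = s -> 0 < hls_exponent ps ss.
  move=> _; apply: hls_exponent_gt0 => //; apply: contra ne => /eqP E.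
  by move: hs; rewrite E; case: (ss).
have [C1 [C10 HC1]] := hls_one_variable p1 ps1 g'0 g'gt.
exists (C1 * C); split; first exact: mulr_ge0.
move=> K f f0; set g := 1 - _ + _.
have s1 : 1 < s by exact: lt_le_trans ps1.
have p0 : 0 < p by rewrite (lt_trans ltr01).
have s0 : 0 < s by rewrite (lt_trans ltr01).
have ss0 : all (fun x => 0 < x) ss.
  elim: ps ss hs {IH ne neq HC g'0 g'gt HC1 g} => [|q qs IH] [|r ss] //= /andP[/andP[q1 qr] /IH ->].
  by rewrite andbT (lt_le_trans (lt_trans ltr01 q1)).
pose F t := lp p (fun x => f (x :: t)).
have F0 : nneg F by move=> t; exact: lp_ge0.
apply: (@le_trans _ _ (dnorm ss (fun t => C1 * dsum (size ps) (fun t' =>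
    dyadic_ker (hls_exponent ps ss) t t' * F t')))); last first.
  rewrite dnormZ//; last by move=> t; apply: dsum_ge0 => t'; rewrite mulr_ge0 ?dyadic_ker_ge0.
  by rewrite -mulrA; apply: ler_wpM2l => //; exact: HC.
apply: le_dnorm => // t; first exact: lp_ge0.
pose H (t' : (size ps).-tuple 'I_(2 ^ K)) (x : 'I_(2 ^ K)) := \sum_(y < 2 ^ K) (2 `^ (- g)) ^+ maxn (lev K x y) (slev t t') * f (y :: t').
have H0 t' : nneg (H t').
  by move=> x; apply: sumr_ge0 => y _; rewrite mulr_ge0 ?exprn_ge0 ?powR_ge0.
apply: (@le_trans _ _ (lp s (fun x => \sum_t' 1 * H t' x))).
  rewrite le_eqVlt; apply/orP; left; apply/eqP; apply: eq_lp => x.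
  rewrite dsum_cons /dsum exchange_big/=; apply: eq_bigr => t' _.
  by rewrite mul1r.
apply: (le_trans (minkowski_lp _ s1 (fun=> ler01) H0)).
rewrite mulr_sumr; apply: ler_sum => t' _; rewrite mul1r mulrA.
by apply: HC1; rewrite ?slev_leK.
Qed.

End DyadicHLS.

(** * Lower integrals *)

Notation enneg f := (forall x, (0 <= f x)%E).

Section LowerIntegral.
Local Open Scope ereal_scope.
Context d {T : measurableType d} {R : realType}.
Variable mu : {measure set T -> \bar R}.
Implicit Types f g : T -> \bar R.

Import HBNNSimple.

Lemma lower_integralP f (x : \bar R) : enneg f ->
  (forall h : {nnsfun T >-> R}, (forall t, (h t)%:E <= f t) -> \int[mu]_t (h t)%:E <= x) ->
  \int[mu]_t f t <= x.
Proof.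
move=> f0 H; rewrite ge0_integralTE//; apply: ge_ereal_sup => _ [h hf <-].
by rewrite -integralT_nnsfun; exact: H.
Qed.

Lemma lower_integral_ge f (h : {nnsfun T >-> R}) : enneg f ->
  (forall t, (h t)%:E <= f t) -> \int[mu]_t (h t)%:E <= \int[mu]_t f t.
Proof.
move=> f0 hf; rewrite (ge0_integralTE _ f0) integralT_nnsfun.
by apply: ereal_sup_ubound; exists h.
Qed.

(** The integral of a nonnegative function is a lower integral, a supremum over the simple
functions below it, which makes sense without measurability. Restricting a simple function
to the complement of a null set does not change its integral. *)
Lemma le_integral_off_null f g (N : set T) : measurable N -> mu N = 0 ->
  enneg f -> enneg g -> (forall t, ~ N t -> f t <= g t) ->
  \int[mu]_t f t <= \int[mu]_t g t.
Proof.
move=> mN N0 f0 g0 fg; apply: lower_integralP => // h hf.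
have mNC : measurable (~` N) by exact: measurableC.
pose k := (mul_nnsfun h (indic_nnsfun R mNC)).
have -> : \int[mu]_t (h t)%:E = \int[mu]_t (k t)%:E.
  apply: ge0_ae_eq_integral => //.
  - by apply/measurable_EFinP.
  - by apply/measurable_EFinP.
  - by move=> t _; rewrite lee_fin.
  - by move=> t _; rewrite lee_fin.
  - exists N; split => // t /= /not_implyP[_ hk]; apply: contrapT => Nt; apply: hk.
    by rewrite /= mindicE mem_set// mulr1.
apply: lower_integral_ge => // t; rewrite /k/= mindicE.
have [Nt|Nt] := pselect (N t).
  by rewrite memNset ?mulr0// => /(_ Nt).
by rewrite mem_set// mulr1 (le_trans (hf t))// fg.
Qed.

Lemma le_integral_nonmeasurable f g : enneg f -> (forall t, f t <= g t) ->
  \int[mu]_t f t <= \int[mu]_t g t.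
Proof.
move=> f0 fg; apply: (@le_integral_off_null _ _ set0) => // t.
exact: le_trans (f0 t) (fg t).
Qed.

Lemma le_Lnorm_off_null (p : \bar R) f g (N : set T) : 0 < p -> measurable N ->
  mu N = 0 -> (forall t, ~ N t -> `|f t| <= `|g t|) -> Lnorm mu p f <= Lnorm mu p g.
Proof.
move=> p0 mN N0 fg; rewrite Lnorm.unlock; case: p p0 => [r r0|_|//].
  rewrite lte_fin in r0.
  apply: gt0_ler_poweR; rewrite ?invr_ge0 ?(ltW r0)// ?in_itv/= ?andbT ?leey ?integral_ge0//.
  - by move=> t _; exact: poweR_ge0.
  - by move=> t _; exact: poweR_ge0.
  apply: le_integral_off_null N0 _ _ _ => //.
  - by move=> t; exact: poweR_ge0.
  - by move=> t; exact: poweR_ge0.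
  by move=> t /fg fgt; apply: gt0_ler_poweR; rewrite ?(ltW r0)// in_itv/= ?abse_ge0 ?leey.
case: ifPn => // _; apply: le_ess_sup; exists N; split => // t /= nfg.
by apply: contrapT => /fg.
Qed.

Lemma le_integral_scale f (c : R) : (0 <= c)%R -> enneg f ->
  \int[mu]_t (c%:E * f t) <= c%:E * \int[mu]_t f t.
Proof.
rewrite le_eqVlt => /predU1P[<- _|c0 f0].
  by rewrite mul0e integral0_eq// => t _; rewrite mul0e.
apply: lower_integralP => [t|h hf]; first by rewrite mule_ge0// lee_fin ltW.
have ci0 : (0 <= c^-1)%R by rewrite invr_ge0 ltW.
have := @lower_integral_ge f (scale_nnsfun h ci0) f0 _.
rewrite /= => /(_ _)/(lee_wpmul2l _); move=> H.
have -> : \int[mu]_t (h t)%:E = c%:E * \int[mu]_t (c^-1 * h t)%:E.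
  rewrite -ge0_integralZl_EFin ?(ltW c0)//.
  - by apply: eq_integral => t _; rewrite -EFinM mulrA mulfV ?gt_eqF// mul1r.
  - by move=> t _; rewrite lee_fin mulr_ge0.
  - by apply/measurable_EFinP/measurable_funM.
apply: H; first by rewrite lee_fin ltW.
move=> t; rewrite EFinM -(@lee_pmul2l _ c%:E)// ?lte_fin//.
by rewrite -!EFinM mulrA mulfV ?gt_eqF// mul1r.
Qed.

Lemma le_LnormZ (p : R) f (c : R) : (0 < p)%R -> (0 <= c)%R ->
  Lnorm mu p%:E (fun t => c%:E * f t) <= c%:E * Lnorm mu p%:E f.
Proof.
move=> p0 c0; rewrite Lnorm.unlock.
have cE : c%:E = (c `^ p)%:E `^ p^-1 by rewrite poweR_EFin powRK// gt_eqF.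
rewrite [X in _ <= X * _]cE.
rewrite -poweRM ?lee_fin ?powR_ge0 ?integral_ge0//=; last by move=> t _; exact: poweR_ge0.
apply: gt0_ler_poweR; rewrite ?invr_ge0 ?(ltW p0)// ?in_itv/= ?andbT ?leey ?integral_ge0//.
- by move=> t _; exact: poweR_ge0.
- by rewrite mule_ge0// ?lee_fin ?powR_ge0// integral_ge0// => t _; exact: poweR_ge0.
apply: le_trans (le_integral_scale _ _); rewrite ?powR_ge0//; last first.
  by move=> t; exact: poweR_ge0.
apply: le_integral_nonmeasurable => t; first exact: poweR_ge0.
rewrite abseM gee0_abs ?lee_fin// ?poweRM ?abse_ge0//.
Qed.

(** Hölder's inequality against the indicator function of a set of finite measure. *)
Lemma le_Lnorm_exponent (p : R) (s : \bar R) f (A : set T) (l : R) :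
  (0 < p)%R -> p%:E <= s -> measurable A -> (0 < l)%R -> mu A = l%:E ->
  (forall t, ~ A t -> f t = 0) ->
  Lnorm mu p%:E f <= (l `^ (p^-1 - fine s^-1))%:E * Lnorm mu s f.
Proof.
move=> p0 ps mA l0 Al fA; have ip0 : (0 < p^-1)%R by rewrite invr_gt0.
have F0 t : 0 <= `|f t| `^ p by exact: poweR_ge0.
have pn0 : p != 0%R by rewrite gt_eqF.
case: s ps => [s ps|_|//]; last first.
  rewrite invey/= subr0 Lnorm.unlock.
  have A0 : 0 < mu A by rewrite Al lte_fin.
  have T0 : 0 < mu [set: T] by apply: lt_le_trans A0 _; apply: le_measure; rewrite ?inE.
  rewrite T0; have [N [mN N0 HN]] := ess_sup_ge mu (abse \o f).
  have M0 : 0 <= ess_sup mu (abse \o f).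
    by apply: ess_sup_gee => //; apply: nearW => t /=; exact: abse_ge0.
  case: (ess_sup _ _) M0 HN => [m m0 HN|_ _|//]; last first.
    by rewrite gt0_muley ?leey// lte_fin powR_gt0.
  rewrite lee_fin in m0.
  apply: (@le_trans _ _ ((m `^ p * l)%:E `^ p^-1)); last first.
    by rewrite poweR_EFin lee_fin powRM ?powR_ge0 ?(ltW l0)// powRK// mulrC.
  apply: gt0_ler_poweR; rewrite ?(ltW ip0) ?in_itv/= ?leey ?andbT ?integral_ge0//.
    by rewrite lee_fin mulr_ge0 ?powR_ge0// ltW.
  apply: (@le_trans _ _ (\int[mu]_t (m `^ p * \1_A t)%:E)).
    apply: le_integral_off_null N0 _ _ _ => // t.
      by rewrite lee_fin mulr_ge0 ?powR_ge0.
    move=> Nt; have [At|nAt] := pselect (A t); last first.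
      by rewrite fA// abse0 poweR0r// lee_fin mulr_ge0 ?powR_ge0.
    rewrite indicE mem_set// mulr1 -poweR_EFin.
    apply: gt0_ler_poweR; rewrite ?(ltW p0) ?in_itv/= ?leey ?andbT//.
    by apply: contrapT => /HN.
  under eq_integral do rewrite EFinM.
  rewrite ge0_integralZl_EFin ?powR_ge0//.
  - by rewrite integral_indic// setIT Al -EFinM.
  - exact/measurable_EFinP/measurable_indic.
rewrite lee_fin in ps; rewrite inver; have s0 : (0 < s)%R by exact: lt_le_trans ps.
rewrite gt_eqF//=; move: ps; rewrite le_eqVlt => /predU1P[<-|ps].
  by rewrite subrr powRr0 mul1e.
have sn0 : s != 0%R by rewrite gt_eqF.
have ps1 : (p / s < 1)%R by rewrite ltr_pdivrMr// mul1r.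
have r0 : (0 < s / p)%R by rewrite divr_gt0.
have q0 : (0 < (1 - p / s)^-1)%R by rewrite invr_gt0 subr_gt0.
have rq : ((s / p)^-1 + (1 - p / s)^-1^-1 = 1)%R by rewrite invf_div invrK; ring.
have G0 t : 0 <= `|f t| `^ s by exact: poweR_ge0.
have key : \int[mu]_t `|f t| `^ p <= (l `^ (1 - p / s))%:E * (\int[mu]_t `|f t| `^ s) `^ (p / s).
  apply: lower_integralP => // h hf.
  have mh : measurable_fun setT (h : T -> R) by [].
  have h1 := hoelder mu mh (@measurable_indic _ _ R setT A mA) r0 q0 rq.
  have -> : \int[mu]_t (h t)%:E = Lnorm mu 1 (EFin \o (h \* (\1_A : T -> R))%R).
    rewrite Lnorm1; apply: eq_integral => t _ /=; rewrite indicE.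
    have [At|nAt] := pselect (A t); first by rewrite mem_set// mulr1 ger0_norm.
    rewrite memNset// mulr0 normr0; apply/eqP; rewrite eq_le; apply/andP; split; last by rewrite lee_fin.
    by have := hf t; rewrite fA// abse0 poweR0r.
  apply: (le_trans h1); rewrite muleC; apply: lee_pmul; rewrite ?Lnorm_ge0//.
    rewrite Lnorm.unlock invrK.
    have -> : \int[mu]_t `|(EFin \o (\1_A : T -> R)) t| `^ (1 - p / s)^-1 = l%:E.
      rewrite -Al -[A in RHS]setIT -integral_indic//; apply: eq_integral => t _ /=.
      by rewrite indicE; case: (t \in A); rewrite ?normr1 ?normr0 ?powR1 ?powR0// gt_eqF.
    by rewrite poweR_EFin.
  rewrite Lnorm.unlock invf_div.
  have ps0 : (0 <= p / s)%R by rewrite ltW// divr_gt0.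
  apply: gt0_ler_poweR; rewrite ?in_itv/= ?leey ?andbT ?integral_ge0//.
  apply: le_integral_nonmeasurable => t; first by rewrite lee_fin powR_ge0.
  have -> : `|f t| `^ s = (`|f t| `^ p) `^ (s / p).
    by rewrite -poweRrM mulrC divfK.
  rewrite -poweR_EFin; apply: gt0_ler_poweR; rewrite ?(ltW r0) ?in_itv/= ?leey ?andbT ?lee_fin//.
  by rewrite ger0_norm.
rewrite Lnorm.unlock.
apply: (@le_trans _ _ (((l `^ (1 - p / s))%:E * (\int[mu]_t `|f t| `^ s) `^ (p / s)) `^ p^-1)).
  apply: gt0_ler_poweR; rewrite ?(ltW ip0) ?in_itv/= ?leey ?andbT ?integral_ge0//.
  by rewrite mule_ge0// ?lee_fin ?powR_ge0 ?poweR_ge0.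
rewrite poweRM ?lee_fin ?powR_ge0 ?poweR_ge0// poweR_EFin -powRrM -poweRrM.
have -> : ((1 - p / s) / p = p^-1 - s^-1)%R by field; rewrite pn0 sn0.
by have -> : (p / s / p = s^-1)%R by field; rewrite pn0 sn0.
Qed.

End LowerIntegral.

(** * Mixed norms *)

Lemma sum_inv_cons (R : realType) n (p0 : R) (p : n.-tuple R) :
  \sum_(i < n.+1) (tnth [tuple of p0 :: p] i)^-1 = p0^-1 + \sum_(i < n) (tnth p i)^-1.
Proof.
by rewrite big_ord_recl tnth0; congr (_ + _); apply: eq_bigr => i _; rewrite tnthS.
Qed.

Section Rn.
Context {R : realType}.
Local Open Scope ereal_scope.
Notation mu1 := (@lebesgue_measure R).

Lemma vcons_ord0 n (z : measurableTypeR R * Rn R n) : tnth (vcons z) ord0 = z.1.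
Proof. exact: tnth0. Qed.

Lemma vcons_lift n (z : measurableTypeR R * Rn R n) (i : 'I_n) :
  tnth (vcons z) (lift ord0 i) = tnth z.2 i.
Proof. exact: (tnthS z.1 z.2 i). Qed.

Lemma vconsP n (y : Rn R n.+1) : exists x t, y = vcons (x, t).
Proof. by exists (thead y), [tuple of behead y]; rewrite [LHS]tuple_eta. Qed.

Lemma measurable_slice n (f : Rn R n.+1 -> \bar R) (t : Rn R n) :
  measurable_fun setT f ->
  measurable_fun setT (fun x : measurableTypeR R => f (vcons (x, t))).
Proof.
move=> mf; apply: (measurableT_comp mf).
apply: (measurableT_comp (@measurable_vcons R n)).
exact: pair2_measurable.
Qed.

(** By definition, the measure is the image of a product measure. *)
Lemma tonelli_Rn n (f : Rn R n.+1 -> \bar R) : measurable_fun setT f -> enneg f ->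
  \int[lebesgueRn R n.+1]_z f z = \int[lebesgueRn R n]_t \int[mu1]_x f (vcons (x, t)).
Proof.
move=> mf f0.
pose pm : {measure set (Rn R n.+1) -> \bar R} :=
  measure_function_pushforward__canonical__measure_function_Measure
    (mu1 \x lebesgueRn R n)%E (@measurable_vcons R n).
rewrite (eq_measure_integral pm)//.
rewrite (ge0_integral_pushforward (@measurable_vcons R n))//.
rewrite preimage_setT fubini_tonelli2//; last by move=> x; exact: f0.
by apply: measurableT_comp => //; exact: measurable_vcons.
Qed.

Lemma measurable_slice_integral n (f : Rn R n.+1 -> \bar R) : measurable_fun setT f ->
  enneg f -> measurable_fun setT (fun t : Rn R n => \int[mu1]_x f (vcons (x, t))).
Proof.
move=> mf f0; apply: (@measurable_fun_fubini_tonelli_G _ _ _ _ _ mu1 (f \o @vcons R n)); last by move=> x; exact: f0.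
by apply: measurableT_comp => //; exact: measurable_vcons.
Qed.

Lemma measurable_abse_poweR d (T : measurableType d) (f : T -> \bar R) (p : R) :
  measurable_fun setT f -> measurable_fun setT (fun x => `|f x| `^ p).
Proof.
move=> mf; apply: (measurableT_comp (measurable_poweR p)).
exact: measurableT_comp.
Qed.

Lemma measurable_slice_Lnorm n (f : Rn R n.+1 -> \bar R) (p : R) : measurable_fun setT f ->
  measurable_fun setT (fun t : Rn R n => Lnorm mu1 p%:E (fun x => f (vcons (x, t)))).
Proof.
move=> mf; under eq_fun do rewrite Lnorm.unlock.
apply: (measurableT_comp (measurable_poweR p^-1)).
apply: (@measurable_slice_integral n (fun z => `|f z| `^ p)).
  exact: measurable_abse_poweR.
by move=> z; exact: poweR_ge0.
Qed.

Lemma measurable_slice_set n (N : set (Rn R n.+1)) (t : Rn R n) : measurable N ->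
  measurable [set x : measurableTypeR R | N (vcons (x, t))].
Proof.
move=> mN; have mf : measurable_fun setT (fun x : measurableTypeR R => vcons (x, t)).
  by apply: (measurableT_comp (@measurable_vcons R n)); exact: pair2_measurable.
by rewrite -[X in measurable X]setTI; exact: mf.
Qed.

(** Tonelli's theorem for the indicator function. *)
Lemma null_slices n (N : set (Rn R n.+1)) : measurable N -> lebesgueRn R n.+1 N = 0 ->
  exists M : set (Rn R n), [/\ measurable M, lebesgueRn R n M = 0 &
    forall t, ~ M t -> mu1 [set x | N (vcons (x, t))] = 0].
Proof.
move=> mN N0; pose F (t : Rn R n) := mu1 [set x | N (vcons (x, t))].
have FE t : F t = \int[mu1]_x (\1_N (vcons (x, t)))%:E.
  transitivity (\int[mu1]_x (\1_[set x | N (vcons (x, t))] x)%:E).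
    by rewrite integral_indic ?setIT//; exact: measurable_slice_set.
  by [].
have F0 t : 0 <= F t by exact: measure_ge0.
have m1 : measurable_fun setT (fun z : Rn R n.+1 => (\1_N z)%:E : \bar R).
  by apply/measurable_EFinP; exact: measurable_indic.
have mF : measurable_fun setT F.
  rewrite (_ : F = fun t => \int[mu1]_x (\1_N (vcons (x, t)))%:E); last exact/funext.
  by apply: (measurable_slice_integral m1) => z; rewrite lee_fin.
have IF : \int[lebesgueRn R n]_t `|F t| = 0.
  under eq_integral do rewrite gee0_abs// FE.
  rewrite -(tonelli_Rn m1) => [|z]; last by rewrite lee_fin.
  by rewrite integral_indic// setIT.
have [M [mM M0 HM]] := (ae_eq_integral_abs _ measurableT mF).1 IF.
exists M; split => // t nMt; apply: contrapT => Ft; apply: nMt; apply: HM => /=.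
by move=> /(_ I).
Qed.

Lemma mixed_normS n (p0 : \bar R) (p : n.-tuple (\bar R)) (f : Rn R n.+1 -> \bar R) :
  mixed_norm [tuple of p0 :: p] f =
  mixed_norm p (fun t => Lnorm mu1 p0 (fun x => f (vcons (x, t)))).
Proof.
rewrite /= theadE; congr (mixed_norm _ _); exact: val_inj.
Qed.

Lemma mixed_norm_ge0 n (p : n.-tuple (\bar R)) f : 0 <= mixed_norm p f.
Proof. by elim: n p f => [|n IH] p f /=; [exact: abse_ge0|exact: IH]. Qed.

(** A mixed norm is an iterated lower integral, so the exceptional set may be discarded slice
by slice, although the intermediate functions need not be measurable. *)
Lemma le_mixed_norm_off_null n (p : n.-tuple (\bar R)) (f g : Rn R n -> \bar R)
    (N : set (Rn R n)) : all (fun x => 0 < x) p -> measurable N ->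
  lebesgueRn R n N = 0 -> (forall t, ~ N t -> `|f t| <= `|g t|) ->
  mixed_norm p f <= mixed_norm p g.
Proof.
elim: n p f g N => [|n IH] p f g N.
  move=> _ mN N0 fg /=; apply: fg => Nt; move: N0.
  by rewrite /= diracE mem_set// => /eqP; rewrite onee_eq0.
case/tupleP: p => p0 p /= /andP[p00 p0s] mN N0 fg.
have [M [mM M0 HM]] := null_slices mN N0.
have := mixed_normS p0 p f; rewrite /= => ->; have := mixed_normS p0 p g; rewrite /= => ->.
apply: (IH _ _ _ M) => // t nMt; rewrite !gee0_abs ?Lnorm_ge0//.
apply: (le_Lnorm_off_null p00 (measurable_slice_set t mN) (HM _ nMt)) => x /= nN.
exact: fg.
Qed.

Lemma le_mixed_norm n (p : n.-tuple (\bar R)) (f g : Rn R n -> \bar R) :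
  all (fun x => 0 < x) p -> (forall t, `|f t| <= `|g t|) -> mixed_norm p f <= mixed_norm p g.
Proof. by move=> p0 fg; apply: (@le_mixed_norm_off_null _ _ _ _ set0). Qed.

Definition etuple n (p : n.-tuple R) : n.-tuple (\bar R) := [tuple of map EFin p].

Lemma etuple_cons n (p0 : R) (p : n.-tuple R) :
  etuple [tuple of p0 :: p] = [tuple of p0%:E :: etuple p].
Proof. exact: val_inj. Qed.

Lemma all_etuple n (p : n.-tuple R) (a : R) : all (fun x => (a < x)%R) p ->
  all (fun x => a%:E < x) (etuple p).
Proof. by rewrite all_map. Qed.

Lemma le_mixed_normZ n (p : n.-tuple R) (f : Rn R n -> \bar R) (c : R) :
  all (fun x => (0 < x)%R) p -> (0 <= c)%R ->
  mixed_norm (etuple p) (fun t => c%:E * f t) <= c%:E * mixed_norm (etuple p) f.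
Proof.
move=> + c0; elim: n p f => [|n IH] p f; first by rewrite /= abseM gee0_abs.
case/tupleP: p => p0 p /andP[p00 p0s]; rewrite etuple_cons !mixed_normS.
apply: le_trans (IH p _ p0s); apply: le_mixed_norm; first exact: all_etuple p0s.
move=> t; rewrite gee0_abs ?Lnorm_ge0// gee0_abs ?mule_ge0 ?Lnorm_ge0//.
exact: le_LnormZ.
Qed.

Lemma cube_vcons n (a0 l : R) (a : Rn R n) x t :
  cube [tuple of a0 :: a] l (vcons (x, t)) <-> (a0 <= x <= a0 + l)%R /\ cube a l t.
Proof.
split.
  move=> h; split; first by have := h ord0; rewrite vcons_ord0 tnth0.
  by move=> i; have := h (lift ord0 i); rewrite vcons_lift tnthS.
move=> [h0 h] i; case: (unliftP ord0 i) => [j ->|->]; last by rewrite vcons_ord0 tnth0.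
by rewrite vcons_lift tnthS; exact: h.
Qed.

Lemma lebesgue_itv (a l : R) : (0 < l)%R ->
  mu1 [set x : R | (a <= x <= a + l)%R] = l%:E.
Proof.
move=> l0; rewrite (_ : mkset _ = `[a, (a + l)%R]%classic); last first.
  by apply/seteqP; split => x /=; rewrite in_itv.
rewrite lebesgue_measure_itv/= lte_fin ltrDl l0 -EFinD; congr _%:E; ring.
Qed.

Lemma measurable_closed_itv (a l : R) :
  measurable [set x : measurableTypeR R | (a <= x <= a + l)%R].
Proof.
rewrite (_ : mkset _ = `[a, (a + l)%R]%classic); last first.
  by apply/seteqP; split => x /=; rewrite in_itv.
exact: measurable_itv.
Qed.

(** Hölder's inequality on an interval, in each variable. *)
Lemma mixed_norm_exponent n (p : n.-tuple R) (s : n.-tuple (\bar R)) (a : Rn R n) (l : R)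
    (f : Rn R n -> \bar R) :
  all2 (fun p s => ((0 < p)%R && (p%:E <= s))) p s -> (0 < l)%R ->
  (forall x, ~ cube a l x -> f x = 0) ->
  mixed_norm (etuple p) f <=
  (l `^ (\sum_(i < n) (tnth p i)^-1 - sum_recip s))%:E * mixed_norm s f.
Proof.
move=> + l0; elim: n p s a f => [|n IH] p s a f.
  by rewrite /sum_recip !big_ord0 subr0 powRr0 mul1e.
case/tupleP: p => p0 p; case/tupleP: s => s0 s; case/tupleP: a => a0 a.
move=> /andP[/andP[p00 ps0] pss] f0; rewrite etuple_cons !mixed_normS.
set c := (l `^ (p0^-1 - fine s0^-1))%R; have c0 : (0 <= c)%R by exact: powR_ge0.
pose F t := Lnorm mu1 s0 (fun x => f (vcons (x, t))).
have ps' : all (fun x => (0 < x)%R) p.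
  by elim: {IH f f0 F a}n p s pss => [|n IH] p s; [rewrite tuple0|
    case/tupleP: p => p1 p; case/tupleP: s => s1 s /= /andP[/andP[-> _] /IH]].
apply: (@le_trans _ _ (mixed_norm (etuple p) (fun t => c%:E * F t))).
  apply: le_mixed_norm; first exact: all_etuple ps'.
  move=> t; rewrite !gee0_abs ?mule_ge0 ?lee_fin ?Lnorm_ge0//.
  apply: (le_Lnorm_exponent p00 ps0 (measurable_closed_itv a0 l) l0 (lebesgue_itv a0 l0)).
  by move=> x nx; apply: f0 => /cube_vcons[].
apply: (le_trans (le_mixed_normZ F ps' c0)).
have F0 t : ~ cube a l t -> F t = 0.
  move=> nt; rewrite /F (_ : (fun x => _) = cst 0) ?Lnorm0//.
    by rewrite gt_eqF// (lt_le_trans _ ps0).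
  by apply/funext => x; apply: f0 => /cube_vcons[].
apply: (le_trans (lee_wpmul2l _ (IH p s a F pss F0))); first by rewrite lee_fin.
rewrite muleA -EFinM /c -powRD; last by rewrite (gt_eqF l0) implybT.
have -> : sum_recip [tuple of s0 :: s] = (fine s0^-1 + sum_recip s)%R.
  rewrite /sum_recip big_ord_recl tnth0; congr (_ + _)%R.
  by apply: eq_bigr => i _; rewrite tnthS.
by rewrite sum_inv_cons opprD addrACA.
Qed.

End Rn.

(** * Minkowski, Hölder and Fatou for mixed norms *)

Section Einf.
Context {R : realType}.
Local Open Scope ereal_scope.
Implicit Types u : (\bar R)^nat.

Lemma limn_einfE u : limn_einf u = ereal_sup (range (einfs u)).
Proof. by rewrite limn_einf_lim; apply: cvg_lim => //; exact: cvg_einfs_sup. Qed.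

Lemma einfs_ge u n (a : \bar R) : (forall k, (n <= k)%N -> a <= u k) -> a <= einfs u n.
Proof. by move=> h; apply: le_ereal_inf_tmp => _ [k /= nk <-]; exact: h. Qed.

Lemma einfs_le u n k : (n <= k)%N -> einfs u n <= u k.
Proof. by move=> nk; apply: ereal_inf_lbound; exists k. Qed.

Lemma limn_einf_ge n u (a : \bar R) : (forall k, (n <= k)%N -> a <= u k) -> a <= limn_einf u.
Proof.
move=> h; rewrite limn_einfE; apply: le_trans (einfs_ge h) _.
by apply: ereal_sup_ubound; exists n.
Qed.

Lemma limn_einf_le u (b : \bar R) : (forall k, u k <= b) -> limn_einf u <= b.
Proof.
move=> h; rewrite limn_einfE; apply: ge_ereal_sup => _ [n _ <-].
exact: le_trans (einfs_le _ (leqnn n)) (h n).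
Qed.

Lemma le_poweR (r : R) (a b : \bar R) : (0 < r)%R -> 0 <= a -> a <= b -> a `^ r <= b `^ r.
Proof.
move=> r0 a0 ab; apply: gt0_ler_poweR; rewrite ?(ltW r0)// in_itv/= leey ?a0//.
by rewrite (le_trans a0 ab).
Qed.

Lemma poweRK (r : R) (a : \bar R) : (0 < r)%R -> 0 <= a -> (a `^ r) `^ r^-1 = a.
Proof. by move=> r0 a0; rewrite -poweRrM mulfV ?gt_eqF// poweRe1. Qed.

Lemma poweR_limn_einf u (r : R) : (0 < r)%R -> (forall k, 0 <= u k) ->
  (limn_einf u) `^ r <= limn_einf (fun k => u k `^ r).
Proof.
move=> r0 u0; have r'0 : (0 < r^-1)%R by rewrite invr_gt0.
pose L := limn_einf (fun k => u k `^ r); rewrite -/L.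
have L0 : 0 <= L by apply: (limn_einf_ge (n := 0%N)) => k _; exact: poweR_ge0.
suff uL : limn_einf u <= L `^ r^-1.
  rewrite -[leRHS](@poweRK r^-1)// invrK; apply: le_poweR => //.
  by apply: (limn_einf_ge (n := 0%N)) => k _.
rewrite limn_einfE; apply: ge_ereal_sup => _ [n _ <-].
have e0 : 0 <= einfs u n by exact: einfs_ge.
rewrite -[leLHS](poweRK r0)//; apply: le_poweR; rewrite ?poweR_ge0//.
apply: (limn_einf_ge (n := n)) => k nk; apply: le_poweR => //; exact: einfs_le.
Qed.

End Einf.

Section LnormExtended.
Context d {T : measurableType d} {R : realType}.
Variable mu : {measure set T -> \bar R}.
Local Open Scope ereal_scope.
Implicit Types f g : T -> \bar R.

Lemma Lnorm_fin_ae f (p : R) : (0 < p)%R -> measurable_fun setT f ->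
  Lnorm mu p%:E f < +oo ->
  exists N, [/\ measurable N, mu N = 0 & forall t, ~ N t -> f t = (fine (f t))%:E].
Proof.
move=> p0 mf fp; have pn0 : p != 0%R by rewrite gt_eqF.
have : mu.-integrable setT (fun t => `|f t| `^ p).
  apply/integrableP; split; first exact: measurable_abse_poweR.
  under eq_integral do rewrite gee0_abs ?poweR_ge0//.
  by rewrite -poweR_Lnorm//; exact: poweR_lty.
move=> /(integrable_ae measurableT)[N [mN N0 HN]].
exists N; split => // t nNt; rewrite fineK//; apply: contrapT => nf; apply: nNt; apply: HN.
move=> /(_ I); rewrite /= => h; apply: nf; move: h.
by case: (f t) => //=; rewrite (negbTE pn0).
Qed.

Lemma eq_Lnorm_off_null f g (p : \bar R) N : 0 < p -> measurable N -> mu N = 0 ->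
  (forall t, ~ N t -> f t = g t) -> Lnorm mu p f = Lnorm mu p g.
Proof.
move=> p0 mN N0 fg; apply/eqP; rewrite eq_le.
by rewrite !(le_Lnorm_off_null p0 mN N0) // => t /fg ->.
Qed.

(** Functions of finite norm are finite off a null set, so this follows from the inequality
for real functions. *)
Lemma le_LnormD f g (p : R) : (1 <= p)%R -> measurable_fun setT f -> measurable_fun setT g ->
  Lnorm mu p%:E (fun t => f t + g t) <= Lnorm mu p%:E f + Lnorm mu p%:E g.
Proof.
move=> p1 mf mg; have p0 : (0 < p)%R by rewrite (lt_le_trans ltr01).
have [foo|fy] := eqVneq (Lnorm mu p%:E f) +oo.
  by rewrite foo addye ?leey// gt_eqF// (lt_le_trans _ (Lnorm_ge0 _ _ _)).
have [goo|gy] := eqVneq (Lnorm mu p%:E g) +oo.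
  by rewrite goo addey ?leey// gt_eqF// (lt_le_trans _ (Lnorm_ge0 _ _ _)).
have [N [mN N0 fN]] := Lnorm_fin_ae p0 mf (ltac:(by rewrite ltey)).
have [M [mM M0 gM]] := Lnorm_fin_ae p0 mg (ltac:(by rewrite ltey)).
have mNM : measurable (N `|` M) by exact: measurableU.
have NM0 : mu (N `|` M) = 0 by rewrite measureU0.
have mf' : measurable_fun setT (fine \o f) by exact: measurableT_comp.
have mg' : measurable_fun setT (fine \o g) by exact: measurableT_comp.
have pE : 0 < p%:E by rewrite lte_fin.
have -> : Lnorm mu p%:E f = Lnorm mu p%:E (EFin \o (fine \o f)).
  exact: (eq_Lnorm_off_null pE mN N0).
have -> : Lnorm mu p%:E g = Lnorm mu p%:E (EFin \o (fine \o g)).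
  exact: (eq_Lnorm_off_null pE mM M0).
apply: le_trans (minkowski_EFin mu mf' mg' p1).
apply: (le_Lnorm_off_null pE mNM NM0) => t /not_orP[/fN -> /gM ->].
by [].
Qed.

(** Hölder's inequality, in the form that does not meet the product of 0 and infinity. *)
Lemma le_integral_Lnorm f (g : T -> R) (p : R) (c : R) : (1 < p)%R -> (0 < c)%R ->
  measurable_fun setT f -> enneg f -> measurable_fun setT g -> (forall t, 0 <= g t)%R ->
  Lnorm mu (dual p)%:E (EFin \o g) <= c%:E ->
  \int[mu]_t (f t * (g t)%:E) <= c%:E * Lnorm mu p%:E f.
Proof.
move=> p1 c0 mf f0 mg g0 gc; have p0 := lt_trans ltr01 p1.
have q0 : (0 < dual p)%R by rewrite (lt_trans ltr01)// dual_gt1.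
have [->|fy] := eqVneq (Lnorm mu p%:E f) +oo; first by rewrite gt0_muley ?leey.
have [N [mN N0 fN]] := Lnorm_fin_ae p0 mf (ltac:(by rewrite ltey)).
have mf' : measurable_fun setT (fine \o f) by exact: measurableT_comp.
have h := hoelder mu mf' mg p0 q0 (dual_conj p1).
have -> : Lnorm mu p%:E f = Lnorm mu p%:E (EFin \o (fine \o f)).
  by apply: (eq_Lnorm_off_null _ mN N0) => //; rewrite lte_fin.
rewrite muleC; apply: le_trans (lee_wpmul2l (Lnorm_ge0 _ _ _) gc); apply: le_trans h.
rewrite Lnorm1; apply: (le_integral_off_null mN N0) => // t.
- by rewrite mule_ge0 ?lee_fin.
- by move=> /fN ->; rewrite -EFinM lee_fin ler_norm.
Qed.

End LnormExtended.

Section MixedNorm.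
Context {R : realType}.
Local Open Scope ereal_scope.
Notation mu1 := (@lebesgue_measure R).

Lemma mixed_norm0 n (p : n.-tuple (\bar R)) : all (fun x => 0 < x) p ->
  mixed_norm p (fun=> 0) = 0.
Proof.
elim: n p => [|n IH] p; first by move=> _; exact: abse0.
case/tupleP: p => p0 p /andP[p00 ps0]; rewrite mixed_normS -[RHS](IH p ps0).
by congr mixed_norm; apply/funext => t; rewrite Lnorm0// gt_eqF.
Qed.

Lemma le_mixed_normD n (p : n.-tuple R) (f g : Rn R n -> \bar R) :
  all (fun x => (1 <= x)%R) p -> measurable_fun setT f -> measurable_fun setT g ->
  enneg f -> enneg g ->
  mixed_norm (etuple p) (fun x => f x + g x) <=
  mixed_norm (etuple p) f + mixed_norm (etuple p) g.
Proof.
elim: n p f g => [|n IH] p f g; first by move=> _ _ _ f0 g0; exact: lee_abs_add.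
case/tupleP: p => p0 p /andP[p01 ps1] mf mg f0 g0; rewrite etuple_cons !mixed_normS.
have ps0 : all (fun x => (0 < x)%R) p.
  by apply: sub_all ps1 => x; exact: lt_le_trans.
apply: le_trans (IH _ _ _ ps1 _ _ _ _).
- apply: le_mixed_norm; first exact: all_etuple ps0.
  move=> t; rewrite !gee0_abs ?adde_ge0 ?Lnorm_ge0//.
  by apply: le_LnormD => //; exact: measurable_slice.
- exact: measurable_slice_Lnorm.
- exact: measurable_slice_Lnorm.
- by move=> t; exact: Lnorm_ge0.
- by move=> t; exact: Lnorm_ge0.
Qed.

Lemma le_mixed_norm_sum n (p : n.-tuple R) (I : Type) (r : seq I) (F : I -> Rn R n -> \bar R) :
  all (fun x => (1 <= x)%R) p -> (forall i, measurable_fun setT (F i)) ->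
  (forall i, enneg (F i)) ->
  mixed_norm (etuple p) (fun x => \sum_(i <- r) F i x) <=
  \sum_(i <- r) mixed_norm (etuple p) (F i).
Proof.
move=> p1 mF F0; elim: r => [|i r IH].
  rewrite big_nil; under eq_fun do rewrite big_nil.
  by rewrite mixed_norm0//; apply: all_etuple; apply: sub_all p1 => x; exact: lt_le_trans.
rewrite big_cons; under eq_fun do rewrite big_cons.
apply: le_trans (leeD (lexx _) IH); apply: le_mixed_normD => //.
- exact: emeasurable_sum.
- by move=> x; exact: sume_ge0.
Qed.

(** Fatou's lemma in each variable. *)
Lemma mixed_norm_fatou n (p : n.-tuple R) (S : nat -> Rn R n -> \bar R) (B : \bar R) :
  all (fun x => (0 < x)%R) p -> (forall k, measurable_fun setT (S k)) ->
  (forall k, enneg (S k)) -> (forall k, mixed_norm (etuple p) (S k) <= B) ->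
  mixed_norm (etuple p) (fun x => limn_einf (S^~ x)) <= B.
Proof.
have L0 m (S' : nat -> Rn R m -> \bar R) x : (forall k, enneg (S' k)) ->
    0 <= limn_einf (S'^~ x).
  by move=> S0; apply: (limn_einf_ge (n := 0%N)) => k _; exact: S0.
elim: n p S => [|n IH] p S.
  move=> _ _ S0 SB /=; rewrite gee0_abs; last exact: L0.
  by apply: limn_einf_le => k; have := SB k; rewrite /= gee0_abs.
case/tupleP: p => p0 p /andP[p00 ps0] mS S0 SB; rewrite etuple_cons mixed_normS.
apply: le_trans (IH p (fun k t => Lnorm mu1 p0%:E (fun x => S k (vcons (x, t)))) ps0 _ _ _).
- apply: le_mixed_norm; first exact: all_etuple ps0.
  move=> t; rewrite !gee0_abs ?Lnorm_ge0//; last first.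
    by apply: (limn_einf_ge (n := 0%N)) => k _; exact: Lnorm_ge0.
  have ip0 : (0 < p0^-1)%R by rewrite invr_gt0.
  have I0 k : 0 <= \int[mu1]_x `|S k (vcons (x, t))| `^ p0.
    by apply: integral_ge0 => x _; exact: poweR_ge0.
  rewrite Lnorm.unlock; apply: le_trans (poweR_limn_einf ip0 I0).
  apply: le_poweR => //; first by apply: integral_ge0 => x _; exact: poweR_ge0.
  apply: (le_trans _ (fatou mu1 measurableT _ _)) => //=.
  + apply: le_integral_nonmeasurable => x; first exact: poweR_ge0.
    rewrite gee0_abs; last exact: L0.
    apply: (le_trans (poweR_limn_einf p00 _)) => //.
    by under eq_fun do rewrite -[X in X `^ _]gee0_abs//.
  + by move=> k; apply: measurable_abse_poweR; exact: measurable_slice.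
  + by move=> k x _; exact: poweR_ge0.
- by move=> k; exact: measurable_slice_Lnorm.
- by move=> k t; exact: Lnorm_ge0.
- by move=> k; have := SB k; rewrite etuple_cons mixed_normS.
Qed.

End MixedNorm.

(** * Step functions on grids *)

Section Cells.
Context {R : realType} (K : nat) (h : R).
Hypothesis h0 : 0 < h.
Notation I := 'I_(2 ^ K).
Notation mu1 := (@lebesgue_measure R).

(** Half-open, so that the cells of a grid are disjoint. *)
Definition cell (o : R) (j : nat) (x : R) : bool := o + h * j%:R <= x < o + h * j.+1%:R.

Lemma cell_inj o i j x : cell o i x -> cell o j x -> i = j.
Proof.
wlog ij : i j / (i <= j)%N => [H|].
  by have [/H|/ltnW/H H' xi xj] := leqP i j; [exact|rewrite (H' xj xi)].
move=> /andP[_ xi] /andP[xj _]; apply/eqP; rewrite eqn_leq ij/= leqNgt; apply/negP => lij.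
have : h * i.+1%:R <= h * j%:R by rewrite ler_pM2l// ler_nat.
by move: xi xj; lra.
Qed.

Definition cellR o (j : I) x : R := (cell o j x)%:R.

Lemma cell_setE o j : [set x | cell o j x] = `[o + h * j%:R, o + h * j.+1%:R[%classic.
Proof. by apply/seteqP; split => x /=; rewrite in_itv. Qed.

Lemma cellR_indic o j : cellR o j = \1_[set x | cell o j x].
Proof.
apply/funext => x; rewrite indicE /cellR; congr (_%:R).
case: (boolP (cell o j x)) => [hx|/negP hx]; first by rewrite mem_set.
by rewrite memNset.
Qed.

Lemma measurable_cellR o j : measurable_fun setT (cellR o j : measurableTypeR R -> R).
Proof.
rewrite cellR_indic cell_setE; apply: measurable_indic; exact: measurable_itv.
Qed.

Lemma integral_cellR o j : (\int[mu1]_x (cellR o j x)%:E)%E = h%:E.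
Proof.
rewrite cellR_indic cell_setE integral_indic//.
rewrite setIT; apply: (eq_trans (lebesgue_measure_itv _)); rewrite /= lte_fin ltrD2l ltr_pM2l// ltr_nat ltnSn.
by rewrite -EFinB; congr (_%:E); rewrite -natr1; ring.
Qed.

Lemma sum_cellR (a : I -> R) o x : (exists2 j, cell o (j : I) x & \sum_j a j * cellR o j x = a j) \/
  ((forall j : I, cellR o j x = 0) /\ \sum_j a j * cellR o j x = 0).
Proof.
have [/existsP[j xj]|/existsPn nx] := boolP [exists j : I, cell o j x].
  left; exists j => //; rewrite (bigD1 j)//= /cellR xj mulr1 big1 ?addr0// => i ij.
  rewrite (_ : cell o i x = false) ?mulr0//; apply: contraNF ij => xi.
  by apply/eqP/val_inj; exact: cell_inj xi xj.
have N j : cellR o j x = 0 by rewrite /cellR (negbTE (nx j)).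
by right; split => //; rewrite big1// => j _; rewrite N mulr0.
Qed.

Lemma Lnorm_cells (s : R) (a : I -> R) o : 0 < s -> nneg a ->
  Lnorm mu1 s%:E (fun x => (\sum_j a j * cellR o j x)%:E) = (h `^ s^-1 * lp s a)%:E.
Proof.
move=> s0 a0; rewrite Lnorm.unlock.
have -> : (\int[mu1]_x `|(\sum_j a j * cellR o j x)%:E| `^ s)%E =
    (\int[mu1]_x \sum_(j : I) (a j `^ s * cellR o j x)%:E)%E.
  apply: eq_integral => x _; rewrite sumEFin/= ger0_norm; last first.
    by apply: sumr_ge0 => j _; rewrite mulr_ge0.
  congr (_%:E); have [[j xj ->]|[N ->]] := sum_cellR a o x.
    have [[i xi ->]|[N _]] := sum_cellR (fun j => a j `^ s) o x.
      by rewrite (val_inj (cell_inj xi xj)).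
    by have := N j; rewrite /cellR xj => /eqP; rewrite oner_eq0.
  by rewrite powR0 ?gt_eqF// big1// => j _; rewrite N mulr0.
rewrite ge0_integral_sum//; last 2 first.
- move=> j; apply/measurable_EFinP; apply: measurable_funM => //.
  exact: measurable_cellR.
- by move=> j x _; rewrite lee_fin mulr_ge0 ?powR_ge0.
have E (j : I) : (\int[mu1]_x (a j `^ s * cellR o j x)%:E = (a j `^ s * h)%:E)%E.
  under eq_integral do rewrite EFinM.
  rewrite ge0_integralZl_EFin ?powR_ge0 ?integral_cellR//.
    by move=> x _; rewrite lee_fin.
  by apply/measurable_EFinP; exact: measurable_cellR.
under eq_bigr do rewrite E.
rewrite sumEFin poweR_EFin -mulr_suml powRM ?sum_powR_ge0 ?(ltW h0)//.
by rewrite mulrC lpE.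
Qed.

Definition cell_indic n (o : n.-tuple R) (b : n.-tuple I) (x : Rn R n) : R :=
  \prod_(i < n) cellR (tnth o i) (tnth b i) (tnth x i).

Lemma cell_indic_ge0 n (o : n.-tuple R) b x : 0 <= cell_indic o b x.
Proof. by apply: prodr_ge0 => i _. Qed.

Lemma cell_indic_vcons n o0 (o : n.-tuple R) (b0 : I) (b : n.-tuple I) x (t : Rn R n) :
  cell_indic [tuple of o0 :: o] [tuple of b0 :: b] (vcons (x, t)) = cellR o0 b0 x * cell_indic o b t.
Proof.
rewrite /cell_indic big_ord_recl vcons_ord0 !tnth0; congr (_ * _).
by apply: eq_bigr => i _; rewrite vcons_lift !tnthS.
Qed.

Lemma measurable_cell_indic n (o : n.-tuple R) b : measurable_fun setT (cell_indic o b).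
Proof.
apply: measurable_prod => i _.
apply: (measurableT_comp (measurable_cellR _ _)); exact: measurable_tnth.
Qed.

Definition step n (o : n.-tuple R) (phi : seq I -> R) (x : Rn R n) : R :=
  \sum_(b : n.-tuple I) phi b * cell_indic o b x.

Lemma step_ge0 n (o : n.-tuple R) phi x : nneg phi -> 0 <= step o phi x.
Proof. by move=> p0; apply: sumr_ge0 => b _; rewrite mulr_ge0 ?cell_indic_ge0. Qed.

Lemma measurable_step n (o : n.-tuple R) phi : measurable_fun setT (step o phi).
Proof.
apply: measurable_sum => b; apply: measurable_funM => //; exact: measurable_cell_indic.
Qed.

Lemma step_vcons n o0 (o : n.-tuple R) phi x (t : Rn R n) :
  step [tuple of o0 :: o] phi (vcons (x, t)) =
  \sum_b0 step o (fun b => phi (b0 :: b)) t * cellR o0 b0 x.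
Proof.
rewrite /step big_tuple_cons; apply: eq_bigr => b0 _; rewrite mulr_suml.
by apply: eq_bigr => b _; rewrite cell_indic_vcons -mulrA; congr (_ * _); exact: mulrC.
Qed.

(** The cells are disjoint, so a step function takes at a point the value at one cell, or 0
outside the grid. *)
Lemma stepP n (o : n.-tuple R) x :
  (exists b : n.-tuple I, forall phi, step o phi x = phi b) \/ (forall phi, step o phi x = 0).
Proof.
elim: n o x => [|n IH] o x.
  left; exists [tuple] => phi; rewrite /step big_tuple0 /cell_indic big_ord0 mulr1//.
case/tupleP: o => o0 o; have [x0 [t ->]] := vconsP x.
have [[b Hb]|N] := IH o t; last first.
  by right => phi; rewrite step_vcons big1// => b0 _; rewrite N mul0r.
have [[b0 xb0 _]|[N _]] := sum_cellR (fun=> 1) o0 x0; last first.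
  by right => phi; rewrite step_vcons big1// => b0 _; rewrite N mulr0.
left; exists [tuple of b0 :: b] => phi; rewrite step_vcons.
under eq_bigr do rewrite Hb.
have [[b1 xb1 ->]|[N _]] := sum_cellR (fun b1 => phi (b1 :: b)) o0 x0.
  by rewrite (val_inj (cell_inj xb1 xb0)).
by have := N b0; rewrite /cellR xb0 => /eqP; rewrite oner_eq0.
Qed.

(** In each variable the norm of a step function is a power of the mesh times the norm of its
sequence of values. *)
Lemma mixed_norm_step n (s : n.-tuple R) (o : n.-tuple R) (phi : seq I -> R) :
  all (fun x => 0 < x) s -> nneg phi ->
  (mixed_norm (etuple s) (fun x => (step o phi x)%:E) <=
   (h `^ (\sum_(i < n) (tnth s i)^-1) * dnorm s phi)%:E)%E.
Proof.
elim: n s o phi => [|n IH] s o phi.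
  move=> _ p0 /=; rewrite /step big_tuple0 /cell_indic !big_ord0 powRr0 mulr1 mul1r.
  by rewrite (tuple0 s)/= ger0_norm.
case/tupleP: s => s0 s; case/tupleP: o => o0 o /andP[s00 ss0] p0.
rewrite etuple_cons mixed_normS.
pose phi1 t := h `^ s0^-1 * lp s0 (fun b0 => phi (b0 :: t)).
have phi10 : nneg phi1 by move=> t; rewrite mulr_ge0 ?powR_ge0 ?lp_ge0.
have -> : (fun t => Lnorm mu1 s0%:E (fun x => (step [tuple of o0 :: o] phi (vcons (x, t)))%:E)) =
    (fun t => (step o phi1 t)%:E).
  apply/funext => t; under eq_Lnorm do rewrite step_vcons.
  rewrite Lnorm_cells// => [|b0]; last exact: step_ge0.
  congr (_%:E); have [[b Hb]|N] := stepP o t.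
    by rewrite Hb /phi1; congr (_ * _); apply: eq_lp => b0; rewrite Hb.
  rewrite N lpE big1 => [|b0 _]; last by rewrite N powR0// gt_eqF.
  by rewrite powR0 ?mulr0// invr_eq0 gt_eqF.
apply: (le_trans (IH s o phi1 ss0 phi10)); rewrite lee_fin /phi1 dnormZ ?powR_ge0//; last first.
  by move=> t; exact: lp_ge0.
rewrite sum_inv_cons powRD ?(gt_eqF h0) ?implybT// /= mulrA [h `^ s0^-1 * _]mulrC; exact: lexx.
Qed.

Definition cell_integral n (o : n.-tuple R) (f : Rn R n -> \bar R) (b : n.-tuple I) : \bar R :=
  (\int[lebesgueRn R n]_y (f y * (cell_indic o b y)%:E))%E.

(** Averaging over cells does not increase mixed norms; in the innermost variable this
is duality and Hölder's inequality. *)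
Lemma dnorm_cell_integral n (p : n.-tuple R) (o : n.-tuple R) (f : Rn R n -> \bar R) (A : seq I -> R) :
  all (fun x => 1 < x) p -> measurable_fun setT f -> enneg f -> nneg A ->
  (forall b : n.-tuple I, (A b)%:E <= cell_integral o f b)%E ->
  ((dnorm p A)%:E <= (h `^ (n%:R - \sum_(i < n) (tnth p i)^-1))%:E * mixed_norm (etuple p) f)%E.
Proof.
elim: n p o f A => [|n IH] p o f A.
  move=> _ mf f0 A0 HA; rewrite big_ord0 subr0 powRr0 mul1e /= (tuple0 p)/=.
  have := HA [tuple]; rewrite /cell_integral /cell_indic.
  under eq_integral do rewrite big_ord0 mule1.
  by rewrite /= integral_dirac// diracE mem_set// mul1e gee0_abs.
case/tupleP: p => p0 p; case/tupleP: o => o0 o /andP[p01 ps1] mf f0 A0 HA.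
rewrite etuple_cons mixed_normS.
have p00 := lt_trans ltr01 p01; have q1 := dual_gt1 p01; have q0 := lt_trans ltr01 q1.
pose F t := Lnorm mu1 p0%:E (fun x => f (vcons (x, t))).
have mF : measurable_fun setT F by exact: measurable_slice_Lnorm.
have F0 t : (0 <= F t)%E by exact: Lnorm_ge0.
pose B b := lp p0 (fun b0 => A (b0 :: b)).
pose c := h `^ (dual p0)^-1; have c0 : 0 < c by exact: powR_gt0.
have HB (b : n.-tuple I) : ((B b)%:E <= c%:E * cell_integral o F b)%E.
  rewrite /B; have [g [g0 g1 <-]] := lp_dual p01 q0 (dual_conj p01) (fun b0 => A0 (b0 :: b)).
  pose G x := \sum_b0 g b0 * cellR o0 b0 x.
  have G0 x : 0 <= G x by apply: sumr_ge0 => b0 _; rewrite mulr_ge0.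
  have mG : measurable_fun setT (G : measurableTypeR R -> R).
    by apply: measurable_sum => b0; apply: measurable_funM => //; exact: measurable_cellR.
  have mcind (b0 : I) : measurable_fun setT
      (fun y : Rn R n.+1 => f y * (cell_indic [tuple of o0 :: o] [tuple of b0 :: b] y)%:E)%E.
    by apply: emeasurable_funM => //; apply/measurable_EFinP; exact: measurable_cell_indic.
  apply: (@le_trans _ _ (\sum_(b0 : I) (g b0)%:E * cell_integral [tuple of o0 :: o] f [tuple of b0 :: b])%E).
    rewrite -sumEFin; apply: lee_sum => b0 _; rewrite mulrC EFinM.
    by apply: lee_wpmul2l; [rewrite lee_fin|exact: (HA [tuple of b0 :: b])].
  have -> : (\sum_(b0 : I) (g b0)%:E * cell_integral [tuple of o0 :: o] f [tuple of b0 :: b] =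
     \int[lebesgueRn R n.+1]_y \sum_(b0 : I) ((g b0)%:E *
         (f y * (cell_indic [tuple of o0 :: o] [tuple of b0 :: b] y)%:E)))%E.
    rewrite ge0_integral_sum//.
    - apply: eq_bigr => b0 _; rewrite ge0_integralZl_EFin// => y _.
      by rewrite mule_ge0 ?lee_fin ?cell_indic_ge0.
    - by move=> b0; apply: emeasurable_funM.
    - by move=> b0 y _; rewrite !mule_ge0 ?lee_fin ?cell_indic_ge0.
  rewrite tonelli_Rn; last 2 first.
  - by apply: emeasurable_sum => b0; apply: emeasurable_funM.
  - by move=> y; apply: sume_ge0 => b0 _; rewrite !mule_ge0 ?lee_fin ?cell_indic_ge0.
  rewrite /cell_integral -ge0_integralZl_EFin ?(ltW c0)//; last 2 first.
  - by move=> t _; rewrite mule_ge0 ?lee_fin ?cell_indic_ge0.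
  - by apply: emeasurable_funM => //; apply/measurable_EFinP; exact: measurable_cell_indic.
  have tgt0 x t : (0 <= \sum_(b0 : I) ((g b0)%:E *
      (f (vcons (x, t)) * (cell_indic [tuple of o0 :: o] [tuple of b0 :: b] (vcons (x, t)))%:E)))%E.
    by apply: sume_ge0 => b0 _; rewrite !mule_ge0 ?lee_fin ?cell_indic_ge0.
  apply: le_integral_nonmeasurable => t; first by apply: integral_ge0 => x _.
  apply: (@le_trans _ _ ((cell_indic o b t)%:E * \int[mu1]_x (f (vcons (x, t)) * (G x)%:E))%E).
    apply: le_trans (le_integral_scale _ (cell_indic_ge0 _ _ _) _); last first.
      by move=> x; rewrite mule_ge0 ?lee_fin.
    rewrite le_eqVlt; apply/orP; left; apply/eqP; apply: eq_integral => x _.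
    rewrite /G -sumEFin ge0_sume_distrr => [|b0 _]; last by rewrite lee_fin mulr_ge0.
    rewrite ge0_sume_distrr => [|b0 _]; last by rewrite mule_ge0 ?lee_fin ?mulr_ge0.
    apply: eq_bigr => b0 _; rewrite cell_indic_vcons.
    rewrite [RHS]muleCA [LHS]muleCA -EFinM -EFinM; congr (_ * _%:E)%E.
    by ring.
  rewrite [leRHS]muleA [leRHS]muleC; apply: lee_wpmul2l; first by rewrite lee_fin cell_indic_ge0.
  apply: (@le_integral_Lnorm _ _ _ mu1 (fun x => f (vcons (x, t))) G p0 c p01 c0) => //.
    exact: measurable_slice.
  rewrite (Lnorm_cells _ q0 g0) /c lee_fin -[leRHS]mulr1.
  by apply: ler_wpM2l => //; exact: powR_ge0.
have B0 : nneg B by move=> b; exact: lp_ge0.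
have ci0 : 0 <= c^-1 by rewrite invr_ge0 ltW.
have A'0 b : 0 <= c^-1 * B b by exact: mulr_ge0.
have HA' (b : n.-tuple I) : ((c^-1 * B b)%:E <= cell_integral o F b)%E.
  rewrite -(@lee_pmul2l _ c%:E)// ?lte_fin//.
  by rewrite -EFinM mulrA mulfV ?gt_eqF// mul1r; exact: HB.
have := IH p o F _ ps1 mF F0 A'0 HA'; rewrite dnormZ//; last first.
  by apply/allP => x xp; exact: lt_trans ltr01 (allP ps1 x xp).
rewrite EFinM => /(lee_wpmul2l (x := c%:E)); rewrite lee_fin (ltW c0) => /(_ isT).
rewrite !muleA -!EFinM mulfV ?gt_eqF// mul1r /c -powRD ?(gt_eqF h0) ?implybT//.
have -> : (dual p0)^-1 + (n%:R - \sum_(i < n) (tnth p i)^-1) =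
  n.+1%:R - \sum_(i < n.+1) (tnth [tuple of p0 :: p] i)^-1.
  by rewrite sum_inv_cons; have := dual_conj p01; rewrite -natr1; lra.
by [].
Qed.

End Cells.

(** * The one-third trick *)

Section ShiftedGrids.
Context {R : realType} (K : nat) (h : R).
Hypothesis h0 : 0 < h.
Notation I := 'I_(2 ^ K).

Lemma cell_exists (o x : R) : o <= x < o + h * (2 ^ K)%:R -> exists j : I, cell h o j x.
Proof.
move=> /andP[ox xo]; have z0 : 0 <= (x - o) / h by rewrite divr_ge0 ?subr_ge0// ltW.
have /andP[t1 t2] := truncn_itv z0; set j := Num.truncn _ in t1 t2.
have jK : (j < 2 ^ K)%N.
  rewrite -(ltr_nat R); apply: le_lt_trans t1 _; rewrite ltr_pdivrMr//; lra.
exists (Ordinal jK); rewrite /cell/=; apply/andP; split.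
  by move: t1; rewrite ler_pdivlMr//; lra.
by move: t2; rewrite ltr_pdivrMr//; lra.
Qed.

Lemma grid_point (o x y : R) (i j M : nat) : (0 < M)%N -> cell h o i x -> cell h o j y ->
  (i %/ M < j %/ M)%N -> x < o + h * (j %/ M * M)%:R <= y.
Proof.
move=> M0 /andP[_ x1] /andP[y0 _] ij.
have i1 : (i.+1 <= j %/ M * M)%N by rewrite -ltn_divLR.
apply/andP; split; first by apply: lt_le_trans x1 _; rewrite lerD2l ler_pM2l// ler_nat.
by apply: le_trans y0; rewrite lerD2l ler_pM2l// ler_nat leq_divM.
Qed.

(** The one-third trick: a grid and its translate by a third of the side of its root have
no two points at distance less than a third of the mesh, since 3 does not divide a power
of 2. *)
Lemma one_third (b x y D : R) (m : nat) (i j i' j' : nat) : (m <= K)%N ->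
  x <= y -> y - x <= D -> D < 2 ^+ m * h / 3 ->
  cell h b i x -> cell h b j y ->
  cell h (b - h * (2 ^ K)%:R / 3) i' x -> cell h (b - h * (2 ^ K)%:R / 3) j' y ->
  (i %/ 2 ^ m = j %/ 2 ^ m)%N \/ (i' %/ 2 ^ m = j' %/ 2 ^ m)%N.
Proof.
move=> mK xy yx Dm ci cj ci' cj'.
have M0 : (0 < 2 ^ m)%N by rewrite expn_gt0.
have mono (o : R) u v : cell h o u x -> cell h o v y -> (u <= v)%N.
  move=> /andP[ux _] /andP[_ yv]; rewrite -ltnS -(ltr_nat R) -(ltr_pM2l h0); lra.
have := leq_div2r (2 ^ m) (mono _ _ _ ci cj); rewrite leq_eqVlt => /predU1P[->|lt1]; first by left.
have := leq_div2r (2 ^ m) (mono _ _ _ ci' cj'); rewrite leq_eqVlt => /predU1P[->|lt2]; first by right.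
have /andP[] := grid_point M0 ci cj lt1; have /andP[] := grid_point M0 ci' cj' lt2.
set A := (j %/ _)%N; set B := (j' %/ _)%N.
rewrite -(subnK mK) expnD !natrM.
move Mh : (h * (2 ^ m)%:R) => e; have e0 : 0 < e by rewrite -Mh mulr_gt0// ltr0n.
have -> : h * (B%:R * (2 ^ m)%:R) = B%:R * e by rewrite -Mh; ring.
have -> : h * (A%:R * (2 ^ m)%:R) = A%:R * e by rewrite -Mh; ring.
have -> : h * ((2 ^ (K - m))%:R * (2 ^ m)%:R) = (2 ^ (K - m))%:R * e by rewrite -Mh; ring.
rewrite (_ : 2 ^+ m * h / 3 = e / 3) in Dm; last by rewrite -Mh natrX; ring.
set P := (2 ^ (K - m))%N => B1 B2 A1 A2.
have n3 (a c : nat) : (3 * a + c)%:R = 3 * a%:R + c%:R :> R by rewrite natrD natrM.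
have H1 : (3 * A + P < 3 * B + 1)%N.
  by rewrite -(ltr_nat R) -(ltr_pM2r e0) !n3; lra.
have H2 : (3 * B + 0 < 3 * A + (P + 1))%N.
  by rewrite -(ltr_nat R) -(ltr_pM2r e0) !n3 natrD; lra.
have : (3 %| P)%N.
  apply/dvdnP; exists (B - A)%N; move: H1 H2; move: (A) (B) (P) => a1 b1 c1; clear; lia.
by rewrite Euclid_dvdX.
Qed.

Definition shifted n (b : n.-tuple R) (tau : n.-tuple bool) : n.-tuple R :=
  [tuple tnth b i - (tnth tau i)%:R * (h * (2 ^ K)%:R / 3) | i < n].

Lemma slev_le n (a c : n.-tuple I) m :
  (forall i, (tnth a i %/ 2 ^ m = tnth c i %/ 2 ^ m)%N) -> (slev a c <= m)%N.
Proof.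
elim: n a c => [|n IH] a c; first by rewrite (tuple0 a) (tuple0 c).
case/tupleP: a => a0 a; case/tupleP: c => c0 c ac /=; rewrite geq_max lev_le; apply/andP; split.
  by apply/eqP; have := ac ord0; rewrite !tnth0.
by apply: IH => i; have := ac (lift ord0 i); rewrite !tnthS.
Qed.

(** The one-third trick in each coordinate, at the least common level whose third exceeds [D];
the factor 6 is 3 times the ratio 2 of successive levels. *)
Lemma shifted_grids n (b : n.-tuple R) (x y : Rn R n) (l D : R) :
  h * (2 ^ K)%:R = 4 * l -> cube b l x -> cube b l y ->
  (forall i, `|tnth x i - tnth y i| <= D) -> h <= D ->
  exists (tau : n.-tuple bool) (a c : n.-tuple I) m,
    [/\ forall i, cell h (tnth (shifted b tau) i) (tnth a i) (tnth x i),
        forall i, cell h (tnth (shifted b tau) i) (tnth c i) (tnth y i),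
        (slev a c <= m)%N & h * 2 ^+ m <= 6 * D].
Proof.
move=> hl xb yb xyD hD.
have l0 : 0 < l by rewrite -(pmulr_rgt0 _ (ltr0n R 4)) -hl mulr_gt0// ltr0n expn_gt0.
have exm : exists m, (D < 2 ^+ m * h / 3) || (m == K) by exists K; rewrite eqxx orbT.
have [m mP mmin] := ex_minnP exm.
have mK : (m <= K)%N by apply: mmin; rewrite eqxx orbT.
have hm : h * 2 ^+ m <= 6 * D.
  case: m mmin {mP mK} => [_|m mmin]; first by move: hD h0; clear; rewrite expr0 mulr1; lra.
  have := contra (mmin m); rewrite -ltnNge ltnSn => /(_ isT); rewrite negb_or => /andP[+ _].
  by rewrite -leNgt exprS; lra.
have ex (t : bool) (i : 'I_n) (z : Rn R n) : cube b l z ->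
    exists j : I, cell h (tnth b i - t%:R * (h * (2 ^ K)%:R / 3)) j (tnth z i).
  move=> zb; apply: cell_exists; have /andP[z1 z2] := zb i; rewrite hl.
  by case: t => /=; apply/andP; split; lra.
have one (i : 'I_n) : exists (t : bool) (j k : I),
    [/\ cell h (tnth b i - t%:R * (h * (2 ^ K)%:R / 3)) j (tnth x i),
        cell h (tnth b i - t%:R * (h * (2 ^ K)%:R / 3)) k (tnth y i) &
        (j %/ 2 ^ m = k %/ 2 ^ m)%N].
  have [j cj] := ex false i _ xb; have [k ck] := ex false i _ yb.
  have [j' cj'] := ex true i _ xb; have [k' ck'] := ex true i _ yb.
  have [/orP[DM|/eqP mE]] := (mP, erefl m); last first.
    by move=> _; exists false, j, k; split => //; rewrite mE !divn_small.
  move=> _; have := xyD i.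
  move: (cj) (ck) (cj') (ck'); rewrite /= mul0r subr0 mul1r => cj1 ck1 cj1' ck1' D1.
  have [xy|/ltW yx] := leP (tnth x i) (tnth y i).
    have [|E|E] := one_third mK xy _ DM cj1 ck1 cj1' ck1'.
    - by rewrite distrC ger0_norm ?subr_ge0 in D1.
    - by exists false, j, k.
    - by exists true, j', k'.
  have [|E|E] := one_third mK yx _ DM ck1 cj1 ck1' cj1'.
  - by rewrite ger0_norm ?subr_ge0 in D1.
  - by exists false, j, k.
  - by exists true, j', k'.
have [t Ht] := choice one; have [j Hj] := choice Ht; have [k Hk] := choice Hj.
exists [tuple t i | i < n], [tuple j i | i < n], [tuple k i | i < n], m; split => //.
- by move=> i; rewrite !tnth_mktuple; have [] := Hk i.
- by move=> i; rewrite !tnth_mktuple; have [] := Hk i.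
- by apply: slev_le => i; rewrite !tnth_mktuple; have [] := Hk i.
Qed.

End ShiftedGrids.

(** * Fractional integration on a cube *)

Section Kernel.
Context {R : realType} (n : nat).
Implicit Types x y : Rn R n.

Lemma eucl_dist_ge0 x y : 0 <= eucl_dist x y.
Proof. exact: sqrtr_ge0. Qed.

Lemma eucl_dist_coord x y i : `|tnth x i - tnth y i| <= eucl_dist x y.
Proof.
rewrite -sqrtr_sqr ler_wsqrtr// (bigD1 i)//= lerDl; apply: sumr_ge0 => j _; exact: sqr_ge0.
Qed.

Lemma eucl_dist_le x y (l : R) : 0 <= l -> (forall i, `|tnth x i - tnth y i| <= l) ->
  eucl_dist x y <= n%:R * l.
Proof.
move=> l0 H; have nl : 0 <= n%:R * l by rewrite mulr_ge0.
rewrite -(ger0_norm nl) -sqrtr_sqr ler_wsqrtr//.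
apply: (@le_trans _ _ (n%:R * l ^+ 2)); last first.
  rewrite exprMn ler_wpM2r ?sqr_ge0//; case: (n) => [|m]; first by rewrite expr0n.
  by rewrite expr2 ler_peMr// ler1n.
rewrite mulr_natl -[X in _ *+ X]card_ord -sumr_const; apply: ler_sum => i _.
by rewrite -real_normK ?num_real// ler_sqr ?nnegrE.
Qed.

Lemma measurable_eucl_dist :
  measurable_fun setT (fun z : Rn R n * Rn R n => eucl_dist z.1 z.2).
Proof.
apply: (measurableT_comp (f := @Num.sqrt R)).
  by apply: continuous_measurable_fun; exact: sqrt_continuous.
apply: measurable_sum => i; apply: measurable_funX; apply: measurable_funB.
  by apply: (measurableT_comp (measurable_tnth i)); exact: measurable_fst.
by apply: (measurableT_comp (measurable_tnth i)); exact: measurable_snd.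
Qed.

End Kernel.

Section LocalPotential.
Context {R : realType} (n K : nat) (h : R).
Hypothesis h0 : 0 < h.
Notation I := 'I_(2 ^ K).
Implicit Types (f : Rn R n -> \bar R) (o : n.-tuple R).

Lemma cell_indic1 o (a : n.-tuple I) (x : Rn R n) :
  (forall i, cell h (tnth o i) (tnth a i) (tnth x i)) -> cell_indic h o a x = 1.
Proof. by move=> H; apply: big1 => i _; rewrite /cellR H. Qed.

Lemma step_ge o (phi : seq I -> R) (a : n.-tuple I) (x : Rn R n) : nneg phi ->
  (forall i, cell h (tnth o i) (tnth a i) (tnth x i)) -> phi a <= step h o phi x.
Proof.
move=> phi0 /cell_indic1 H; rewrite /step (bigD1 a)//= H mulr1 lerDl.
by apply: sumr_ge0 => b _; rewrite mulr_ge0 ?cell_indic_ge0.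
Qed.

Lemma integral_step o f (psi : seq I -> R) : measurable_fun setT f -> enneg f -> nneg psi ->
  (\int[lebesgueRn R n]_y (f y * (step h o psi y)%:E) =
   \sum_(b : n.-tuple I) (psi b)%:E * cell_integral h o f b)%E.
Proof.
move=> mf f0 psi0.
have mc (b : n.-tuple I) : measurable_fun setT (fun y => f y * (cell_indic h o b y)%:E)%E.
  by apply: emeasurable_funM => //; apply/measurable_EFinP; exact: measurable_cell_indic.
transitivity (\int[lebesgueRn R n]_y \sum_(b : n.-tuple I) ((psi b)%:E * (f y * (cell_indic h o b y)%:E)))%E.
  apply: eq_integral => y _; rewrite /step -sumEFin ge0_sume_distrr => [|b _]; last first.
    by rewrite lee_fin mulr_ge0 ?cell_indic_ge0.
  by apply: eq_bigr => b _; rewrite EFinM muleCA.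
rewrite ge0_integral_sum//.
- apply: eq_bigr => b _; rewrite ge0_integralZl_EFin// => y _.
  by rewrite mule_ge0 ?lee_fin ?cell_indic_ge0.
- by move=> b; apply: emeasurable_funM.
- by move=> b y _; rewrite !mule_ge0 ?lee_fin ?cell_indic_ge0.
Qed.

(** Discrete norms take functions on sequences of indices of any length; hence the default
value 0. *)
Definition cell_mass o f (c : seq I) : R := oapp (fun b : n.-tuple I => fine (cell_integral h o f b)) 0 (insub c).

Lemma cell_integral_ge0 o f (b : n.-tuple I) : enneg f -> (0 <= cell_integral h o f b)%E.
Proof. by move=> f0; apply: integral_ge0 => y _; rewrite mule_ge0 ?lee_fin ?cell_indic_ge0. Qed.

Lemma cell_mass_ge0 o f : enneg f -> nneg (cell_mass o f).
Proof.
by move=> f0 c; rewrite /cell_mass; case: insub => //= b; apply/fine_ge0/cell_integral_ge0.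
Qed.

Lemma cell_massE o f (b : n.-tuple I) : measurable_fun setT f -> enneg f ->
  (\int[lebesgueRn R n]_y f y < +oo)%E -> (cell_mass o f b)%:E = cell_integral h o f b.
Proof.
move=> mf f0 foo; rewrite /cell_mass valK/= fineK// ge0_fin_numE ?cell_integral_ge0//.
apply: le_lt_trans foo; apply: le_integral_nonmeasurable => y.
  by rewrite mule_ge0 ?lee_fin ?cell_indic_ge0.
rewrite -[leRHS]mule1; apply: lee_wpmul2l => //; rewrite lee_fin.
by apply: prodr_ile1 => i _; rewrite /cellR ler0n lern1 leq_b1.
Qed.

(** At distances above the mesh, the kernel is at most a multiple of the dyadic kernel of one
of the translated grids, and so of the sum over all of them. *)
Lemma potential_le_steps (b : n.-tuple R) (l gam : R) f (x : Rn R n) :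
  h * (2 ^ K)%:R = 4 * l -> 0 <= gam -> measurable_fun setT f -> enneg f ->
  (forall y, ~ cube b l y -> f y = 0%E) -> (\int[lebesgueRn R n]_y f y < +oo)%E ->
  cube b l x ->
  (\int[lebesgueRn R n]_y (f y * (Num.max (eucl_dist x y) h `^ (- gam))%:E) <=
   \sum_(tau : n.-tuple bool) ((6 / h) `^ gam *
     step h (shifted K h b tau) (fun a : seq I => dsum n (fun c => dyadic_ker gam a c *
        cell_mass (shifted K h b tau) f c)) x)%:E)%E.
Proof.
move=> hl gam0 mf f0 fb foo xb.
pose G tau y := step h (shifted K h b tau) (fun a : seq I => step h (shifted K h b tau) (dyadic_ker gam a) y) x.
have G0 tau y : 0 <= G tau y by apply: step_ge0 => a; apply: step_ge0 => c; exact: dyadic_ker_ge0.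
have GE tau : (exists a : n.-tuple I, (forall phi, step h (shifted K h b tau) phi x = phi a)) \/
    (forall phi : seq I -> R, step h (shifted K h b tau) phi x = 0) by exact: stepP.
have mG tau : measurable_fun setT (G tau).
  have [[a Ha]|N] := GE tau.
    by rewrite (_ : G tau = step h (shifted K h b tau) (dyadic_ker gam a));
      [exact: measurable_step|apply/funext => y; rewrite /G Ha].
  by rewrite (_ : G tau = cst 0)//; apply/funext => y; rewrite /G N.
have c0 : 0 <= (6 / h) `^ gam by exact: powR_ge0.
have dom y : cube b l y -> Num.max (eucl_dist x y) h `^ (- gam) <=
    \sum_(tau : n.-tuple bool) (6 / h) `^ gam * G tau y.
  move=> yb; set D := Num.max _ _.
  have hD : h <= D by rewrite le_max lexx orbT.
  have xyD i : `|tnth x i - tnth y i| <= D by rewrite le_max eucl_dist_coord.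
  have [tau [a [c [m [ca cc acm hm]]]]] := shifted_grids h0 hl xb yb xyD hD.
  rewrite (bigD1 tau)//=; apply: ler_wpDr.
    by apply: sumr_ge0 => t _; apply: mulr_ge0.
  have D0 : 0 < D by exact: lt_le_trans hD.
  apply: (@le_trans _ _ ((6 / h) `^ gam * dyadic_ker gam a c)); last first.
    apply: ler_wpM2l => //; rewrite /G.
    pose phi (a' : seq I) := step h (shifted K h b tau) (dyadic_ker gam a') y.
    have phi0 : nneg phi by move=> a'; apply: step_ge0 => c'; exact: dyadic_ker_ge0.
    apply: le_trans (step_ge phi0 ca); apply: (step_ge (phi := dyadic_ker gam a)) => // c'.
    exact: dyadic_ker_ge0.
  have -> : dyadic_ker gam a c = (2 ^+ slev a c) `^ (- gam).
    rewrite /dyadic_ker; elim: (slev a c) => [|k IH]; first by rewrite !expr0 powR1.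
    by rewrite !exprS IH powRM// exprn_ge0.
  have hE : 6 / h = (h / 6)^-1 by rewrite invf_div.
  rewrite hE -powR_inv1 ?divr_ge0 ?(ltW h0)// -powRrM mulN1r.
  rewrite -powRM ?divr_ge0 ?exprn_ge0 ?(ltW h0)//.
  have u0 : 0 < h / 6 * 2 ^+ slev a c by rewrite mulr_gt0 ?divr_gt0 ?exprn_gt0.
  rewrite !powRN lef_pV2 ?posrE ?powR_gt0//.
  apply: ge0_ler_powR => //; rewrite ?nnegrE ?(ltW u0) ?(ltW D0)//.
  have : h * 2 ^+ slev a c <= h * 2 ^+ m.
    by rewrite ler_pM2l// ler_weXn2l// ler1n.
  lra.
apply: (@le_trans _ _ (\int[lebesgueRn R n]_y
    \sum_(tau : n.-tuple bool) (((6 / h) `^ gam)%:E * (f y * (G tau y)%:E)))%E).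
  apply: le_integral_nonmeasurable => y.
    by rewrite mule_ge0 ?lee_fin ?powR_ge0.
  have [yb|nyb] := pselect (cube b l y); last first.
    by rewrite (fb _ nyb) mul0e; apply: sume_ge0 => t _; rewrite mul0e mule0.
  have -> : (\sum_(tau : n.-tuple bool) (((6 / h) `^ gam)%:E * (f y * (G tau y)%:E)) =
      f y * (\sum_(tau : n.-tuple bool) (6 / h) `^ gam * G tau y)%:E)%E.
    rewrite -sumEFin ge0_sume_distrr => [|t _]; last by rewrite lee_fin mulr_ge0.
    by apply: eq_bigr => t _; rewrite EFinM muleCA.
  by apply: lee_wpmul2l => //; rewrite lee_fin; exact: dom.
have mfG tau : measurable_fun setT (fun y => f y * (G tau y)%:E)%E.
  by apply: emeasurable_funM => //; exact/measurable_EFinP.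
rewrite ge0_integral_sum//; last 2 first.
- by move=> t; apply: emeasurable_funM.
- by move=> t y _; rewrite !mule_ge0 ?lee_fin.
apply: lee_sum => tau _; rewrite ge0_integralZl_EFin//; last first.
  by move=> y _; rewrite mule_ge0 ?lee_fin.
rewrite EFinM; apply: lee_wpmul2l; first by rewrite lee_fin.
have [[a Ha]|N] := GE tau; last first.
  by rewrite N integral0_eq// => y _; rewrite /G N mule0.
rewrite Ha; under eq_integral do rewrite /G Ha.
rewrite integral_step//; last by move=> c; exact: dyadic_ker_ge0.
by rewrite /dsum -sumEFin; apply: lee_sum => c _; rewrite EFinM cell_massE.
Qed.

End LocalPotential.

Lemma le_limn_einf (R : realType) (u v : nat -> \bar R) :
  (forall k, u k <= v k)%E -> (limn_einf u <= limn_einf v)%E.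
Proof.
move=> uv; rewrite (limn_einfE u); apply: ge_ereal_sup => _ [n _ <-].
by apply: (limn_einf_ge (n := n)) => k nk; apply: le_trans (uv k); exact: einfs_le.
Qed.

Lemma measurable_eucl_dist2 (R : realType) n (x : Rn R n) : measurable_fun setT (eucl_dist x).
Proof.
exact: (measurableT_comp (@measurable_eucl_dist R n) (pair1_measurable x)).
Qed.

Section CubeBounds.
Context {R : realType} (n : nat).
Implicit Types f : Rn R n -> \bar R.

Lemma dnorm_const (ps : seq R) (r : R) : all (fun p => 0 < p) ps -> 0 <= r ->
  dnorm ps (fun _ : seq 'I_(2 ^ 0) => r) = r.
Proof.
move=> + r0; elim: ps => //= p ps IH /andP[p0 ps0]; rewrite -[RHS](IH ps0).
apply: eq_dnorm => _; rewrite lpE (_ : \sum_(x < 2 ^ 0) r `^ p = r `^ p); last first.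
  exact: big_ord1.
by rewrite powRK// gt_eqF.
Qed.

(** A cube is a single cell, so that averaging over cells contains Hölder's inequality. *)
Lemma integral_le_mixed_norm (p : n.-tuple R) (a : Rn R n) (l : R) f :
  all (fun x => 1 < x) p -> 0 < l -> measurable_fun setT f -> enneg f ->
  (forall x, ~ cube a l x -> f x = 0%E) ->
  (\int[lebesgueRn R n]_x f x <=
   ((2 * l) `^ (n%:R - \sum_(i < n) (tnth p i)^-1))%:E * mixed_norm (etuple p) f)%E.
Proof.
move=> p1 l0 mf f0 fa; have h0 : 0 < 2 * l by rewrite mulr_gt0.
have p0 : all (fun x => 0 < x) p by apply/allP => x /(allP p1); exact: lt_trans.
have cintE (b : n.-tuple 'I_(2 ^ 0)) : cell_integral (2 * l) a f b = (\int[lebesgueRn R n]_x f x)%E.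
  apply: eq_integral => x _; have [xa|xa] := pselect (cube a l x); last by rewrite fa// mul0e.
  rewrite cell_indic1 ?mule1// => i; have /andP[x1 x2] := xa i; rewrite /cell.
  have -> : nat_of_ord (tnth b i) = 0%N by case: (tnth b i) => -[].
  by apply/andP; split; lra.
have key (r : R) : 0 <= r -> (r%:E <= \int[lebesgueRn R n]_x f x)%E ->
    (r%:E <= ((2 * l) `^ (n%:R - \sum_(i < n) (tnth p i)^-1))%:E * mixed_norm (etuple p) f)%E.
  move=> r0 rf; apply: (@le_trans _ _ (dnorm p (fun _ : seq 'I_(2 ^ 0) => r))%:E).
    by rewrite lee_fin dnorm_const.
  by apply: (dnorm_cell_integral h0 (o := a)) => // b; rewrite cintE.
have : (0 <= \int[lebesgueRn R n]_x f x)%E by exact: integral_ge0.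
case: (\int[_]_x f x)%E key => [r|key _|//]; first by move=> key; rewrite lee_fin => r0; exact: key.
rewrite leye_eq; apply/eqP; apply/eqyP => A A0;
exact: le_trans (key A (ltW A0) (leey _)).
Qed.
End CubeBounds.

Lemma hls_exponentE (R : realType) n (p s : n.-tuple R) :
  hls_exponent p s = n%:R - \sum_(i < n) (tnth p i)^-1 + \sum_(i < n) (tnth s i)^-1.
Proof.
elim: n p s => [|n IH] p s; first by rewrite (tuple0 p) !big_ord0 subr0 addr0.
case/tupleP: p => p0 p; case/tupleP: s => s0 s /=; rewrite IH !sum_inv_cons -natr1.
by ring.
Qed.

Lemma all_hls_range (R : realType) n (p s : n.-tuple R) :
  all2 (fun p s => (1 < p) && (p <= s)) p s ->
  all (fun x => 1 < x) p /\ all (fun x => 1 < x) s.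
Proof.
elim: (val p) (val s) => [|u us IH] [|v vs]//= /andP[/andP[u1 uv] /IH[-> ->]].
by rewrite u1 (lt_le_trans u1 uv).
Qed.

Section LocalTheorem.
Context {R : realType}.

(** Fatou's lemma as the mesh tends to 0. *)
Lemma potential_le_limn (n : nat) (gam l : R) (x : Rn R n) (f : Rn R n -> \bar R) :
  0 < gam -> 0 < l -> measurable_fun setT f -> enneg f ->
  (\int[lebesgueRn R n]_y (f y * (eucl_dist x y `^ (- gam))%:E) <=
   limn_einf (fun K => \int[lebesgueRn R n]_y
     (f y * (Num.max (eucl_dist x y) (l / (2 ^ K)%:R) `^ (- gam))%:E)))%E.
Proof.
move=> g0 l0 mf f0.
pose F K y := (f y * (Num.max (eucl_dist x y) (l / (2 ^ K)%:R) `^ (- gam))%:E)%E.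
have F0 K y : (0 <= F K y)%E by rewrite mule_ge0 ?lee_fin ?powR_ge0.
have mF K : measurable_fun setT (F K).
  apply: emeasurable_funM => //; apply/measurable_EFinP.
  apply: (measurableT_comp (measurable_powR _)).
  by apply: measurable_maxr => //; exact: measurable_eucl_dist2.
apply: le_trans (fatou (lebesgueRn R n) measurableT mF (fun K y _ => F0 K y)).
apply: le_integral_nonmeasurable => y; first by rewrite mule_ge0 ?lee_fin ?powR_ge0.
have [d0|dn] := eqVneq (eucl_dist x y) 0.
  rewrite d0 powR0 ?oppr_eq0 ?gt_eqF// mule0.
  by apply: (limn_einf_ge (n := 0%N)) => k _; exact: F0.
have d0 : 0 < eucl_dist x y by rewrite lt0r dn eucl_dist_ge0.
have [N HN] : exists N, l / (2 ^ N)%:R <= eucl_dist x y.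
  exists (Num.bound (l / eucl_dist x y)); rewrite ler_pdivrMr ?ltr0n ?expn_gt0//.
  rewrite mulrC -ler_pdivrMr//; apply: le_trans (ltW (archi_boundP _)) _.
    by rewrite divr_ge0 ?ltW.
  by rewrite ler_nat ltnW// ltn_expl.
apply: (limn_einf_ge (n := N)) => k Nk; rewrite /F max_l//.
apply: le_trans HN; rewrite ler_pM2l// lef_pV2 ?posrE ?ltr0n ?expn_gt0//.
by rewrite ler_nat leq_pexp2l.
Qed.

(** The estimate on a cube: dyadic potentials of all sufficiently fine grids are bounded
uniformly in the mesh, and the powers of the mesh cancel. *)
Lemma local_potential n (p s : n.-tuple R) :
  all2 (fun p s => (1 < p) && (p <= s)) p s -> p != s ->
  exists C : R, 0 < C /\ forall (b : n.-tuple R) (l : R) (f : Rn R n -> \bar R),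
  0 < l -> measurable_fun setT f -> enneg f -> (forall y, ~ cube b l y -> f y = 0%E) ->
  (mixed_norm (etuple s) (fun x =>
     (\int[lebesgueRn R n]_y (f y * (eucl_dist x y `^ (- hls_exponent p s))%:E)) *
     (\1_(cube b l) x)%:E) <= C%:E * mixed_norm (etuple p) f)%E.
Proof.
move=> ps pns; set gam := hls_exponent p s.
have [p1 s1] := all_hls_range ps.
have s0 : all (fun x => 0 < x) s by apply/allP => x /(allP s1); exact: lt_trans.
have p0 : all (fun x => 0 < x) p by apply/allP => x /(allP p1); exact: lt_trans.
have pn0 : val p != [::].
  case: n p s ps pns {gam p1 s1 s0 p0} => [|n] p s _; first by rewrite (tuple0 p) (tuple0 s) eqxx.
  by case/tupleP: p.
have g0 : 0 < gam by exact: hls_exponent_gt0.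
have [C0 [C00 HC0]] := dyadic_hls ps pns.
pose N := #|{: n.-tuple bool}|; pose C1 := 6 `^ gam * C0.
have C10 : 0 <= C1 by rewrite mulr_ge0// powR_ge0.
exists (N%:R * C1 + 1); split; first by rewrite ltr_wpDl// mulr_ge0.
move=> b l f l0 mf f0 fb; set B := mixed_norm (etuple p) f.
have B0 : (0 <= B)%E by exact: mixed_norm_ge0.
have CB : ((N%:R * C1)%:E * B <= (N%:R * C1 + 1)%:E * B)%E.
  by apply: lee_wpmul2r => //; rewrite lee_fin lerDl.
have [Boo|Bfin] := eqVneq B +oo%E.
  by rewrite Boo gt0_muley ?leey// lte_fin ltr_wpDl// mulr_ge0.
apply: le_trans CB.
have foo : (\int[lebesgueRn R n]_y f y < +oo)%E.
  apply: le_lt_trans (integral_le_mixed_norm p1 l0 mf f0 fb) _.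
  by rewrite lte_mul_pinfty ?lee_fin ?powR_ge0// ltey.
have cancel_mesh (u : R) : 0 < u -> (6 / u) `^ gam * u `^ gam = 6 `^ gam.
  move=> u0; rewrite -powRM ?(ltW u0)//; last by rewrite divr_ge0 ?(ltW u0).
  by congr (_ `^ _); field; rewrite gt_eqF.
pose h K := 4 * l / (2 ^ K)%:R.
have h0 K : 0 < h K by rewrite divr_gt0 ?mulr_gt0// ltr0n expn_gt0.
have hl K : h K * (2 ^ K)%:R = 4 * l by rewrite /h divfK// gt_eqF// ltr0n expn_gt0.
pose phi K tau (a : seq 'I_(2 ^ K)) :=
  dsum n (fun c => dyadic_ker gam a c * cell_mass (h K) (shifted K (h K) b tau) f c).
have phi0 K tau : nneg (phi K tau).
  by move=> a; apply: dsum_ge0 => c; rewrite mulr_ge0 ?dyadic_ker_ge0 ?cell_mass_ge0.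
pose S K (tau : n.-tuple bool) x :=
  ((6 / h K) `^ gam * step (h K) (shifted K (h K) b tau) (phi K tau) x)%:E.
have S0 K tau x : (0 <= S K tau x)%E by rewrite lee_fin mulr_ge0 ?powR_ge0 ?step_ge0.
have mS K tau : measurable_fun setT (S K tau).
  by apply/measurable_EFinP; apply: measurable_funM => //; exact: measurable_step.
have Sn K tau : (mixed_norm (etuple s) (S K tau) <= C1%:E * B)%E.
  have HS : (mixed_norm (etuple s) (S K tau) <=
      ((6 / h K) `^ gam)%:E * mixed_norm (etuple s)
        (fun x => (step (h K) (shifted K (h K) b tau) (phi K tau) x)%:E))%E.
    apply: le_trans (le_mixed_normZ _ s0 (powR_ge0 _ _)); rewrite le_eqVlt; apply/orP; left.
    by apply/eqP; congr mixed_norm; apply/funext => x; exact: EFinM.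
  apply: (le_trans HS).
  have c0 : (0 <= ((6 / h K) `^ gam)%:E)%E by rewrite lee_fin powR_ge0.
  apply: (le_trans (lee_wpmul2l c0 (mixed_norm_step (h0 K) _ s0 (phi0 K tau)))).
  have A0 := cell_mass_ge0 (h K) (shifted K (h K) b tau) f0 : nneg (cell_mass (K := K) (h K) _ f).
  have := HC0 K _ A0; rewrite size_tuple -/gam => Hd.
  have HA (c : n.-tuple 'I_(2 ^ K)) : ((cell_mass (h K) (shifted K (h K) b tau) f c)%:E <=
      cell_integral (h K) (shifted K (h K) b tau) f c)%E by rewrite cell_massE.
  have Hc := dnorm_cell_integral (h0 K) p1 mf f0 A0 HA.
  set X := h K `^ (\sum_(i < n) (tnth s i)^-1).
  set Y := h K `^ (n%:R - \sum_(i < n) (tnth p i)^-1) in Hc.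
  have XY : (6 / h K) `^ gam * X * Y = 6 `^ gam.
    rewrite -mulrA /X /Y -powRD ?(gt_eqF (h0 K)) ?implybT//.
    have -> : \sum_(i < n) (tnth s i)^-1 + (n%:R - \sum_(i < n) (tnth p i)^-1) = gam.
      by rewrite /gam hls_exponentE addrC.
    exact: cancel_mesh.
  apply: (@le_trans _ _ (((6 / h K) `^ gam * X * C0)%:E *
      (dnorm p (cell_mass (h K) (shifted K (h K) b tau) f))%:E)%E).
    rewrite -!EFinM lee_fin -!mulrA; do 2 (apply: ler_wpM2l; first exact: powR_ge0).
    exact: Hd.
  have c1 : (0 <= ((6 / h K) `^ gam * X * C0)%:E)%E by rewrite lee_fin !mulr_ge0// powR_ge0.
  apply: (le_trans (lee_wpmul2l c1 Hc)).
  by rewrite muleA -EFinM mulrAC XY.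
have Sum K : (mixed_norm (etuple s) (fun x => \sum_(tau : n.-tuple bool) S K tau x) <=
    (N%:R * C1)%:E * B)%E.
  apply: le_trans (le_mixed_norm_sum _ _ (mS K) (S0 K)) _.
    by apply/allP => x /(allP s1)/ltW.
  apply: (@le_trans _ _ (\sum_(tau : n.-tuple bool) C1%:E * B)%E); first exact: lee_sum.
  have BE : B = (fine B)%:E by rewrite fineK// ge0_fin_numE// ltey.
  move: (fine B) BE => v ->; rewrite -EFinM (eq_bigr (fun=> (C1 * v)%:E))//.
  rewrite sumEFin sumr_const -EFinM lee_fin.
  by rewrite (_ : N%:R * C1 * v = (C1 * v) *+ N)// -[RHS]mulr_natl mulrA.
have mSum K : measurable_fun setT (fun x => \sum_(tau : n.-tuple bool) S K tau x)%E.
  exact: emeasurable_sum.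
have Sum0 K x : (0 <= \sum_(tau : n.-tuple bool) S K tau x)%E by exact: sume_ge0.
apply: le_trans (mixed_norm_fatou s0 mSum Sum0 Sum).
apply: le_mixed_norm; first exact: all_etuple s0.
move=> x; have [xb|xb] := pselect (cube b l x); last first.
  by rewrite indicE memNset// mule0 abse0.
rewrite indicE mem_set// mule1 gee0_abs; last first.
  by apply: integral_ge0 => y _; rewrite mule_ge0 ?lee_fin ?powR_ge0.
rewrite gee0_abs; last by apply: (limn_einf_ge (n := 0%N)).
have l40 : 0 < 4 * l by rewrite mulr_gt0.
apply: (le_trans (potential_le_limn x g0 l40 mf f0)); apply: le_limn_einf => K.
exact: (potential_le_steps (h0 K) (hl K) (ltW g0) mf f0 fb foo xb).
Qed.
End LocalTheorem.

(** * Cubes and Morrey norms *)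

Section Cubes.
Context {R : realType} (n : nat).
Implicit Types (a : Rn R n) (l : R) (f : Rn R n -> \bar R).

Lemma measurable_cube a l : measurable (cube a l).
Proof.
rewrite (_ : cube a l = \bigcap_(i in [set: 'I_n])
    ((fun x : Rn R n => tnth x i) @^-1` [set z | tnth a i <= z <= tnth a i + l])).
  apply: fin_bigcap_measurable => // i _; rewrite -[X in measurable X]setTI.
  by apply: (measurable_tnth i) => //; exact: measurable_closed_itv.
by apply/seteqP; split => [x xa i _|x xa i]; apply: xa.
Qed.

Lemma measurable_restrict_cube a l f : measurable_fun setT f ->
  measurable_fun setT (fun x => f x * (\1_(cube a l) x)%:E)%E.
Proof.
move=> mf; apply: emeasurable_funM => //; apply/measurable_EFinP.
by apply: measurable_indic; exact: measurable_cube.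
Qed.

End Cubes.

Lemma lebesgueRn_cube (R : realType) n (a : Rn R n) (l : R) : 0 < l ->
  lebesgueRn R n (cube a l) = (l ^+ n)%:E.
Proof.
move=> l0; elim: n a => [|n IH] a.
  by rewrite /= diracE mem_set// => -[].
case/tupleP: a => a0 a; rewrite /= /vcons_measure /pushforward.
rewrite (_ : _ @^-1` _ = [set x | a0 <= x <= a0 + l] `*` cube a l); last first.
  by apply/seteqP; split => -[x t] /cube_vcons.
rewrite product_measure1E; [|exact: measurable_closed_itv|exact: measurable_cube].
by rewrite IH exprS EFinM; congr (_ * _)%E; exact: lebesgue_itv.
Qed.

Section Morrey.
Context {R : realType} (n : nat).
Hypothesis n0 : (0 < n)%N.
Implicit Types (a : Rn R n) (l q : R) (f : Rn R n -> \bar R) (p : n.-tuple (\bar R)).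

Lemma morrey_weight p q a l : 0 < q -> 0 < l ->
  (lebesgueRn R n (cube a l) `^ (fine (q%:E)^-1 - n%:R^-1 * sum_recip p) =
   (l `^ (n%:R / q - sum_recip p))%:E)%E.
Proof.
move=> q0 l0; rewrite lebesgueRn_cube// poweR_EFin inver gt_eqF//=.
rewrite -powR_mulrn ?(ltW l0)// -powRrM mulrBr mulrA mulfV ?mul1r//.
by rewrite pnatr_eq0 -lt0n.
Qed.

Lemma le_mixed_norm_morrey p q f a l : 0 < q -> 0 < l ->
  (mixed_norm p (fun x => f x * (\1_(cube a l) x)%:E) <=
   (l `^ (sum_recip p - n%:R / q))%:E * morrey_norm p q%:E f)%E.
Proof.
move=> q0 l0; set e := sum_recip p - n%:R / q.
have w0 : 0 < l `^ (- e) by exact: powR_gt0.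
rewrite -(@lee_pmul2l _ (l `^ (- e))%:E)// ?lte_fin// muleA -EFinM -powRD; last first.
  by rewrite (gt_eqF l0) implybT.
rewrite addNr powRr0 mul1e; apply: ereal_sup_ubound; exists (cube a l); first by exists a, l.
by rewrite morrey_weight// opprB.
Qed.

Lemma morrey_norm_le p q f (B : \bar R) : 0 < q ->
  (forall a l, 0 < l -> (mixed_norm p (fun x => f x * (\1_(cube a l) x)%:E) <=
   (l `^ (sum_recip p - n%:R / q))%:E * B)%E) -> (morrey_norm p q%:E f <= B)%E.
Proof.
move=> q0 H; apply: ge_ereal_sup => _ [_ [a [l [l0 ->]]] <-].
rewrite morrey_weight//; set e := n%:R / q - sum_recip p.
have w0 : (0 <= (l `^ e)%:E)%E by rewrite lee_fin powR_ge0.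
apply: le_trans (lee_wpmul2l w0 (H a l l0)) _; rewrite muleA -EFinM -powRD; last first.
  by rewrite (gt_eqF l0) implybT.
by rewrite addrC subrKA subrr powRr0 mul1e.
Qed.

Lemma morrey_norm_ge0 p (q : \bar R) f : (0 <= morrey_norm p q f)%E.
Proof.
apply: le_trans (ereal_sup_ubound _); last by exists (cube [tuple 0 | i < n] 1); [exists [tuple 0 | i < n], 1|].
by rewrite mule_ge0 ?poweR_ge0 ?mixed_norm_ge0.
Qed.

Lemma sum_recip_etuple (s : n.-tuple R) : all (fun x => 0 < x) s ->
  sum_recip (etuple s) = \sum_(i < n) (tnth s i)^-1.
Proof.
move=> s0; apply: eq_bigr => i _; rewrite tnth_map inver gt_eqF//.
by have /all_tnthP := s0; apply.
Qed.

(** Hölder's inequality on the cube. *)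
Lemma le_mixed_norm_morrey_exponent (p : n.-tuple R) (p1 : n.-tuple (\bar R)) q f a l :
  all2 (fun (u : R) (v : \bar R) => (0 < u) && (u%:E <= v)%E) p p1 -> 0 < q -> 0 < l ->
  (mixed_norm (etuple p) (fun x => f x * (\1_(cube a l) x)%:E) <=
   (l `^ (\sum_(i < n) (tnth p i)^-1 - n%:R / q))%:E * morrey_norm p1 q%:E f)%E.
Proof.
move=> pp q0 l0; apply: le_trans (mixed_norm_exponent (a := a) pp l0 _) _.
  by move=> x xa; rewrite indicE memNset// mule0.
have w0 : (0 <= (l `^ (\sum_(i < n) (tnth p i)^-1 - sum_recip p1))%:E)%E.
  by rewrite lee_fin powR_ge0.
apply: le_trans (lee_wpmul2l w0 (le_mixed_norm_morrey p1 f a q0 l0)) _.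
rewrite muleA -EFinM -powRD; last by rewrite (gt_eqF l0) implybT.
by rewrite addrA subrK.
Qed.

Lemma mixed_norm_indicator (s : n.-tuple R) a l (c : R) : all (fun x => 0 < x) s ->
  0 < l -> 0 <= c ->
  (mixed_norm (etuple s) (fun x => c%:E * (\1_(cube a l) x)%:E) <=
   (c * (2 * l) `^ (\sum_(i < n) (tnth s i)^-1))%:E)%E.
Proof.
move=> s0 l0 c0; have h0 : 0 < 2 * l by rewrite mulr_gt0.
apply: (@le_trans _ _ (mixed_norm (etuple s)
    (fun x => (step (2 * l) a (fun _ : seq 'I_(2 ^ 0) => c) x)%:E))).
  apply: le_mixed_norm; first exact: all_etuple s0.
  move=> x; rewrite -EFinM !gee0_abs ?lee_fin ?step_ge0 ?mulr_ge0//.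
  have [xa|xa] := pselect (cube a l x); last by rewrite indicE memNset// mulr0 step_ge0.
  rewrite indicE mem_set// mulr1.
  apply: (step_ge (phi := fun=> c) (a := [tuple (ord0 : 'I_(2 ^ 0)) | i < n])) => // i.
  have /andP[x1 x2] := xa i; rewrite /cell tnth_mktuple /=.
  by apply/andP; split; lra.
apply: (le_trans (mixed_norm_step h0 a s0 (fun _ => c0))).
by rewrite dnorm_const// mulrC.
Qed.

End Morrey.

(** * Mass at a distance *)

Section FarPart.
Context {R : realType} (n : nat).
Implicit Types (a x y : Rn R n) (l gam nu A : R) (g : Rn R n -> \bar R).

Definition potential gam g x : \bar R :=
  (\int[lebesgueRn R n]_y (g y * (eucl_dist x y `^ (- gam))%:E))%E.

Lemma potential_ge0 gam g x : enneg g -> (0 <= potential gam g x)%E.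
Proof. by move=> g0; apply: integral_ge0 => y _; rewrite mule_ge0 ?lee_fin ?powR_ge0. Qed.

Lemma measurable_kernel gam x g : measurable_fun setT g ->
  measurable_fun setT (fun y => g y * (eucl_dist x y `^ (- gam))%:E)%E.
Proof.
move=> mg; apply: emeasurable_funM => //; apply/measurable_EFinP.
by apply: (measurableT_comp (measurable_powR _)); exact: measurable_eucl_dist2.
Qed.

Lemma measurable_potential gam g : measurable_fun setT g -> enneg g ->
  measurable_fun setT (potential gam g).
Proof.
move=> mg g0.
apply: (@measurable_fun_fubini_tonelli_F _ _ _ _ _ (lebesgueRn R n)
  (fun z : Rn R n * Rn R n => g z.2 * (eucl_dist z.1 z.2 `^ (- gam))%:E)%E).
  apply: emeasurable_funM; first by apply: (measurableT_comp mg); exact: measurable_snd.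
  apply/measurable_EFinP; apply: (measurableT_comp (measurable_powR _)).
  exact: measurable_eucl_dist.
by move=> z; rewrite mule_ge0 ?lee_fin ?powR_ge0.
Qed.

(** A cube of side exactly proportional to 2 ^ k that contains the 2 ^ k l-neighbourhood of
the given cube. *)
Definition corner a l k : Rn R n := [tuple tnth a i - 2 ^+ k * l | i < n].
Definition dilate a l k : set (Rn R n) := cube (corner a l k) (3 * 2 ^+ k * l).

Lemma dilateP a l k y : dilate a l k y <->
  forall i, tnth a i - 2 ^+ k * l <= tnth y i <= tnth a i + 2 * (2 ^+ k * l).
Proof.
split=> H i; have := H i; rewrite tnth_mktuple => /andP[H1 H2]; apply/andP; split => //; lra.
Qed.

Lemma dist_dilate a l k x y : 0 < l -> cube a l x -> ~ dilate a l k y ->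
  2 ^+ k * l <= eucl_dist x y.
Proof.
move=> l0 xa yn; rewrite leNgt; apply/negP => xy; apply: yn; apply/dilateP => i.
have := le_lt_trans (eucl_dist_coord x y i) xy; rewrite ltr_norml => /andP[d1 d2].
have /andP[x1 x2] := xa i.
have : l <= 2 ^+ k * l by rewrite ler_peMl ?(ltW l0) ?exprn_ege1 ?ler1n.
by move=> ll; apply/andP; split; lra.
Qed.

Lemma dilate_cover a l y : 0 < l -> exists k, dilate a l k y.
Proof.
move=> l0; pose S : R := \sum_(i < n) `|tnth y i - tnth a i|.
have S0 : 0 <= S by apply: sumr_ge0.
exists (Num.bound (S / l)); apply/dilateP => i.
have Si : `|tnth y i - tnth a i| <= S by rewrite /S (bigD1 i)//= lerDl sumr_ge0.
have Sl : S <= 2 ^+ Num.bound (S / l) * l.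
  rewrite -ler_pdivrMr//; apply: le_trans (ltW (archi_boundP _)) _; first exact: divr_ge0 S0 (ltW l0).
  by rewrite -natrX ler_nat ltnW// ltn_expl.
have := le_trans Si Sl; rewrite ler_norml => /andP[u1 u2].
by apply/andP; split; move: u1 u2; set t := 2 ^+ _ * l => u1 u2; lra.
Qed.

(** The mass between two successive dilates is at distance at least 2 ^ k l, and the resulting
series over the dyadic annuli is geometric with ratio 2 ^ (- nu). *)
Lemma far_potential a l gam nu A g x : 0 < l -> 0 < gam -> 0 < nu -> 0 <= A ->
  measurable_fun setT g -> enneg g ->
  (forall k, (\int[lebesgueRn R n]_y (g y * (\1_(dilate a l k.+1) y)%:E) <=
     (A * (2 ^+ k * l) `^ (gam - nu))%:E)%E) ->
  cube a l x ->
  (potential gam (fun y => g y * (\1_(~` dilate a l 0) y)%:E) x <=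
   (A * l `^ (- nu) / (1 - 2 `^ (- nu)))%:E)%E.
Proof.
move=> l0 gam0 nu0 A0 mg g0 HA xa.
have ml k : 0 < 2 ^+ k * l by rewrite mulr_gt0 ?exprn_gt0.
pose G k y := (g y * (\1_(dilate a l k.+1) y)%:E)%E.
have G0 k y : (0 <= G k y)%E by rewrite mule_ge0 ?lee_fin.
have mG k : measurable_fun setT (G k) by exact: measurable_restrict_cube.
pose c k := (2 ^+ k * l) `^ (- gam).
pose F N y := (\sum_(k < N) (c k)%:E * G k y)%E.
have c0 k : 0 <= c k by exact: powR_ge0.
have mF N : measurable_fun setT (F N).
  by apply: emeasurable_sum => k; apply: emeasurable_funM.
have F0 N y : (0 <= F N y)%E.
  by apply: sume_ge0 => k _; rewrite mule_ge0 ?lee_fin.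
have /andP[w0 w1] := @powR2N_lt1 R nu nu0.
apply: (@le_trans _ _ (\int[lebesgueRn R n]_y limn_einf (F^~ y))%E).
  apply: le_integral_nonmeasurable => y.
    by rewrite !mule_ge0 ?lee_fin ?powR_ge0.
  have L0 : (0 <= limn_einf (F^~ y))%E by apply: (limn_einf_ge (n := 0%N)).
  have [yn|yn] := pselect (dilate a l 0 y).
    by rewrite indicE memNset ?mule0 ?mul0e//; exact.
  rewrite indicE mem_set// mule1.
  have exk : exists k, `[< dilate a l k y >].
    by have [k yk] := dilate_cover a y l0; exists k; exact/asboolP.
  have [[|k] /asboolP yk kmin] := ex_minnP exk; first by [].
  have ynk : ~ dilate a l k y by move=> /asboolP/kmin; rewrite ltnn.
  apply: (limn_einf_ge (n := k.+1)) => N kN.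
  rewrite /F (bigD1 (Ordinal kN))//=; apply: le_trans (leeDl _ _); last first.
    by apply: sume_ge0 => i _; rewrite mule_ge0 ?lee_fin.
  rewrite /G indicE mem_set// mule1 muleC; apply: lee_wpmul2r => //; rewrite lee_fin /c.
  rewrite !powRN lef_pV2 ?posrE ?powR_gt0//; last first.
    by apply: lt_le_trans (ml k) _; exact: dist_dilate xa ynk.
  by apply: ler_powR_pow => //; [exact: ltW|exact: dist_dilate xa ynk].
apply: le_trans (fatou (lebesgueRn R n) measurableT mF (fun N y _ => F0 N y)) _.
apply: limn_einf_le => N; rewrite /F ge0_integral_sum//; last 2 first.
- by move=> k; apply: emeasurable_funM.
- by move=> k y _; rewrite mule_ge0 ?lee_fin.
apply: (@le_trans _ _ (\sum_(k < N) (A * l `^ (- nu) * (2 `^ (- nu)) ^+ k)%:E)%E).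
  apply: lee_sum => k _; rewrite ge0_integralZl_EFin//.
  have ck0 : (0 <= (c k)%:E)%E by rewrite lee_fin.
  apply: le_trans (lee_wpmul2l ck0 (HA k)) _.
  rewrite -EFinM lee_fin mulrCA -mulrA ler_wpM2l// /c -powRD ?(gt_eqF (ml k)) ?implybT//.
  rewrite addKr powRM ?exprn_ge0 ?(ltW l0)// mulrC.
  suff -> : (2 ^+ k : R) `^ (- nu) = (2 `^ (- nu)) ^+ k by [].
  elim: (nat_of_ord k) => [|j IH]; first by rewrite !expr0 powR1.
  by rewrite !exprS -IH powRM// exprn_ge0.
rewrite sumEFin lee_fin -mulr_sumr ler_wpM2l ?mulr_ge0 ?powR_ge0//.
have := @geo_sum_lt R (2 `^ (- nu)) 0 N; rewrite expr0 div1r big_mkord; apply.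
by rewrite powR_ge0.
Qed.

End FarPart.

(** * Potentials between Morrey spaces *)

Lemma mul_indic_in (R : realType) T (A : set T) (u : \bar R) x :
  A x -> (u * (\1_A x)%:E = u)%E.
Proof. by move=> xA; rewrite indicE mem_set// mule1. Qed.

Lemma mul_indic_out (R : realType) T (A : set T) (u : \bar R) x :
  ~ A x -> (u * (\1_A x)%:E = 0)%E.
Proof. by move=> xA; rewrite indicE memNset// mule0. Qed.

Lemma mul_indic_ge0 (R : realType) T (A : set T) (u : \bar R) x :
  (0 <= u)%E -> (0 <= u * (\1_A x)%:E)%E.
Proof. by move=> u0; rewrite mule_ge0 ?lee_fin. Qed.

Lemma le_mul_indic (R : realType) T (A : set T) (u v c : \bar R) x :
  (A x -> (u <= c * v)%E) -> (u * (\1_A x)%:E <= c * (v * (\1_A x)%:E))%E.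
Proof.
have [xA H|xA _] := pselect (A x); first by rewrite !(mul_indic_in _ xA); exact: H.
by rewrite !(mul_indic_out _ xA) mule0.
Qed.

Section Core.
Context {R : realType} (n : nat).
Implicit Types (a x y : Rn R n) (l : R) (g : Rn R n -> \bar R).

Lemma cube_dilate a l x : 0 < l -> cube a l x -> dilate a l 0 x.
Proof.
move=> l0 xa; apply/dilateP => i; have /andP[x1 x2] := xa i.
by rewrite expr0 mul1r; apply/andP; split; lra.
Qed.

Lemma potential_split gam g (A : set (Rn R n)) x : measurable A ->
  measurable_fun setT g -> enneg g ->
  potential gam g x = (potential gam (fun y => g y * (\1_A y)%:E) x +
    potential gam (fun y => g y * (\1_(~` A) y)%:E) x)%E.
Proof.
move=> mA mg g0.
have mI (B : set (Rn R n)) : measurable B -> measurable_fun setT (fun y => g y * (\1_B y)%:E)%E.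
  move=> mB; apply: emeasurable_funM => //; apply/measurable_EFinP; exact: measurable_indic.
rewrite /potential -ge0_integralD//.
- apply: eq_integral => y _; rewrite -ge0_muleDl ?mule_ge0 ?lee_fin//; congr (_ * _)%E.
  have [yA|yA] := pselect (A y).
    by rewrite !indicE mem_set// memNset ?mule1 ?mule0 ?adde0// => /(_ yA).
  by rewrite !indicE memNset// mem_set// mule1 mule0 add0e.
- by move=> y _; rewrite !mule_ge0 ?lee_fin ?powR_ge0.
- exact: measurable_kernel (mI _ mA).
- by move=> y _; rewrite !mule_ge0 ?lee_fin ?powR_ge0.
- by apply: measurable_kernel; apply: mI; exact: measurableC.
Qed.

(** On a bounded set, a less singular kernel is dominated by a more singular one. *)
Lemma potential_le_singular gam delta a l g x : 0 < l -> 0 < gam -> 0 <= delta ->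
  (forall y, ~ cube a l y -> g y = 0%E) -> enneg g -> cube a l x ->
  (potential gam g x <= ((n%:R * l) `^ delta)%:E * potential (gam + delta) g x)%E.
Proof.
move=> l0 gam0 d0 ga g0 xa.
apply: le_trans (le_integral_scale _ (powR_ge0 _ _) _); last first.
  by move=> y; rewrite mule_ge0 ?lee_fin ?powR_ge0.
apply: le_integral_nonmeasurable => y; first by rewrite mule_ge0 ?lee_fin ?powR_ge0.
have [ya|ya] := pselect (cube a l y); last by rewrite ga// !mul0e mule0.
rewrite muleCA; apply: lee_wpmul2l => //; rewrite -EFinM lee_fin.
have [e0|en] := eqVneq (eucl_dist x y) 0.
  by rewrite e0 powR0 ?oppr_eq0 ?gt_eqF// mulr_ge0 ?powR_ge0.
have e0 : 0 < eucl_dist x y by rewrite lt0r en eucl_dist_ge0.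
have enl : eucl_dist x y <= n%:R * l.
  apply: eucl_dist_le; first exact: ltW.
  move=> i; have /andP[x1 x2] := xa i; have /andP[y1 y2] := ya i.
  by rewrite ler_norml; apply/andP; split; lra.
have -> : eucl_dist x y `^ (- gam) = eucl_dist x y `^ delta * eucl_dist x y `^ (- (gam + delta)).
  by rewrite -powRD ?en ?implybT//; congr (_ `^ _); ring.
apply: ler_wpM2r; first exact: powR_ge0.
move: d0; rewrite le_eqVlt => /predU1P[<-|d0]; first by rewrite !powRr0.
exact: ler_powR_pow (ltW e0) enl.
Qed.

Variables (p s : n.-tuple R) (p1 : n.-tuple (\bar R)) (p2 : n.-tuple R) (alpha q1 q2 : R).
Hypotheses (alpha_gt0 : 0 < alpha) (alpha_ltn : alpha < n%:R) (q1_gt0 : 0 < q1) (q2_gt0 : 0 < q2).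
Hypothesis hq : q2^-1 = q1^-1 - alpha / n%:R.
Hypothesis ps : all2 (fun u v => (1 < u) && (u <= v)) p s.
Hypothesis pns : p != s.
Hypothesis pp1 : all2 (fun (u : R) (v : \bar R) => (0 < u) && (u%:E <= v)%E) p p1.
Hypothesis p2s : all2 (fun (u v : R) => (0 < u) && (u <= v)) p2 s.
Hypothesis psa : \sum_(i < n) (tnth p i)^-1 - \sum_(i < n) (tnth s i)^-1 <= alpha.

Notation P := (\sum_(i < n) (tnth p i)^-1).
Notation S := (\sum_(i < n) (tnth s i)^-1).
Notation nu := (n%:R / q2).

(** Fractional integration on each cube, and Hölder's inequality on the dyadic annuli
around it. *)
Lemma morrey_potential : exists C : R, 0 < C /\
  forall g, measurable_fun setT g -> enneg g ->
  (morrey_norm (etuple p2) q2%:E (potential (n%:R - alpha) g) <=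
   C%:E * morrey_norm p1 q1%:E g)%E.
Proof.
have nR : 0 < n%:R :> R by exact: lt_trans alpha_ltn.
have n0 : (0 < n)%N by rewrite -(ltr_nat R).
have nu0 : 0 < nu by rewrite divr_gt0.
have gam0 : 0 < n%:R - alpha by rewrite subr_gt0.
have nuE : n%:R / q1 = nu + alpha.
  by rewrite hq mulrBr [n%:R * (alpha / _)]mulrC divfK ?gt_eqF//; ring.
have [p10 s1] := all_hls_range ps.
have s0 : all (fun r : R => 0 < r) s by apply/allP => x /(allP s1); exact: lt_trans.
have p20 : all (fun r : R => 0 < r) p2.
  by elim: (val p2) (val s) p2s => [|u us IH] [|v vs]//= /andP[/andP[-> _] /IH].
have p2s' : all2 (fun (u : R) (v : \bar R) => (0 < u) && (u%:E <= v)%E) p2 (etuple s).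
  by rewrite /=; elim: (val p2) (val s) p2s => [|u us IH] [|v vs]//= /andP[/andP[u0 uv] /IH ->]; rewrite u0 lee_fin uv.
have [Cl [Cl0 HCl]] := local_potential ps pns.
pose delta := alpha - (P - S); have d0 : 0 <= delta by rewrite subr_ge0.
have hE : hls_exponent p s = n%:R - alpha + delta by rewrite hls_exponentE /delta; ring.
pose C1 := (n%:R `^ delta) * Cl * 3 `^ (S - nu).
pose C2 := 2 `^ (n%:R - P) * 6 `^ (n%:R - alpha - nu) / (1 - 2 `^ (- nu)) * 2 `^ S.
have C10 : 0 < C1 by rewrite !mulr_gt0 ?powR_gt0.
have /andP[w0 w1] := @powR2N_lt1 R nu nu0.
have C20 : 0 < C2 by rewrite !mulr_gt0 ?powR_gt0// invr_gt0 subr_gt0.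
exists (C1 + C2); split; first by rewrite addr_gt0.
move=> g mg g0; set M := morrey_norm p1 q1%:E g.
have M0 : (0 <= M)%E by exact: morrey_norm_ge0.
have [Moo|Mfin] := eqVneq M +oo%E.
  by rewrite Moo gt0_muley ?leey// lte_fin addr_gt0.
have ME : M = (fine M)%:E by rewrite fineK// ge0_fin_numE// ltey.
have m0 : 0 <= fine M by exact: fine_ge0.
have HM a l : 0 < l -> (mixed_norm (etuple p) (fun x => g x * (\1_(cube a l) x)%:E) <=
   (l `^ (P - n%:R / q1) * fine M)%:E)%E.
  move=> l0; rewrite EFinM -ME; exact: le_mixed_norm_morrey_exponent.
move: (fine M) ME m0 HM => m ME m0 HM; rewrite ME.
apply: morrey_norm_le => // a l l0.
have PR := mixed_norm_exponent (a := a) p2s' l0 (f := fun x => potential (n%:R - alpha) g x * (\1_(cube a l) x)%:E)%E.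
apply: le_trans (PR _) _ => [x xa|]; first by rewrite indicE memNset// mule0.
rewrite !sum_recip_etuple//.
suff main : (mixed_norm (etuple s) (fun x => potential (n%:R - alpha) g x * (\1_(cube a l) x)%:E) <=
    ((C1 + C2) * m * l `^ (S - nu))%:E)%E.
  have c0 : (0 <= (l `^ (\sum_(i < n) (tnth p2 i)^-1 - S))%:E)%E by rewrite lee_fin powR_ge0.
  apply: le_trans (lee_wpmul2l c0 main) _; rewrite -!EFinM lee_fin.
  rewrite mulrCA -powRD ?(gt_eqF l0) ?implybT// addrA subrK mulrC.
  exact: lexx.
pose Q0 := dilate a l 0.
have mQ0 : measurable Q0 by exact: measurable_cube.
pose g1 y := (g y * (\1_Q0 y)%:E)%E.
have g10 : enneg g1 by move=> y; rewrite mule_ge0 ?lee_fin.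
have mg1 : measurable_fun setT g1 by exact: measurable_restrict_cube.
have L0 : 0 < 3 * 2 ^+ 0 * l by rewrite !mulr_gt0.
have near : (mixed_norm (etuple s) (fun x => potential (n%:R - alpha) g1 x * (\1_Q0 x)%:E) <=
    (C1 * m * l `^ (S - nu))%:E)%E.
  have g1Q y : ~ cube (corner a l 0) (3 * 2 ^+ 0 * l) y -> g1 y = 0%E.
    by move=> yQ; rewrite /g1 indicE memNset// mule0.
  have c0 : 0 <= (n%:R * (3 * 2 ^+ 0 * l)) `^ delta by exact: powR_ge0.
  have c0E : (0 <= ((n%:R * (3 * 2 ^+ 0 * l)) `^ delta)%:E)%E by rewrite lee_fin.
  apply: (@le_trans _ _ (mixed_norm (etuple s) (fun x => ((n%:R * (3 * 2 ^+ 0 * l)) `^ delta)%:E *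
      (potential (hls_exponent p s) g1 x * (\1_Q0 x)%:E)))%E).
    apply: le_mixed_norm; first exact: all_etuple s0.
    move=> x; have u0 := potential_ge0 (n%:R - alpha) x g10.
    have v0 := potential_ge0 (hls_exponent p s) x g10.
    rewrite (gee0_abs (mul_indic_ge0 Q0 x u0)) gee0_abs; last first.
      exact: mule_ge0 c0E (mul_indic_ge0 Q0 x v0).
    apply: le_mul_indic => // xQ; rewrite hE.
    exact: (potential_le_singular L0 gam0 d0 g1Q g10 xQ).
  apply: le_trans (le_mixed_normZ _ s0 c0) _.
  apply: le_trans (lee_wpmul2l c0E (HCl _ _ _ L0 mg1 g10 g1Q)) _.
  have Cl0E : (0 <= Cl%:E)%E by rewrite lee_fin ltW.
  apply: le_trans (lee_wpmul2l c0E (lee_wpmul2l Cl0E (HM _ _ L0))) _.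
  rewrite -!EFinM lee_fin expr0 mulr1 powRM ?mulr_ge0 ?(ltW l0)//.
  have -> : n%:R `^ delta * (3 * l) `^ delta * (Cl * ((3 * l) `^ (P - n%:R / q1) * m)) =
      n%:R `^ delta * Cl * ((3 * l) `^ delta * (3 * l) `^ (P - n%:R / q1)) * m by ring.
  have l30 : 0 < 3 * l by rewrite mulr_gt0.
  rewrite -powRD ?(gt_eqF l30) ?implybT//.
  have -> : delta + (P - n%:R / q1) = S - nu by rewrite nuE /delta; ring.
  rewrite powRM ?(ltW l0)// /C1 le_eqVlt; apply/orP; left; apply/eqP; ring.
pose A := 2 `^ (n%:R - P) * 6 `^ (n%:R - alpha - nu) * m.
have A0 : 0 <= A by rewrite !mulr_ge0 ?powR_ge0.
have HA k : (\int[lebesgueRn R n]_y (g y * (\1_(dilate a l k.+1) y)%:E) <=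
     (A * (2 ^+ k * l) `^ (n%:R - alpha - nu))%:E)%E.
  have t0 : 0 < 2 ^+ k * l by rewrite mulr_gt0 ?exprn_gt0.
  have Lk : 0 < 3 * 2 ^+ k.+1 * l by rewrite !mulr_gt0 ?exprn_gt0.
  apply: le_trans (integral_le_mixed_norm (a := corner a l k.+1) p10 Lk _ _ _) _.
  - exact: measurable_restrict_cube.
  - by move=> y; rewrite mule_ge0 ?lee_fin.
  - by move=> y yQ; rewrite indicE memNset// mule0.
  have c0 : (0 <= ((2 * (3 * 2 ^+ k.+1 * l)) `^ (n%:R - P))%:E)%E by rewrite lee_fin powR_ge0.
  apply: le_trans (lee_wpmul2l c0 (HM _ _ Lk)) _; rewrite -EFinM lee_fin.
  rewrite powRM ?(ltW Lk)// mulrA -[_ * _ * _ `^ (P - _)]mulrA -powRD ?(gt_eqF Lk) ?implybT//.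
  have -> : n%:R - P + (P - n%:R / q1) = n%:R - alpha - nu by rewrite nuE; ring.
  have -> : 3 * 2 ^+ k.+1 * l = 6 * (2 ^+ k * l) by rewrite exprS; ring.
  rewrite powRM ?(ltW t0)// /A le_eqVlt; apply/orP; left; apply/eqP; ring.
pose c := A * l `^ (- nu) / (1 - 2 `^ (- nu)).
have c0 : 0 <= c by rewrite !mulr_ge0 ?powR_ge0// invr_ge0 subr_ge0 ltW.
have far := mixed_norm_indicator a s0 l0 c0.
apply: (@le_trans _ _ (mixed_norm (etuple s) (fun x => potential (n%:R - alpha) g1 x * (\1_Q0 x)%:E +
    c%:E * (\1_(cube a l) x)%:E))%E).
  apply: le_mixed_norm; first exact: all_etuple s0.
  move=> x; have t0 := potential_ge0 (n%:R - alpha) x g0.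
  have u0 := potential_ge0 (n%:R - alpha) x g10.
  have c0E : (0 <= c%:E)%E by rewrite lee_fin.
  have uc0 := adde_ge0 (mul_indic_ge0 Q0 x u0) (mul_indic_ge0 (cube a l) x c0E).
  rewrite (gee0_abs (mul_indic_ge0 (cube a l) x t0)) (gee0_abs uc0).
  have [xa|xa] := pselect (cube a l x); last by rewrite (mul_indic_out _ xa).
  have xQ : Q0 x by exact: cube_dilate.
  rewrite !(mul_indic_in _ xa) (mul_indic_in _ xQ) (potential_split _ _ mQ0 mg g0).
  apply: leeD2l; exact: (far_potential l0 gam0 nu0 A0 mg g0 HA xa).
apply: le_trans (le_mixed_normD _ _ _ _ _) _.
- by apply/allP => x /(allP s1)/ltW.
- by apply: measurable_restrict_cube; exact: measurable_potential.
- apply: emeasurable_funM => //; apply/measurable_EFinP; apply: measurable_indic.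
  exact: measurable_cube.
- by move=> x; apply/mul_indic_ge0/potential_ge0.
- by move=> x; apply: mul_indic_ge0; rewrite lee_fin.
apply: le_trans (leeD near far) _; rewrite -EFinD lee_fin.
rewrite powRM ?(ltW l0)// /c /A /C2 powRD ?(gt_eqF l0) ?implybT//.
by rewrite le_eqVlt; apply/orP; left; apply/eqP; ring.
Qed.

End Core.

(** * Borel versions of Lebesgue measurable functions *)

Lemma null_bigcup_count (R : realType) n (I : countType) (N : I -> set (Rn R n)) :
  measurable (\bigcup_r N r) -> (forall r, measurable (N r)) ->
  (forall r, lebesgueRn R n (N r) = 0%E) -> lebesgueRn R n (\bigcup_r N r) = 0%E.
Proof.
move=> mN mNr N0; apply/negligibleP => //.
have -> : \bigcup_r N r = \bigcup_k (if unpickle k is Some r then N r else set0).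
  apply/seteqP; split => x.
    by move=> [r _ Nx]; exists (pickle r) => //; rewrite pickleK.
  by move=> [k _]; case: unpickle => // r Nx; exists r.
apply: negligible_bigcup => k; case: unpickle => [r|]; last exact: negligible_set0.
exact: (negligibleP _ (mNr r)).2 (N0 r).
Qed.

Lemma completed_algebraP (R : realType) n (A : set (Rn R n)) :
  completed_algebra_gen (lebesgueRn R n) A -> exists B N : set (Rn R n),
  [/\ measurable B, measurable N, lebesgueRn R n N = 0%E & A `&` ~` N = B `&` ~` N].
Proof.
move=> [B mB [M [N [mN N0 MN]] <-]]; exists B, N; split => //.
apply/seteqP; split => x [].
  by move=> [Bx|/MN Nx] nNx; split.
by move=> Bx nNx; split => //; left.
Qed.

(** A Lebesgue measurable function agrees with a Borel function off a Borel null set: the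
exceptional sets of countably many level sets suffice. *)
Lemma borel_version (R : realType) n (f : Rn R n -> R) : lebesgue_measurable f ->
  exists (g : Rn R n -> R) (N : set (Rn R n)), [/\ measurable_fun setT g, measurable N,
    lebesgueRn R n N = 0%E & forall x, ~ N x -> f x = g x].
Proof.
move=> lf.
have H (r : rat) : exists N : set (Rn R n), exists B : set (Rn R n),
    [/\ measurable B, measurable N, lebesgueRn R n N = 0%E &
        f @^-1` `]ratr r, +oo[%classic `&` ~` N = B `&` ~` N].
  have [B [N HN]] := completed_algebraP (lf _ (measurable_itv `]ratr r, +oo[)).
  by exists N, B.
have [N HN] := choice H; have [B HB] := choice HN.
pose M := \bigcup_(r : rat) N r.
have mM : measurable M by apply: bigcupT_measurable_rat => r; have [] := HB r.
have M0 : lebesgueRn R n M = 0%E.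
  by apply: null_bigcup_count => // r; have [] := HB r.
exists (fun x => f x * \1_(~` M) x), M; split => // [|x nMx]; last first.
  by rewrite indicE mem_set// mulr1.
have mC : measurable (~` M) by exact: measurableC.
have fM (r : rat) : f @^-1` `]ratr r, +oo[%classic `&` ~` M = B r `&` ~` M.
  have [_ _ _ E] := HB r.
  have NM : ~` M = ~` N r `&` ~` M.
    by apply/seteqP; split => x; [move=> nM; split => // Nx; apply: nM; exists r|case].
  by rewrite NM setIA E setIA.
apply: (measurability _ (RGenOInfty.measurableE R)) => _ [_ [c ->] <-]; rewrite setTI.
rewrite (_ : _ @^-1` _ = (\bigcup_(r : rat) (if c < ratr r then B r `&` ~` M else set0)) `|`
    (if c < 0 then M else set0)); last first.
  apply/seteqP; split => x /=; rewrite in_itv/= andbT.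
    have [Mx|nMx] := pselect (M x).
      by rewrite indicE memNset// mulr0 => c0; right; rewrite c0.
    rewrite indicE mem_set// mulr1 => /rat_in_itvoo[r]; rewrite in_itv/= => /andP[cr rf].
    by left; exists r => //=; rewrite cr -fM; split => //=; rewrite in_itv/= rf.
  case=> [[r _]|]; case: ifPn => //.
    move=> cr; rewrite -fM => -[/=]; rewrite in_itv/= andbT => rf nMx.
    by rewrite indicE mem_set// mulr1 (lt_trans cr).
  by move=> c0 Mx; rewrite indicE memNset// mulr0.
apply: measurableU; last by case: ifP.
apply: bigcupT_measurable_rat => r; case: ifP => // _; apply: measurableI => //.
by have [] := HB r.
Qed.

(** * The Riesz potential and the choice of exponents *)

(** The integral is a difference of two nonnegative ones, each at most the right-hand side;
where it is oo - oo, that is -oo, the right-hand side is infinite. *)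
Lemma abse_integral_le d (T : measurableType d) (R : realType)
    (mu : {measure set T -> \bar R}) (h : T -> \bar R) :
  (`|\int[mu]_y h y| <= \int[mu]_y `|h y|)%E.
Proof.
set J := (\int[mu]_y `|h y|)%E; rewrite integralE.
have a0 : (0 <= \int[mu]_y h^\+ y)%E by exact: integral_ge0.
have b0 : (0 <= \int[mu]_y h^\- y)%E by exact: integral_ge0.
have aJ : (\int[mu]_y h^\+ y <= J)%E.
  by apply: le_integral_nonmeasurable => // y; rewrite funeposE ge_max lee_abs abse_ge0.
have bJ : (\int[mu]_y h^\- y <= J)%E.
  by apply: le_integral_nonmeasurable => // y; rewrite funenegE ge_max -abseN lee_abs abse_ge0.
move: (\int[mu]_y h^\+ y)%E (\int[mu]_y h^\- y)%E J a0 b0 aJ bJ => a b J.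
case: J => [J||]; [|by rewrite !leey|by move=> a0 _ /(le_trans a0)].
case: a => [a||]//; case: b => [b||]//; rewrite -EFinB abse_EFin !lee_fin => a0 b0 aJ bJ.
by rewrite ler_norml; apply/andP; split; lra.
Qed.

Section Reduction.
Context {R : realType} (n : nat).

Lemma riesz_le_potential (alpha : R) (f g : Rn R n -> R) (N : set (Rn R n)) x :
  measurable N -> lebesgueRn R n N = 0%E -> (forall y, ~ N y -> f y = g y) ->
  (`|riesz_potential alpha f x| <= potential (n%:R - alpha) (fun y => `|g y|%:E) x)%E.
Proof.
move=> mN N0 fg; apply: le_trans (abse_integral_le _ _) _.
apply: (le_integral_off_null mN N0) => [//|y|y /fg fgy].
  by rewrite mule_ge0 ?lee_fin ?powR_ge0.
rewrite -EFinM abse_EFin lee_fin normrM powRN fgy ler_wpM2l//.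
by rewrite normfV ger0_norm ?powR_ge0.
Qed.

Lemma all2_tnth (T1 T2 : Type) (r : T1 -> T2 -> bool) (a : n.-tuple T1) (b : n.-tuple T2) :
  (forall i, r (tnth a i) (tnth b i)) -> all2 r a b.
Proof.
elim: n a b => [|m IH] a b H; first by rewrite (tuple0 a) (tuple0 b).
case/tupleP: a H => a0 a; case/tupleP: b => b0 b H /=; apply/andP; split.
  by have := H ord0; rewrite !tnth0.
by apply: IH => i; have := H (lift ord0 i); rewrite !tnthS.
Qed.

(** Passing to the absolute value of a Borel version of [f], it suffices to find finite
exponents [p] below [p1] and [s] above [p2] whose gap is at most [alpha]. *)
Lemma riesz_morrey_bound (alpha q1 q2 : R) (p1 p2 : n.-tuple (\bar R)) (p s : 'I_n -> R) :
  0 < alpha -> alpha < n%:R -> 0 < q1 -> 0 < q2 -> q2^-1 = q1^-1 - alpha / n%:R ->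
  (forall i, 1 < p i <= s i) -> (exists i, p i != s i) ->
  (forall i, ((p i)%:E <= tnth p1 i)%E) ->
  (forall i, (0 < tnth p2 i)%E /\ (tnth p2 i <= (s i)%:E)%E) ->
  \sum_(i < n) (p i)^-1 - \sum_(i < n) (s i)^-1 <= alpha ->
  exists C : R, 0 < C /\
    forall f : Rn R n -> R, morrey_space p1 q1%:E f ->
      (morrey_norm p2 q2%:E (riesz_potential alpha f) <=
         C%:E * morrey_norm p1 q1%:E (EFin \o f))%E.
Proof.
move=> alpha0 alphan q10 q20 hq ps [i0 pns] pp1 p2s psa.
pose p' := [tuple p i | i < n]; pose s' := [tuple s i | i < n].
pose p2' := [tuple fine (tnth p2 i) | i < n].
have p2E : p2 = etuple p2'.
  apply: eq_from_tnth => i; rewrite tnth_map tnth_mktuple fineK//.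
  have [p20 p2s'] := p2s i; rewrite fin_numE gt_eqF ?(lt_trans _ p20)//= lt_eqF//.
  by rewrite (le_lt_trans p2s')// ltry.
have p20 i : (0 < tnth p2' i).
  by have [] := p2s i; rewrite {1}p2E tnth_map lte_fin.
have h1 : all2 (fun u v => (1 < u) && (u <= v)) p' s'.
  by apply: all2_tnth => i; rewrite !tnth_mktuple.
have h2 : p' != s'.
  by apply: contra pns => /eqP E; rewrite -(tnth_mktuple p i0) -/p' E tnth_mktuple.
have h3 : all2 (fun (u : R) (v : \bar R) => (0 < u) && (u%:E <= v)%E) p' p1.
  apply: all2_tnth => i; rewrite tnth_mktuple pp1 andbT.
  by have /andP[p1i _] := ps i; rewrite (lt_trans _ p1i).
have h4 : all2 (fun u v : R => (0 < u) && (u <= v)) p2' s'.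
  apply: all2_tnth => i; rewrite p20/= [tnth s' i]tnth_mktuple -lee_fin.
  by have [_] := p2s i; rewrite {1}p2E tnth_map.
have h5 : \sum_(i < n) (tnth p' i)^-1 - \sum_(i < n) (tnth s' i)^-1 <= alpha.
  by under eq_bigr do rewrite tnth_mktuple; under [X in _ - X]eq_bigr do rewrite tnth_mktuple.
have [C [C0 HC]] := morrey_potential alpha0 alphan q10 q20 hq h1 h2 h3 h4 h5.
exists C; split => // f [mf _].
have [g [N [mg mN N0 fg]]] := borel_version mf.
pose G (y : Rn R n) : \bar R := `|g y|%:E.
have mG : measurable_fun setT G by apply/measurable_EFinP; exact: measurableT_comp.
have G0 : enneg G by move=> y; rewrite lee_fin.
have p1all : all (fun u => 0 < u)%E p1.
  apply/all_tnthP => i; apply: lt_le_trans (pp1 i); rewrite lte_fin.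
  by have /andP[p1i _] := ps i; rewrite (lt_trans _ p1i).
have p2all : all (fun u => 0 < u)%E p2 by apply/all_tnthP => i; have [] := p2s i.
apply: (@le_trans _ _ (morrey_norm p2 q2%:E (potential (n%:R - alpha) G))).
  apply: ge_ereal_sup => _ [Q Qc <-].
  apply: le_trans (ereal_sup_ubound _); last by exists Q.
  apply: lee_wpmul2l; first exact: poweR_ge0.
  apply: le_mixed_norm => // x; rewrite !abseM; apply: lee_wpmul2r; first exact: abse_ge0.
  rewrite (gee0_abs (potential_ge0 _ _ G0)).
  exact: (riesz_le_potential _ _ mN N0 fg).
rewrite p2E; apply: le_trans (HC G mG G0) _.
apply: lee_wpmul2l; first by rewrite lee_fin ltW.
apply: ge_ereal_sup => _ [Q Qc <-].
apply: le_trans (ereal_sup_ubound _); last by exists Q.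
apply: lee_wpmul2l; first exact: poweR_ge0.
apply: (le_mixed_norm_off_null p1all mN N0) => x /fg fgx.
by rewrite !abseM; apply: lee_wpmul2r; rewrite ?abse_ge0// /G /= fgx normr_id.
Qed.

End Reduction.

(** Equal exponents leave no room for fractional integration in any variable; raising the
target exponents slightly costs an arbitrarily small part of the order of the potential. *)
Lemma raise_exponent (R : realType) n (alpha : R) (p : 'I_n -> R) :
  0 < alpha -> alpha < n%:R -> (forall i, 1 < p i) ->
  exists s : 'I_n -> R, [/\ forall i, 1 < p i <= s i, exists i, p i != s i &
    \sum_(i < n) (p i)^-1 - \sum_(i < n) (s i)^-1 <= alpha].
Proof.
move=> a0 an p1; have nR := lt_trans a0 an.
have n0 : (0 < n)%N by rewrite -(ltr_nat R).
have p0 i : 0 < p i by exact: lt_trans (p1 i).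
pose e := alpha / n%:R / 2; have e0 : 0 < e by rewrite !divr_gt0.
have e1 : e < 1.
  by rewrite /e ltr_pdivrMr// mul1r ltr_pdivrMr//; lra.
have lts i : p i < p i / (1 - e).
  by rewrite ltr_pdivlMr ?subr_gt0// gtr_pMr//; lra.
exists (fun i => p i / (1 - e)); split.
- by move=> i; rewrite p1 ltW.
- by exists (Ordinal n0); rewrite lt_eqF.
- rewrite -sumrB; apply: (@le_trans _ _ (\sum_(i < n) e)).
    apply: ler_sum => i _; rewrite invf_div.
    have -> : (p i)^-1 - (1 - e) / p i = e * (p i)^-1 by ring.
    by rewrite ger_pMr// invf_le1// ltW.
  by rewrite sumr_const card_ord -mulr_natr /e mulrAC divfK ?gt_eqF//; lra.
Qed.

Theorem corollary5p6 (R : realType) (n : nat) (alpha q1 q2 : R)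
    (p1 p2 : n.-tuple (\bar R))
    (alpha_gt0 : 0 < alpha) (alpha_ltn : alpha < n%:R)
    (q1_gt0 : 0 < q1) (q2_gt0 : 0 < q2)
    (hq1 : n%:R / q1 <= sum_recip p1)
    (hq2 : n%:R / q2 <= sum_recip p2)
    (hcases :
      [\/ [/\ forall i, (1 < tnth p1 i)%E /\ (tnth p1 i <= tnth p2 i)%E /\
                        (tnth p2 i < +oo)%E,
              p1 <> p2 &
              sum_recip p1 - sum_recip p2 <= alpha],
          forall i, (0 < tnth p2 i)%E /\ (tnth p2 i < tnth p1 i)%E /\
                    (tnth p1 i <= +oo)%E /\ (1 < tnth p1 i)%E |
          [/\ forall i, (0 < tnth p2 i)%E /\ (tnth p2 i < +oo)%E,
              forall i, (1 < tnth p1 i)%E /\ (tnth p1 i < +oo)%E &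
              \sum_(i < n) Num.max (fine (tnth p1 i)^-1%E - fine (tnth p2 i)^-1%E) 0
                < alpha]])
    (hq : q2^-1 = q1^-1 - alpha / n%:R) :
  exists C : R, 0 < C /\
    forall f : Rn R n -> R, morrey_space p1 q1%:E f ->
      (morrey_norm p2 q2%:E (riesz_potential alpha f) <=
         C%:E * morrey_norm p1 q1%:E (EFin \o f))%E.
Proof.
have fineE (x : \bar R) : (0 < x)%E -> (x < +oo)%E -> x = (fine x)%:E.
  by move=> x0 xoo; rewrite fineK// ge0_fin_numE// ltW.
have recipE (x : \bar R) : (0 < x)%E -> (x < +oo)%E -> fine x^-1%E = (fine x)^-1.
  move=> x0 xoo; rewrite [in LHS](fineE x x0 xoo) inver gt_eqF//.
  by rewrite -lte_fin -fineE.
have reduce := riesz_morrey_bound alpha_gt0 alpha_ltn q1_gt0 q2_gt0 hq.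
case: hcases => [[H pne psa]|H|[H2 H1 psa]].
- have p10 i : (0 < tnth p1 i)%E by have [h _] := H i; exact: lt_trans h.
  have p1oo i : (tnth p1 i < +oo)%E by have [_ [h1 h2]] := H i; exact: le_lt_trans h2.
  have p20 i : (0 < tnth p2 i)%E by have [_ [h _]] := H i; exact: lt_le_trans h.
  have p2oo i : (tnth p2 i < +oo)%E by have [_ []] := H i.
  apply: (reduce _ _ (fun i => fine (tnth p1 i)) (fun i => fine (tnth p2 i))).
  + move=> i; have [h1 [h2 _]] := H i.
    by rewrite -!lte_fin -lee_fin -!fineE// h1 h2.
  + apply: contrapT => N; apply: pne; apply: eq_from_tnth => i.
    apply: contrapT => ne; apply: N; exists i; apply/eqP => E; apply: ne.
    by rewrite (fineE _ (p10 i) (p1oo i)) E -fineE.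
  + by move=> i; rewrite -fineE.
  + by move=> i; rewrite -fineE.
  + move: psa; rewrite /sum_recip; congr (_ - _ <= _).
    * by apply: eq_bigr => i _; exact: recipE.
    * by apply: eq_bigr => i _; exact: recipE.
(* an infinite component of p1 is replaced by a finite one that still exceeds p2 *)
- pose p i : R := if tnth p1 i is u%:E then u else Num.max 1 (fine (tnth p2 i)) + 1.
  have pP i : [/\ 1 < p i, ((p i)%:E <= tnth p1 i)%E & (tnth p2 i <= (p i)%:E)%E].
    have [p20 [p21 [_ p11]]] := H i; rewrite /p.
    case E : (tnth p1 i) p21 p11 => [u||]//= p21; first by split => //; exact: ltW.
    move=> _; rewrite leey; split => //.
      by apply: (@le_lt_trans _ _ (Num.max 1 (fine (tnth p2 i)))); rewrite ?le_max ?lexx// ltrDl.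
    rewrite {1}(fineE _ p20 p21) lee_fin; apply: ler_wpDr => //.
    by rewrite le_max lexx orbT.
  have p1' i : 1 < p i by have [] := pP i.
  have [s [ps pns psa]] := raise_exponent alpha_gt0 alpha_ltn p1'.
  apply: (reduce _ _ p s) => // i; have [_ h1 h2] := pP i => //; split; first by have [] := H i.
  by apply: le_trans h2 _; rewrite lee_fin; have /andP[] := ps i.
- have p10 i : (0 < tnth p1 i)%E by have [h _] := H1 i; exact: lt_trans h.
  have p1oo i : (tnth p1 i < +oo)%E by have [] := H1 i.
  have p20 i : (0 < tnth p2 i)%E by have [] := H2 i.
  have p2oo i : (tnth p2 i < +oo)%E by have [] := H2 i.
  (* the maximum of the two exponents, unless it is p1 *)
  pose p i := fine (tnth p1 i); pose t i := Num.max (p i) (fine (tnth p2 i)).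
  have p1' i : 1 < p i by rewrite -lte_fin -fineE//; have [] := H1 i.
  have p0 i : 0 < p i by exact: lt_trans (p1' i).
  have pp1 i : ((p i)%:E <= tnth p1 i)%E by rewrite -fineE.
  have p2t i : (tnth p2 i <= (t i)%:E)%E.
    by rewrite {1}(fineE _ (p20 i) (p2oo i)) lee_fin le_max lexx orbT.
  have pt i : 1 < p i <= t i by rewrite p1' le_max lexx.
  have [ne|Ne] := pselect (exists i, p i != t i).
    apply: (reduce _ _ p t) => //; rewrite -sumrB; apply: le_trans (ltW psa).
    apply: ler_sum => i _; rewrite !recipE// -/(p i) /t le_max.
    by have [h|h] := leP (p i) (fine (tnth p2 i)); rewrite ?subrr lexx ?orbT.
  have [s [ps pns psa']] := raise_exponent alpha_gt0 alpha_ltn p1'.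
  apply: (reduce _ _ p s) => // i; split => //; apply: le_trans (p2t i) _; rewrite lee_fin.
  have -> : t i = p i by apply/eqP; rewrite eq_sym; apply: contra_notT Ne => h; exists i.
  by have /andP[] := ps i.
Qed.
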